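(* Let $V$ be a simple vertex operator algebra, $G$ a finite group of automorphisms of $V$, and $\mathcal S$ a finite $G$-stable set of pairwise inequivalent irreducible $V$-modules. Let $\mathcal M=\bigoplus_{M\in\mathcal S}M$, and let $A_\alpha(G,\mathcal S)$ be the associative algebra determined by the action of $G$ on $\mathcal S$, acting on $\mathcal M$ (see context). Let $\mathcal S=\bigcup_{j\in J}\mathcal O_j$ be the decomposition into $G$-orbits, fix $M^j\in\mathcal O_j$, and let $\Lambda_j$, $W_\lambda$, $M^j_\lambda$ and $W_{j,\lambda}$ ($j\in J$, $\lambda\in\Lambda_j$) be as in the context. Then as an $A_\alpha(G,\mathcal S)\otimes V^G$-module, $$\mathcal M=\bigoplus_{j\in J,\ \lambda\in\Lambda_j}W_{j,\lambda}\otimes M^j_\lambda .$$ Moreover: 1) Each $M^j_\lambda$ is a nonzero irreducible $V^G$-module. 2) $M^{j_1}_{\lambda_1}$ and $M^{j_2}_{\lambda_2}$ are isomorphic $V^G$-modules if and only if $j_1=j_2$ and $\lambda_1=\lambda_2$. That is, $(A_\alpha(G,\mathcal S),V^G)$ forms a dual pair on $\mathcal M$ (every simple $A_\alpha(G,\mathcal S)$-module occurs in $\mathcal M$, its multiplicity space is an irreducible $V^G$-module, and inequivalent simple modules have inequivalent multiplicity spaces).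
   Context: Vertex operator algebras $V=(V,Y,\mathbf 1,\omega)$ are over $\mathbb C$ in the usual sense (Borcherds, Frenkel–Lepowsky–Meurman): $V=\bigoplus_{n\in\mathbb Z}V_n$ with $\dim V_n<\infty$ and $V_n=0$ for $n$ sufficiently negative. $V$ is simple if it has no nontrivial ideals. An automorphism of $V$ is a linear automorphism $g$ with $g\mathbf 1=\mathbf 1$, $g\omega=\omega$, $gY(v,z)g^{-1}=Y(gv,z)$. $V^G=\{v\in V\mid gv=v\ \forall g\in G\}$ is a vertex operator subalgebra. A weak $V$-module $M$ is a vector space with a linear map $v\mapsto Y_M(v,z)=\sum_{n\in\mathbb Q}v_nz^{-n-1}$, $v_n\in\mathrm{End}\,M$, such that for $u,v\in V$, $w\in M$: $u_lw=0$ for $l\gg0$, $Y_M(\mathbf 1,z)=1$, and the Jacobi identity $z_0^{-1}\delta(\frac{z_1-z_2}{z_0})Y_M(u,z_1)Y_M(v,z_2)-z_0^{-1}\delta(\frac{z_2-z_1}{-z_0})Y_M(v,z_2)Y_M(u,z_1)=z_2^{-1}\delta(\frac{z_1-z_0}{z_2})Y_M(Y(u,z_0)v,z_2)$ holds, with $\delta(z)=\sum_{n\in\mathbb Z}z^n$. A $V$-module is a weak $V$-module $M=\bigoplus_{\lambda\in\mathbb C}M_\lambda$ with $M_\lambda=\{w: L(0)w=\lambda w\}$ finite dimensional and, for fixed $\lambda$, $M_{\lambda+n}=0$ for all sufficiently small integers $n$; here $Y_M(\omega,z)=\sum_n L(n)z^{-n-2}$. For a $V$-module $M$ and $g\in G$,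 $M\circ g$ is the $V$-module equal to $M$ as a vector space with $Y_{M\circ g}(v,z)=Y_M(gv,z)$. A set $\mathcal S$ of irreducible $V$-modules is $G$-stable if for all $M\in\mathcal S$, $g\in G$ there is $N\in\mathcal S$ with $M\circ g\cong N$. When the members of $\mathcal S$ are pairwise inequivalent, $M\cdot g=N$ iff $M\circ g\cong N$ defines a right action of $G$ on $\mathcal S$. For $N\in\mathcal S$ and $x\in G$ fix a linear isomorphism $\phi_N(x):N\to N\cdot x^{-1}$ with $\phi_N(x)Y_N(v,z)\phi_N(x)^{-1}=Y_{N\cdot x^{-1}}(xv,z)$ for all $v\in V$, with $\phi_N(1)=\mathrm{id}$. Define $\alpha_N(y,x)\in\mathbb C^*$ by $\phi_{N\cdot x^{-1}}(y)\phi_N(x)=\alpha_N(y,x)\phi_N(yx)$. $A_\alpha(G,\mathcal S)$ is the associative algebra with basis $a\otimes e(M)$ ($a\in G$, $M\in\mathcal S$) and product $(a\otimes e(M))\cdot(b\otimes e(N))=\alpha_N(a,b)\,\delta_{M\cdot b,N}\,ab\otimes e(N)$. It acts on $\mathcal M$ by $(a\otimes e(M))\cdot w=\delta_{M,N}\phi_M(a)w$ for $w\in N$; this action commutes with that of $V^G$. For $M\in\mathcal S$: $G_M=\{g\in G\mid M\circ g\cong M\}$, $D(M)=\mathrm{span}\{a\otimes e(M)\mid a\in G\}$, and $S(M)=\mathrm{span}\{a\otimes e(M)\mid a\in G_M\}$, a subalgebra which is identified via $a\otimes e(M)\mapsto\bar a$ with the twisted group algebra $\mathbb C^{\alpha_M}[G_M]$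 (basis $\{\bar g\mid g\in G_M\}$, $\bar x\bar y=\alpha_M(x,y)\overline{xy}$). $\Lambda_j$ is the set of irreducible characters of $\mathbb C^{\alpha_{M^j}}[G_{M^j}]$; for $\lambda\in\Lambda_j$, $W_\lambda$ is the corresponding simple module, $M^j_\lambda=\mathrm{Hom}_{\mathbb C^{\alpha_{M^j}}[G_{M^j}]}(W_\lambda,M^j)$ is its multiplicity space in $M^j$ (with $V^G$ acting through $M^j$), and $W_{j,\lambda}=\mathrm{Ind}_{S(M^j)}^{D(M^j)}W_\lambda=D(M^j)\otimes_{S(M^j)}W_\lambda$, an $A_\alpha(G,\mathcal S)$-module by left multiplication on $D(M^j)$. *)

(* Defs.v *)
From HB Require Import structures.
From mathcomp Require Import all_boot all_order all_algebra all_fingroup.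
From mathcomp Require Import boolp classical_sets cardinality reals complex.

Set Implicit Arguments.
Unset Strict Implicit.
Unset Printing Implicit Defensive.
Import Order.TTheory GRing.Theory Num.Theory.
Local Open Scope ring_scope.
Local Open Scope quotient_scope.

Definition is_linear (K : numFieldType) (U W : lmodType K) (f : U -> W) : Prop :=
  forall c u v, f (c *: u + v) = c *: f u + f v.

Definition is_subspace (K : numFieldType) (U : lmodType K) (P : U -> Prop) : Prop :=
  P 0 /\ forall c u v, P u -> P v -> P (c *: u + v).

Record subspace (K : numFieldType) (U : lmodType K) := Subspace {
  sp_pred :> U -> Prop;
  sp_closed : is_subspace sp_pred
}.

Section SubspaceType.
Variables (K : numFieldType) (U : lmodType K) (P : subspace U).

Definition sp_bool : pred U := fun u => `[< P u >].

Record sub_lmod := SubLmod { sm_val : U; sm_valP : sp_bool sm_val }.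

HB.instance Definition _ := [isSub for sm_val].
HB.instance Definition _ := [Choice of sub_lmod by <:].

Fact sp_bool_closed : GRing.subsemimod_closed sp_bool.
Proof.
have [P0 PD] := sp_closed P; split; first split.
- exact/asboolP.
- move=> u v /asboolP Pu /asboolP Pv; apply/asboolP.
  by rewrite -[u]scale1r; apply: PD.
- move=> c u /asboolP Pu; apply/asboolP.
  by rewrite -[_ *: _]addr0; apply: PD.
Qed.

HB.instance Definition _ :=
  GRing.SubChoice_isSubLmodule.Build K U sp_bool sub_lmod sp_bool_closed.

Definition sub_elt (u : U) (Pu : P u) : sub_lmod := SubLmod (asboolT Pu).

Lemma sub_eltP (x : sub_lmod) : P (val x).
Proof. exact/asboolP/(valP x). Qed.

Lemma sub_valD (c : K) (x y : sub_lmod) : val (c *: x + y) = c *: val x + val y.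
Proof. exact: linearP. Qed.
End SubspaceType.

Section DProd.
Variables (K : numFieldType) (I : Type) (U : I -> lmodType K).

Definition dprod : Type := forall i, U i.

HB.instance Definition _ := gen_eqMixin dprod.
HB.instance Definition _ := gen_choiceMixin dprod.

Definition dprod_add (f g : dprod) : dprod := fun i => f i + g i.
Definition dprod_opp (f : dprod) : dprod := fun i => - f i.
Definition dprod_zero : dprod := fun i => 0.
Definition dprod_scale (c : K) (f : dprod) : dprod := fun i => c *: f i.

Fact dprod_addA : associative dprod_add.
Proof. by move=> f g h; apply: functional_extensionality_dep => i; apply: addrA. Qed.
Fact dprod_addC : commutative dprod_add.
Proof. by move=> f g; apply: functional_extensionality_dep => i; apply: addrC. Qed.
Fact dprod_add0 : left_id dprod_zero dprod_add.
Proof. by move=> f; apply: functional_extensionality_dep => i; apply: add0r. Qed.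
Fact dprod_addN : left_inverse dprod_zero dprod_opp dprod_add.
Proof. by move=> f; apply: functional_extensionality_dep => i; apply: addNr. Qed.

HB.instance Definition _ :=
  GRing.isZmodule.Build dprod dprod_addA dprod_addC dprod_add0 dprod_addN.

Fact dprod_scaleA a b (f : dprod) :
  dprod_scale a (dprod_scale b f) = dprod_scale (a * b) f.
Proof. by apply: functional_extensionality_dep => i; apply: scalerA. Qed.
Fact dprod_scale1 : left_id 1 dprod_scale.
Proof. by move=> f; apply: functional_extensionality_dep => i; apply: scale1r. Qed.
Fact dprod_scaleDr : right_distributive dprod_scale +%R.
Proof. by move=> c f g; apply: functional_extensionality_dep => i; apply: scalerDr. Qed.
Fact dprod_scaleDl (f : dprod) : {morph dprod_scale^~ f : a b / a + b}.
Proof. by move=> a b; apply: functional_extensionality_dep => i; apply: scalerDl. Qed.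

HB.instance Definition _ := GRing.Zmodule_isLmodule.Build K dprod
  dprod_scaleA dprod_scale1 dprod_scaleDr dprod_scaleDl.

Definition fin_supp (f : dprod) : Prop :=
  finite_set [set i | f i <> 0]%classic.

Fact fin_supp_subspace : is_subspace fin_supp.
Proof.
split=> [|c f g finf fing].
  rewrite /fin_supp (_ : [set _ | _]%classic = set0) //.
  by apply/seteqP; split=> i //=; apply.
apply: sub_finite_set (_ : finite_set ([set i | f i <> 0] `|` [set i | g i <> 0])%classic).
  move=> i /= nz; case: (pselect (f i = 0)) => [f0|]; last by left.
  right=> g0; apply: nz; rewrite -[LHS]/(c *: f i + g i).
  by rewrite f0 g0 scaler0 addr0.
by rewrite finite_setU.
Qed.

Definition dsum : lmodType K := sub_lmod (Subspace fin_supp_subspace).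

Definition dcoord (x : dsum) (i : I) : U i := sm_val x i.

Lemma dsum_eqP (x y : dsum) : (forall i, dcoord x i = dcoord y i) -> x = y.
Proof. by move=> eqxy; apply/val_inj/functional_extensionality_dep. Qed.

Lemma dcoordD (c : K) (x y : dsum) i :
  dcoord (c *: x + y) i = c *: dcoord x i + dcoord y i.
Proof. by rewrite /dcoord -/(val (c *: x + y)) sub_valD. Qed.

Definition dinj_fun (i : I) (u : U i) : dprod := fun j =>
  if pselect (i = j) is left e then eq_rect i (fun k => U k) u j e else 0.

Fact dinj_fin (i : I) (u : U i) : fin_supp (dinj_fun u).
Proof.
apply: sub_finite_set (finite_set1 i) => j /=.
by rewrite /dinj_fun; case: pselect.
Qed.

Definition dinj (i : I) (u : U i) : dsum :=
  sub_elt (P := Subspace fin_supp_subspace) (dinj_fin u).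

Lemma dinj_eq (i : I) (u : U i) : dcoord (dinj u) i = u.
Proof.
rewrite /dcoord /= /dinj_fun; case: pselect => // e.
by rewrite (Prop_irrelevance e erefl).
Qed.

Lemma dinj_neq (i j : I) (u : U i) : i <> j -> dcoord (dinj u) j = 0.
Proof. by rewrite /dcoord /= /dinj_fun; case: pselect. Qed.

Lemma dinjD (i : I) (c : K) (u v : U i) :
  dinj (c *: u + v) = c *: dinj u + dinj v.
Proof.
apply: dsum_eqP => j; rewrite dcoordD.
case: (pselect (i = j)) => [<-|nij]; first by rewrite !dinj_eq.
by rewrite !dinj_neq // scaler0 addr0.
Qed.

Lemma dinj_inj (i : I) (u v : U i) : dinj u = dinj v -> u = v.
Proof. by move=> e; rewrite -[u]dinj_eq e dinj_eq. Qed.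
End DProd.
Arguments dinj {K I U} i u.

(* btensor r l is the quotient of U (x) W by the relations
   r i u (x) w = u (x) l i w.  With r and l the actions of a ring on a right
   module U and on a left module W this is the tensor product over that ring;
   with no operators at all it is the tensor product over K.  A finite formal
   sum of pairs stands for a sum of pure tensors, and two formal sums are
   identified when no balanced bilinear map separates them. *)
Section Tensor.
Variables (K : numFieldType) (U W : lmodType K) (I : Type).
Variables (r : I -> U -> U) (l : I -> W -> W).

Definition balanced (Z : lmodType K) (b : U -> W -> Z) : Prop :=
  [/\ forall w, is_linear (fun u => b u w),
      forall u, is_linear (b u)
    & forall i u w, b (r i u) w = b u (l i w)].

Definition tens_eval (Z : lmodType K) (b : U -> W -> Z) (s : seq (U * W)) : Z :=
  \sum_(p <- s) b p.1 p.2.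

Definition tens_rel : rel (seq (U * W)) := fun s t =>
  `[< forall (Z : lmodType K) (b : U -> W -> Z),
        balanced b -> tens_eval b s = tens_eval b t >].

Fact tens_rel_equiv : equiv_class_of tens_rel.
Proof.
split=> [s|s t|t s q]; first exact/asboolP.
- by apply/asboolP/asboolP => h Z b hb; rewrite h.
- by move=> /asboolP h1 /asboolP h2; apply/asboolP => Z b hb; rewrite h1 ?h2.
Qed.

Canonical tens_equiv := EquivRelPack tens_rel_equiv.

Definition btensor : Type := {eq_quot tens_equiv}.

HB.instance Definition _ := Choice.on btensor.

Definition tens_cls (s : seq (U * W)) : btensor := generic_quotient.pi {eq_quot tens_equiv} s.
Definition tens_repr (x : btensor) : seq (U * W) :=
  generic_quotient.repr (x : {eq_quot tens_equiv}).

Lemma tens_evalK (Z : lmodType K) (b : U -> W -> Z) s :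
  balanced b -> tens_eval b (tens_repr (tens_cls s)) = tens_eval b s.
Proof.
move=> hb; have := @reprK _ {eq_quot tens_equiv} (tens_cls s).
by move/eqmodP/asboolP; apply.
Qed.

Lemma btensorP (x y : btensor) :
  (forall (Z : lmodType K) (b : U -> W -> Z), balanced b ->
     tens_eval b (tens_repr x) = tens_eval b (tens_repr y)) -> x = y.
Proof.
move=> h; rewrite -[x](@reprK _ {eq_quot tens_equiv}) -[y](@reprK _ {eq_quot tens_equiv}).
exact/eqmodP/asboolP.
Qed.

Definition tens_scales (c : K) (s : seq (U * W)) := [seq (c *: p.1, p.2) | p <- s].

Lemma tens_eval_cat (Z : lmodType K) (b : U -> W -> Z) s t :
  tens_eval b (s ++ t) = tens_eval b s + tens_eval b t.
Proof. by rewrite /tens_eval big_cat. Qed.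

Lemma tens_eval_scale (Z : lmodType K) (b : U -> W -> Z) c s :
  balanced b -> tens_eval b (tens_scales c s) = c *: tens_eval b s.
Proof.
case=> bl _ _; rewrite /tens_eval big_map /= scaler_sumr.
apply: eq_bigr => p _; have b0 : b 0 p.2 = 0.
  by apply: (addrI (b 0 p.2)); rewrite -{1}[b 0 p.2]scale1r -(bl p.2) scaler0 !addr0.
by rewrite -[c *: p.1]addr0 bl b0 addr0.
Qed.

Definition btensor_add (x y : btensor) := tens_cls (tens_repr x ++ tens_repr y).
Definition btensor_scale (c : K) (x : btensor) := tens_cls (tens_scales c (tens_repr x)).
Definition btensor_zero : btensor := tens_cls [::].
Definition btensor_opp := btensor_scale (-1).

Let tE := (tens_evalK, tens_eval_cat, tens_eval_scale).

Fact btensor_addA : associative btensor_add.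
Proof. by move=> x y z; apply: btensorP => Z b hb; rewrite !tE // addrA. Qed.
Fact btensor_addC : commutative btensor_add.
Proof. by move=> x y; apply: btensorP => Z b hb; rewrite !tE // addrC. Qed.
Fact btensor_add0 : left_id btensor_zero btensor_add.
Proof.
by move=> x; apply: btensorP => Z b hb; rewrite !tE // /tens_eval big_nil add0r.
Qed.
Fact btensor_addN : left_inverse btensor_zero btensor_opp btensor_add.
Proof.
move=> x; apply: btensorP => Z b hb; rewrite !tE //.
by rewrite scaleN1r addNr /tens_eval big_nil.
Qed.

HB.instance Definition _ :=
  GRing.isZmodule.Build btensor btensor_addA btensor_addC btensor_add0 btensor_addN.

Fact btensor_scaleA a b (x : btensor) :
  btensor_scale a (btensor_scale b x) = btensor_scale (a * b) x.
Proof. by apply: btensorP => Z f hf; rewrite !tE // scalerA. Qed.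
Fact btensor_scale1 : left_id 1 btensor_scale.
Proof. by move=> x; apply: btensorP => Z f hf; rewrite !tE // scale1r. Qed.
Fact btensor_scaleDr : right_distributive btensor_scale +%R.
Proof. by move=> c x y; apply: btensorP => Z f hf; rewrite !tE // scalerDr. Qed.
Fact btensor_scaleDl (x : btensor) : {morph btensor_scale^~ x : a b / a + b}.
Proof. by move=> a b; apply: btensorP => Z f hf; rewrite !tE // scalerDl. Qed.

HB.instance Definition _ := GRing.Zmodule_isLmodule.Build K btensor
  btensor_scaleA btensor_scale1 btensor_scaleDr btensor_scaleDl.

Definition tens (u : U) (w : W) : btensor := tens_cls [:: (u, w)].

Definition tens_lift (Z : lmodType K) (b : U -> W -> Z) (x : btensor) : Z :=
  tens_eval b (tens_repr x).

Lemma tens_lift_lin (Z : lmodType K) (b : U -> W -> Z) :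
  balanced b -> is_linear (tens_lift b).
Proof. by move=> hb c x y; rewrite /tens_lift !tE. Qed.

Lemma tens_liftE (Z : lmodType K) (b : U -> W -> Z) u w :
  balanced b -> tens_lift b (tens u w) = b u w.
Proof. by move=> hb; rewrite /tens_lift tE // /tens_eval big_seq1. Qed.

Lemma tens_balanced : balanced tens.
Proof.
by split=> [w c u v|u c w w'|i u w]; apply: btensorP => Z b hb; rewrite !tE //;
  case: (hb) => bl br bb; rewrite /tens_eval !big_seq1 ?bl ?br ?bb.
Qed.

Lemma tens_sum (x : btensor) : x = \sum_(p <- tens_repr x) tens p.1 p.2.
Proof.
rewrite -[LHS](@reprK _ {eq_quot tens_equiv}) -/(tens_repr x); elim: (tens_repr x) => [|p s IH].
  by rewrite big_nil.
rewrite big_cons -IH; apply: btensorP => Z b hb.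
by rewrite !tE // /tens_eval !big_cons big_nil addr0.
Qed.

Lemma tens_lift_uniq (Z : lmodType K) (f g : btensor -> Z) :
  is_linear f -> is_linear g ->
  (forall u w, f (tens u w) = g (tens u w)) -> f =1 g.
Proof.
move=> fl gl fg x; rewrite (tens_sum x).
have lin0 (h : btensor -> Z) : is_linear h -> h 0 = 0.
  by move=> hl; apply: (addrI (h 0)); rewrite -{1}[h 0]scale1r -hl scaler0 !addr0.
elim: (tens_repr x) => [|p s IH]; first by rewrite !big_nil !lin0.
by rewrite !big_cons -[tens p.1 p.2]scale1r fl gl IH fg.
Qed.
End Tensor.

Section TensorMap.
Variables (K : numFieldType) (U W : lmodType K) (I : Type).
Variables (r : I -> U -> U) (l : I -> W -> W).
Notation T := (btensor r l).

Definition tens_mapl (f : U -> U) : T -> T :=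
  tens_lift (fun u w => tens r l (f u) w).
Definition tens_mapr (f : W -> W) : T -> T :=
  tens_lift (fun u w => tens r l u (f w)).

Lemma balanced_mapl (f : U -> U) : is_linear f ->
  (forall i u, f (r i u) = r i (f u)) ->
  balanced r l (fun u w => tens r l (f u) w).
Proof.
move=> fl fr; have [bl br bb] := tens_balanced r l.
by split=> [w c u v|u|i u w]; rewrite ?fl ?fr ?bl ?bb.
Qed.

Lemma balanced_mapr (f : W -> W) : is_linear f ->
  (forall i w, f (l i w) = l i (f w)) ->
  balanced r l (fun u w => tens r l u (f w)).
Proof.
move=> fl fr; have [bl br bb] := tens_balanced r l.
by split=> [w|u c v w|i u w]; rewrite ?fl ?fr ?br ?bb //; apply: bl.
Qed.
End TensorMap.

Definition no_op (T : Type) (i : void) : T -> T := fun x => x.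

Definition tensor (K : numFieldType) (U W : lmodType K) : lmodType K :=
  btensor (@no_op U) (@no_op W).

(* algType excludes the zero ring, which occurs here as
   A_alpha(G, S) for empty S. *)
Record assoc_alg (K : numFieldType) := AssocAlg {
  alg_sort :> lmodType K;
  alg_mul : alg_sort -> alg_sort -> alg_sort;
  alg_one : alg_sort;
  alg_mul_linl : forall b, is_linear (fun a => alg_mul a b);
  alg_mul_linr : forall a, is_linear (alg_mul a);
  alg_mulA : associative alg_mul;
  alg_mul1l : left_id alg_one alg_mul;
  alg_mul1r : right_id alg_one alg_mul
}.

Definition is_action (K : numFieldType) (A : assoc_alg K) (U : lmodType K)
    (act : A -> U -> U) : Prop :=
  [/\ forall u, is_linear (fun a : A => act a u),
      forall a, is_linear (act a),
      forall u, act (alg_one A) u = u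
    & forall a b u, act (alg_mul a b) u = act a (act b u)].

Record amodule (K : numFieldType) (A : assoc_alg K) := AModule {
  am_sort :> lmodType K;
  am_act : A -> am_sort -> am_sort;
  am_actP : is_action am_act
}.

Section AModules.
Variables (K : numFieldType) (A : assoc_alg K).

Definition simple_amodule (U : amodule A) : Prop :=
  (exists u : U, u <> 0) /\
  forall P : U -> Prop, is_subspace P ->
    (forall a u, P u -> P (am_act a u)) ->
    (forall u, P u -> u = 0) \/ (forall u, P u).

Definition amodule_iso (U W : amodule A) : Prop :=
  exists2 f : U -> W, is_linear f /\ bijective f
    & forall a u, f (am_act a u) = am_act a (f u).

(* chi is the character of the finite dimensional module U: its value at a is
   the trace of the matrix of a in a basis e of U. *)
Definition affords (U : amodule A) (chi : A -> K) : Prop :=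
  exists (n : nat) (e : 'I_n -> U) (mx : A -> 'M[K]_n),
    [/\ forall u, exists! c : 'rV[K]_n, u = \sum_i c 0 i *: e i,
        forall a j, am_act a (e j) = \sum_i mx a i j *: e i
      & forall a, chi a = \tr (mx a)].

Definition irr_char : Type :=
  {chi : A -> K | exists2 U : amodule A, simple_amodule U & affords U chi}.

Definition irr_mod (chi : irr_char) : amodule A :=
  s2val (cid2 (proj2_sig chi)).
End AModules.

Section LinearLemmas.
Variables (K : numFieldType) (U W : lmodType K) (f : U -> W).
Hypothesis fl : is_linear f.

Lemma is_linear0 : f 0 = 0.
Proof. by apply: (addrI (f 0)); rewrite -{1}[f 0]scale1r -fl scaler0 !addr0. Qed.

Lemma is_linearZ c u : f (c *: u) = c *: f u.
Proof. by rewrite -[c *: u]addr0 fl is_linear0 addr0. Qed.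

Lemma is_linearD u v : f (u + v) = f u + f v.
Proof. by rewrite -[u in LHS]scale1r fl scale1r. Qed.

Lemma is_linear_sum (J : Type) (s : seq J) (P : pred J) (F : J -> U) :
  f (\sum_(i <- s | P i) F i) = \sum_(i <- s | P i) f (F i).
Proof. exact: (big_morph f is_linearD is_linear0). Qed.
End LinearLemmas.

Definition mono (K : numFieldType) (I : finType) (i : I) : {ffun I -> K^o} :=
  [ffun k => (k == i)%:R].

(* The algebra with basis (e_i), i in I, and product e_i e_j = c i j e_(i.j). *)
Record mono_struct (K : numFieldType) (I : finType) := MonoStruct {
  ms_coef : I -> I -> K;
  ms_mul : I -> I -> I;
  ms_one : {ffun I -> K^o};
  ms_mulA : associative ms_mul;
  ms_coefA : forall i j k,
    ms_coef i j * ms_coef (ms_mul i j) k = ms_coef j k * ms_coef i (ms_mul j k);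
  ms_one_l : forall j,
    \sum_i (ms_one i * ms_coef i j) *: mono K (ms_mul i j) = mono K j;
  ms_one_r : forall j,
    \sum_i (ms_one i * ms_coef j i) *: mono K (ms_mul j i) = mono K j
}.

Section MonoAlg.
Variables (K : numFieldType) (I : finType) (m : mono_struct K I).
Local Notation T := {ffun I -> K^o}.

Definition mono_mul (f g : T) : T :=
  \sum_i \sum_j (f i * g j * ms_coef m i j) *: mono K (ms_mul m i j).

Definition mono_ext (U : lmodType K) (op : I -> U -> U) (f : T) (u : U) : U :=
  \sum_i f i *: op i u.

Lemma mono_dec (f : T) : f = \sum_i f i *: mono K i.
Proof.
apply/ffunP => k; rewrite sum_ffunE (bigD1 k) //= !ffunE eqxx [_ *: _]mulr1.
by rewrite big1 ?addr0 // => i /negPf nik; rewrite !ffunE eq_sym nik [_ *: _]mulr0.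
Qed.

Lemma mono_ext_lin (U : lmodType K) (op : I -> U -> U) u :
  is_linear (fun f : T => mono_ext op f u).
Proof.
move=> c f g; rewrite /mono_ext scaler_sumr -big_split.
by apply: eq_bigr => i _; rewrite !ffunE scalerDl scalerA.
Qed.

Lemma mono_extE (U : lmodType K) (op : I -> U -> U) i u :
  mono_ext op (mono K i) u = op i u.
Proof.
rewrite /mono_ext (bigD1 i) //= ffunE eqxx scale1r big1 ?addr0 // => j /negPf nij.
by rewrite ffunE nij scale0r.
Qed.

Lemma mono_ext_linr (U : lmodType K) (op : I -> U -> U) f :
  (forall i, is_linear (op i)) -> is_linear (mono_ext op f).
Proof.
move=> opl c u v; rewrite /mono_ext scaler_sumr -big_split; apply: eq_bigr => i _.
by rewrite opl scalerDr !scalerA mulrC.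
Qed.

Lemma mono_ext_mul (U : lmodType K) (op : I -> U -> U) :
  (forall i, is_linear (op i)) ->
  (forall i j u, op i (op j u) = ms_coef m i j *: op (ms_mul m i j) u) ->
  forall f g u, mono_ext op (mono_mul f g) u = mono_ext op f (mono_ext op g u).
Proof.
move=> opl opM f g u.
rewrite (is_linear_sum (mono_ext_lin op u)) {2}/mono_ext; apply: eq_bigr => i _.
rewrite (is_linear_sum (mono_ext_lin op u)) (is_linear_sum (opl i)) scaler_sumr.
apply: eq_bigr => j _; rewrite (is_linearZ (mono_ext_lin op u)) mono_extE.
by rewrite (is_linearZ (opl i)) opM !scalerA.
Qed.

Lemma mono_lin_eq (U : lmodType K) (f h : T -> U) :
  is_linear f -> is_linear h -> (forall k, f (mono K k) = h (mono K k)) -> f =1 h.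
Proof.
move=> fl hl fh g; rewrite (mono_dec g) (is_linear_sum fl) (is_linear_sum hl).
by apply: eq_bigr => k _; rewrite (is_linearZ fl) (is_linearZ hl) fh.
Qed.

Definition mono_shift (i : I) (g : T) : T :=
  \sum_j (g j * ms_coef m i j) *: mono K (ms_mul m i j).

Lemma mono_mulE f g : mono_mul f g = mono_ext mono_shift f g.
Proof.
apply: eq_bigr => i _; rewrite scaler_sumr; apply: eq_bigr => j _.
by rewrite scalerA mulrA.
Qed.

Lemma mono_shift_lin i : is_linear (mono_shift i).
Proof.
move=> c f g; rewrite /mono_shift scaler_sumr -big_split; apply: eq_bigr => j _.
by rewrite !ffunE mulrDl scalerDl scalerA mulrA.
Qed.

Lemma mono_shift_mono i j :
  mono_shift i (mono K j) = ms_coef m i j *: mono K (ms_mul m i j).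
Proof.
rewrite /mono_shift (bigD1 j) //= ffunE eqxx mul1r big1 ?addr0 // => k /negPf nkj.
by rewrite ffunE nkj mul0r scale0r.
Qed.

Lemma mono_shiftM i j g :
  mono_shift i (mono_shift j g) = ms_coef m i j *: mono_shift (ms_mul m i j) g.
Proof.
apply: (mono_lin_eq (f := fun g => mono_shift i (mono_shift j g))
  (h := fun g => ms_coef m i j *: mono_shift (ms_mul m i j) g)) => [c x y|c x y|k].
- by rewrite !mono_shift_lin.
- by rewrite mono_shift_lin scalerDr !scalerA mulrC.
rewrite !mono_shift_mono (is_linearZ (mono_shift_lin i)) mono_shift_mono.
by rewrite !scalerA ms_mulA ms_coefA.
Qed.

Fact mono_mul_linl g : is_linear (fun f => mono_mul f g).
Proof. by move=> c f f'; rewrite !mono_mulE mono_ext_lin. Qed.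
Fact mono_mul_linr f : is_linear (mono_mul f).
Proof. by move=> c g g'; rewrite !mono_mulE mono_ext_linr //; apply: mono_shift_lin. Qed.
Fact mono_mulA : associative mono_mul.
Proof.
move=> f g h; rewrite [mono_mul (mono_mul f g) h]mono_mulE mono_ext_mul.
- by rewrite -!mono_mulE.
- exact: mono_shift_lin.
- exact: mono_shiftM.
Qed.
Fact mono_mul1l : left_id (ms_one m) mono_mul.
Proof.
apply: mono_lin_eq => [|//|j]; first exact: mono_mul_linr.
rewrite -[RHS](ms_one_l m) mono_mulE; apply: eq_bigr => i _.
by rewrite mono_shift_mono scalerA.
Qed.
Fact mono_mul1r : right_id (ms_one m) mono_mul.
Proof.
apply: (mono_lin_eq (f := mono_mul^~ (ms_one m))) => [|//|j].
  exact: mono_mul_linl.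
by rewrite -[RHS](ms_one_r m) mono_mulE mono_extE.
Qed.

Definition mono_alg : assoc_alg K :=
  AssocAlg mono_mul_linl mono_mul_linr mono_mulA mono_mul1l mono_mul1r.

Lemma mono_ext_action (U : lmodType K) (op : I -> U -> U) :
  (forall i, is_linear (op i)) ->
  (forall i j u, op i (op j u) = ms_coef m i j *: op (ms_mul m i j) u) ->
  (forall u, \sum_i ms_one m i *: op i u = u) ->
  is_action (A := mono_alg) (mono_ext op).
Proof.
move=> opl opM op1; split.
- exact: mono_ext_lin.
- by move=> a; apply: mono_ext_linr.
- exact: op1.
- exact: mono_ext_mul.
Qed.
End MonoAlg.

(* Y u n w is the mode u_n w, where Y(u, z) = sum_n u_n z^(-n-1). *)
Section Modes.
Variables (K : numFieldType) (V U : lmodType K).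
Variables (YV : V -> int -> V -> V) (Y : V -> int -> U -> U).

Definition modes_bilinear : Prop :=
  (forall n w, is_linear (fun u => Y u n w)) /\ (forall u n, is_linear (Y u n)).

Definition modes_truncated : Prop :=
  forall u w, exists N : int, forall n, N <= n -> Y u n w = 0.

(* The generalized binomial coefficient: (1 + t)^x = sum_i (binz x i) t^i. *)
Definition binz (x : int) (i : nat) : K :=
  (\prod_(k < i) (x%:~R - k%:R)) / (i`!)%:R.

(* The Jacobi identity, coefficient by coefficient: this is the coefficient of
   z0^(-l-1) z1^(-m-1) z2^(-n-1), where (z1 - z2)^l is expanded in nonnegative
   powers of z2 in the first term, (z2 - z1)^l in nonnegative powers of z1 in
   the second, (z1 - z0)^r in nonnegative powers of z0 in the third, and
   (-1)^i binz (i - m - 1) i = binz m i.  Under modes_truncated each of the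
   three sums over i >= 0 has finitely many nonzero terms, so the partial sums
   below are the full sums as soon as k is large. *)
Definition modes_jacobi : Prop :=
  forall (u v : V) (w : U) (l m n : int), exists N : nat, forall k, (N <= k)%N ->
    \sum_(i < k) ((-1) ^+ i * binz l i) *: Y u (l + m - i%:Z) (Y v (n + i%:Z) w)
    - ((-1) ^ l) *:
      \sum_(i < k) ((-1) ^+ i * binz l i) *: Y v (l + n - i%:Z) (Y u (m + i%:Z) w)
    = \sum_(i < k) binz m i *: Y (YV u (l + i%:Z) v) (m + n - i%:Z) w.

End Modes.

Definition fin_dim (K : numFieldType) (U : lmodType K) (P : U -> Prop) : Prop :=
  exists (d : nat) (e : 'I_d -> U),
    forall u, P u -> exists c : 'I_d -> K, u = \sum_i c i *: e i.

Definition eigenvec (K : numFieldType) (U : lmodType K) (f : U -> U) (a : K) (u : U) :=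
  f u = a *: u.

(* L(n) = omega_(n+1); the homogeneous subspace V_n is the eigenspace of L(0)
   for n, so that the sum of the V_n is automatically direct. *)
Record voa (K : numFieldType) := VOA {
  voa_sort :> lmodType K;
  voa_mode : voa_sort -> int -> voa_sort -> voa_sort;
  vac : voa_sort;
  omega : voa_sort;
  ccharge : K;
  voa_bilin : modes_bilinear voa_mode;
  voa_trunc : modes_truncated voa_mode;
  voa_vac : forall n u, voa_mode vac n u = if n == -1 then u else 0;
  voa_creation : forall u, voa_mode u (-1) vac = u;
  voa_creation0 : forall u (n : int), 0 <= n -> voa_mode u n vac = 0;
  voa_jacobi : modes_jacobi voa_mode voa_mode;
  voa_virasoro : forall (m n : int) u,
    voa_mode omega (m + 1) (voa_mode omega (n + 1) u)
      - voa_mode omega (n + 1) (voa_mode omega (m + 1) u)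
    = (m - n)%:~R *: voa_mode omega (m + n + 1) u
      + (if m + n == 0 then (m ^+ 3 - m)%:~R / 12%:R * ccharge else 0) *: u;
  voa_deriv : forall u n w,
    voa_mode (voa_mode omega 0 u) n w = - n%:~R *: voa_mode u (n - 1) w;
  voa_graded : forall u, exists (d : nat) (wt : 'I_d -> int) (x : 'I_d -> voa_sort),
    u = \sum_i x i /\
    forall i, eigenvec (voa_mode omega 1) (wt i)%:~R (x i);
  voa_findim : forall n : int, fin_dim (eigenvec (voa_mode omega 1) n%:~R);
  voa_bounded : exists N : int, forall n : int, n < N ->
    forall u, eigenvec (voa_mode omega 1) n%:~R u -> u = 0
}.
Arguments vac {K} v.
Arguments omega {K} v.

Definition simple_voa (K : numFieldType) (V : voa K) : Prop :=
  forall P : V -> Prop, is_subspace P ->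
    (forall u n v, P v -> P (voa_mode u n v)) ->
    (forall u n v, P u -> P (voa_mode u n v)) ->
    (forall u, P u -> u = 0) \/ (forall u, P u).

Record premodule (K : numFieldType) (V : voa K) := PreModule {
  pm_sort :> lmodType K;
  pm_mode : V -> int -> pm_sort -> pm_sort;
  pm_bilin : modes_bilinear pm_mode
}.

Section Modules.
Variables (K : numFieldType) (V : voa K).
Implicit Types M N : premodule V.

(* Modes are indexed by integers: for modes indexed by rational numbers the
   Jacobi identity forces those of nonintegral index to vanish. *)
Definition is_weak_module M : Prop :=
  [/\ modes_truncated (pm_mode (p := M)),
      forall n w, pm_mode (p := M) (vac V) n w = if n == -1 then w else 0
    & modes_jacobi (voa_mode (v := V)) (pm_mode (p := M))].

Definition weight_vec M (a : K) (w : M) : Prop := eigenvec (pm_mode (omega V) 1) a w.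

Definition is_module M : Prop :=
  [/\ is_weak_module M,
      forall w : M, exists (d : nat) (wt : 'I_d -> K) (x : 'I_d -> M),
        w = \sum_i x i /\ forall i, weight_vec (wt i) (x i),
      forall a, fin_dim (@weight_vec M a)
    & forall a, exists N : int, forall n : int, n < N ->
        forall w : M, weight_vec (a + n%:~R) w -> w = 0].

Definition irreducible M : Prop :=
  (exists w : M, w <> 0) /\
  forall P : M -> Prop, is_subspace P ->
    (forall v n w, P w -> P (pm_mode v n w)) ->
    (forall w, P w -> w = 0) \/ (forall w, P w).

Definition module_iso M N : Prop :=
  exists2 f : M -> N, is_linear f /\ bijective f
    & forall v n w, f (pm_mode v n w) = pm_mode v n (f w).

Lemma module_iso_refl M : module_iso M M.
Proof. by exists id => //; split=> //; exists id. Qed.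

Lemma module_iso_sym M N : module_iso M N -> module_iso N M.
Proof.
case=> f [fl [g fK gK]] fm; exists g.
  split; last by exists f.
  by move=> c u v; rewrite -[u in LHS]gK -[v in LHS]gK -fl fK.
by move=> v n w; rewrite -[w in LHS]gK -fm fK.
Qed.

Lemma module_iso_trans M N P : module_iso M N -> module_iso N P -> module_iso M P.
Proof.
case=> f [fl fb] fm [g [gl gb] gm]; exists (g \o f).
  by split; [move=> c u v; rewrite /= fl gl | apply: bij_comp].
by move=> v n w; rewrite /= fm gm.
Qed.

Section DirectSum.
Variables (I : Type) (F : I -> premodule V).

Definition dsum_mode_fun (v : V) (n : int) (x : dsum F) : dprod F :=
  fun i => pm_mode v n (dcoord x i).

Fact dsum_mode_fin v n x : fin_supp (dsum_mode_fun v n x).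
Proof.
apply: sub_finite_set (sub_eltP x) => i /= nz x0; apply: nz.
rewrite /dsum_mode_fun /dcoord -/(val x) x0.
exact: is_linear0 ((pm_bilin (F i)).2 v n).
Qed.

Definition dsum_mode v n x : dsum F :=
  sub_elt (P := Subspace (fin_supp_subspace F)) (dsum_mode_fin v n x).

Lemma dsum_modeE v n x i : dcoord (dsum_mode v n x) i = pm_mode v n (dcoord x i).
Proof. by []. Qed.

Fact dsum_bilin : modes_bilinear dsum_mode.
Proof.
split=> [n x c u v|v n c x y]; apply: dsum_eqP => i; rewrite dcoordD !dsum_modeE.
  by rewrite (pm_bilin (F i)).1.
by rewrite dcoordD (pm_bilin (F i)).2.
Qed.

Definition dsum_premodule : premodule V := PreModule dsum_bilin.
End DirectSum.
End Modules.

(* The group gT identified with its image under ag_act, a finite group of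
   automorphisms of V. *)
Record aut_group (K : numFieldType) (V : voa K) (gT : finGroupType) := AutGroup {
  ag_act :> gT -> V -> V;
  ag_lin : forall g, is_linear (ag_act g);
  ag_1 : forall v, ag_act 1%g v = v;
  ag_M : forall g h v, ag_act (g * h)%g v = ag_act g (ag_act h v);
  ag_inj : forall g h, (forall v, ag_act g v = ag_act h v) -> g = h;
  ag_vac : forall g, ag_act g (vac V) = vac V;
  ag_omega : forall g, ag_act g (omega V) = omega V;
  ag_mode : forall g u n v,
    ag_act g (voa_mode u n v) = voa_mode (ag_act g u) n (ag_act g v)
}.

Section FixedPoints.
Variables (K : numFieldType) (V : voa K) (gT : finGroupType) (G : aut_group V gT).

Definition fixed (v : V) : Prop := forall g, G g v = v.

Fact fixed_subspace : is_subspace fixed.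
Proof.
split=> [g|c u v fu fv g]; first exact: is_linear0 (ag_lin G g).
by rewrite ag_lin fu fv.
Qed.

Definition fixed_lmod : lmodType K := sub_lmod (Subspace fixed_subspace).

Definition fixed_elt (v : V) (fv : fixed v) : fixed_lmod :=
  sub_elt (P := Subspace fixed_subspace) fv.

Definition fix_val (v : fixed_lmod) : V := sm_val v.

Lemma fix_valP v : fixed (fix_val v). Proof. exact: (sub_eltP v). Qed.

Lemma fix_val_inj : injective fix_val. Proof. exact: val_inj. Qed.

Lemma fix_val_lin : is_linear fix_val. Proof. by move=> c u v; apply: sub_valD. Qed.

Fact fixed_mode (u v : fixed_lmod) n : fixed (voa_mode (fix_val u) n (fix_val v)).
Proof. by move=> g; rewrite ag_mode !fix_valP. Qed.

Definition fix_mode (u : fixed_lmod) n (v : fixed_lmod) : fixed_lmod :=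
  fixed_elt (fixed_mode u v n).

Definition fix_vac : fixed_lmod := fixed_elt (fun g => ag_vac G g).
Definition fix_omega : fixed_lmod := fixed_elt (fun g => ag_omega G g).

Fact fixed_avg (v : V) : fixed ((#|gT|%:R)^-1 *: \sum_g G g v).
Proof.
move=> h; rewrite (is_linearZ (ag_lin G h)) (is_linear_sum (ag_lin G h)).
congr (_ *: _); rewrite [RHS](reindex_inj (mulgI h)) /=.
by apply: eq_bigr => g _; rewrite ag_M.
Qed.

Definition fix_avg (v : V) : fixed_lmod := fixed_elt (fixed_avg v).

Lemma fix_avg_lin : is_linear fix_avg.
Proof.
move=> c u v; apply: fix_val_inj; rewrite fix_val_lin /fix_val /=.
rewrite scalerA mulrC -scalerA -scalerDr; congr (_ *: _).
rewrite scaler_sumr -big_split; apply: eq_bigr => g _.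
by rewrite ag_lin.
Qed.

Lemma fix_avgK : cancel fix_val fix_avg.
Proof.
move=> v; apply: fix_val_inj; rewrite /fix_val /=.
rewrite (eq_bigr (fun=> fix_val v)) => [|g _]; last exact: fix_valP.
rewrite sumr_const -scaler_nat scalerA mulVf ?scale1r //.
by rewrite pnatr_eq0 -lt0n; apply/card_gt0P; exists 1%g.
Qed.

Lemma fix_avg_omega (v : V) n :
  fix_avg (voa_mode (omega V) n v) = fix_mode fix_omega n (fix_avg v).
Proof.
apply: fix_val_inj; rewrite /fix_val /= /fix_val /=.
have lin := (voa_bilin V).2 (omega V) n.
rewrite (is_linearZ lin) (is_linear_sum lin); congr (_ *: _).
by apply: eq_bigr => g _; rewrite ag_mode ag_omega.
Qed.

Lemma fix_val_eigen n a v :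
  eigenvec (fix_mode fix_omega n) a v <-> eigenvec (voa_mode (omega V) n) a (fix_val v).
Proof.
rewrite /eigenvec -(is_linearZ fix_val_lin); split=> [<- //|h].
exact: fix_val_inj.
Qed.

Lemma fix_avg_eigen n a v :
  eigenvec (voa_mode (omega V) n) a v -> eigenvec (fix_mode fix_omega n) a (fix_avg v).
Proof. by rewrite /eigenvec -fix_avg_omega => ->; apply: is_linearZ fix_avg_lin _ _. Qed.

Let fvl := fix_val_lin.

Lemma fix_modeE u n v : fix_val (fix_mode u n v) = voa_mode (fix_val u) n (fix_val v).
Proof. by []. Qed.

Fact fix_bilin : modes_bilinear fix_mode.
Proof.
split=> [n w c u v|u n c v w]; apply: fix_val_inj; rewrite fvl !fix_modeE fvl.
  by rewrite (voa_bilin V).1.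
by rewrite (voa_bilin V).2.
Qed.

Fact fix_trunc : modes_truncated fix_mode.
Proof.
move=> u w; have [N hN] := voa_trunc (fix_val u) (fix_val w); exists N => n /hN h.
by apply: fix_val_inj; rewrite (is_linear0 fvl).
Qed.

Fact fix_vacE n u : fix_mode fix_vac n u = if n == -1 then u else 0.
Proof.
apply: fix_val_inj; rewrite [LHS](voa_vac n (fix_val u)).
by case: ifP => _ //; rewrite (is_linear0 fvl).
Qed.

Fact fix_creation u : fix_mode u (-1) fix_vac = u.
Proof. by apply: fix_val_inj; apply: voa_creation. Qed.

Fact fix_creation0 u (n : int) : 0 <= n -> fix_mode u n fix_vac = 0.
Proof.
by move=> n0; apply: fix_val_inj; rewrite (is_linear0 fvl); apply: voa_creation0.
Qed.

Let fvS := is_linear_sum fvl.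
Let fvZ := is_linearZ fvl.
Let fvD := is_linearD fvl.

Lemma fix_valB u v : fix_val (u - v) = fix_val u - fix_val v.
Proof. by rewrite fvD -scaleN1r fvZ scaleN1r. Qed.

Fact fix_jacobi : modes_jacobi fix_mode fix_mode.
Proof.
move=> u v w l m n.
have [N hN] := voa_jacobi (fix_val u) (fix_val v) (fix_val w) l m n.
exists N => k /hN h; apply: fix_val_inj; rewrite fix_valB fvZ !fvS.
under eq_bigr do rewrite fvZ; under [X in _ - _ *: X]eq_bigr do rewrite fvZ.
by under [RHS]eq_bigr do rewrite fvZ.
Qed.

Fact fix_virasoro (m n : int) u :
  fix_mode fix_omega (m + 1) (fix_mode fix_omega (n + 1) u)
    - fix_mode fix_omega (n + 1) (fix_mode fix_omega (m + 1) u)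
  = (m - n)%:~R *: fix_mode fix_omega (m + n + 1) u
    + (if m + n == 0 then (m ^+ 3 - m)%:~R / 12%:R * ccharge V else 0) *: u.
Proof.
apply: fix_val_inj; rewrite fix_valB fvD !fvZ.
exact: voa_virasoro.
Qed.

Fact fix_deriv u n w :
  fix_mode (fix_mode fix_omega 0 u) n w = - n%:~R *: fix_mode u (n - 1) w.
Proof. by apply: fix_val_inj; rewrite fvZ; apply: voa_deriv. Qed.

Fact fix_graded u : exists (d : nat) (wt : 'I_d -> int) (x : 'I_d -> fixed_lmod),
  u = \sum_i x i /\ forall i, eigenvec (fix_mode fix_omega 1) (wt i)%:~R (x i).
Proof.
have [d [wt [x [ux hx]]]] := voa_graded (fix_val u).
exists d, wt, (fix_avg \o x); split=> [|i]; last exact: fix_avg_eigen.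
by rewrite -(is_linear_sum fix_avg_lin) -ux fix_avgK.
Qed.

Fact fix_findim (n : int) : fin_dim (eigenvec (fix_mode fix_omega 1) n%:~R).
Proof.
have [d [e he]] := voa_findim V n; exists d, (fix_avg \o e) => u.
move/fix_val_eigen/he => [c uE]; exists c.
rewrite -[u]fix_avgK uE (is_linear_sum fix_avg_lin).
by apply: eq_bigr => i _; rewrite (is_linearZ fix_avg_lin).
Qed.

Fact fix_bounded : exists N : int, forall n : int, n < N ->
  forall u, eigenvec (fix_mode fix_omega 1) n%:~R u -> u = 0.
Proof.
have [N hN] := voa_bounded V; exists N => n nN u /fix_val_eigen/(hN n nN) u0.
by apply: fix_val_inj; rewrite u0 (is_linear0 fvl).
Qed.

Definition fixed_voa : voa K := VOA fix_bilin fix_trunc fix_vacE fix_creation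
  fix_creation0 fix_jacobi fix_virasoro fix_deriv fix_graded fix_findim fix_bounded.

Section Restriction.
Variable M : premodule V.

Definition res_mode (v : fixed_voa) (n : int) (w : M) : M :=
  pm_mode (fix_val v) n w.

Fact res_bilin : modes_bilinear res_mode.
Proof.
split=> [n w c u v|u n]; last exact: (pm_bilin M).2.
by rewrite /res_mode fvl (pm_bilin M).1.
Qed.

Definition res_premodule : premodule fixed_voa := PreModule res_bilin.
End Restriction.

Section Twist.
Variables (M : premodule V) (g : gT).

Definition twist_mode (v : V) (n : int) (w : M) : M := pm_mode (G g v) n w.

Fact twist_bilin : modes_bilinear twist_mode.
Proof.
split=> [n w c u v|u n]; last exact: (pm_bilin M).2.
by rewrite /twist_mode ag_lin (pm_bilin M).1.
Qed.

(* M o g *)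
Definition twist : premodule V := PreModule twist_bilin.
End Twist.

Lemma twist_iso M N g : module_iso M N -> module_iso (twist M g) (twist N g).
Proof. by case=> f fb fm; exists f => // v n w; apply: fm. Qed.

Lemma twist1_iso M : module_iso (twist M 1%g) M.
Proof.
exists id => [|v n w]; first by split=> //; exists id.
by rewrite /= /twist_mode ag_1.
Qed.

Lemma twistM_iso M g h : module_iso (twist M (g * h)%g) (twist (twist M g) h).
Proof.
exists id => [|v n w]; first by split=> //; exists id.
by rewrite /= /twist_mode ag_M.
Qed.
End FixedPoints.

(* A vector space carrying commuting actions of an algebra A and of the
   vertex operators of V. *)
Record bimodule (K : numFieldType) (A : assoc_alg K) (V : voa K) := BiModule {
  bm_pre :> premodule V;
  bm_act : A -> bm_pre -> bm_pre;
  bm_actP : is_action bm_act;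
  bm_comm : forall a v n w, bm_act a (pm_mode v n w) = pm_mode v n (bm_act a w)
}.

Section BiModules.
Variables (K : numFieldType) (A : assoc_alg K) (V : voa K).
Implicit Types B : bimodule A V.

Definition bm_amod B : amodule A := AModule (bm_actP B).

Definition bimodule_iso B B' : Prop :=
  exists f : B -> B', [/\ is_linear f, bijective f,
    forall a w, f (bm_act a w) = bm_act a (f w)
  & forall v n w, f (pm_mode v n w) = pm_mode v n (f w)].

Section DirectSum.
Variables (I : Type) (F : I -> bimodule A V).
Let D := dsum_premodule (fun i => bm_pre (F i)).

Definition dsum_act_fun (a : A) (x : D) : dprod F :=
  fun i => bm_act a (dcoord x i).

Fact dsum_act_fin a x : fin_supp (dsum_act_fun a x).
Proof.
apply: sub_finite_set (sub_eltP x) => i /= nz x0; apply: nz.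
rewrite /dsum_act_fun /dcoord -/(val x) x0.
by have [_ al _ _] := bm_actP (F i); apply: is_linear0 (al a).
Qed.

Definition dsum_act (a : A) (x : D) : D :=
  sub_elt (P := Subspace (fin_supp_subspace F)) (dsum_act_fin a x).

Lemma dsum_actE a x i : dcoord (dsum_act a x) i = bm_act a (dcoord x i).
Proof. by []. Qed.

Fact dsum_actP : is_action dsum_act.
Proof.
split=> [x c a b|a c x y|x|a b x]; apply: dsum_eqP => i;
  rewrite ?dcoordD ?dsum_actE ?dcoordD; have [al ar a1 aM] := bm_actP (F i).
- exact: al.
- exact: ar.
- exact: a1.
- exact: aM.
Qed.

Fact dsum_comm a v n (w : D) :
  dsum_act a (pm_mode v n w) = pm_mode v n (dsum_act a w).
Proof. by apply: dsum_eqP => i; apply: bm_comm. Qed.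

Definition dsum_bimodule : bimodule A V := BiModule dsum_actP dsum_comm.
End DirectSum.

Section TensorBimodule.
Variables (X : amodule A) (N : premodule V).
Notation T := (tensor X N).

Definition tens_act (a : A) : T -> T :=
  tens_mapl (r := @no_op X) (l := @no_op N) (am_act a).
Definition tens_mode (v : V) (n : int) : T -> T :=
  tens_mapr (r := @no_op X) (l := @no_op N) (pm_mode v n).

Let tens0 : X -> N -> T := tens (@no_op X) (@no_op N).
Let tb : balanced (@no_op X) (@no_op N) tens0 := tens_balanced _ _.

Let bal_act a : balanced (@no_op X) (@no_op N) (fun u w => tens0 (am_act a u) w).
Proof. by apply: balanced_mapl => // c u v; have [_ ar _ _] := am_actP X; apply: ar. Qed.

Let bal_mode v n : balanced (@no_op X) (@no_op N) (fun u w => tens0 u (pm_mode v n w)).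
Proof. by apply: balanced_mapr => //; apply: (pm_bilin N).2. Qed.

Lemma tens_actE a u w : tens_act a (tens0 u w) = tens0 (am_act a u) w.
Proof. exact: tens_liftE (bal_act a). Qed.

Lemma tens_modeE v n u w : tens_mode v n (tens0 u w) = tens0 u (pm_mode v n w).
Proof. exact: tens_liftE (bal_mode v n). Qed.

Lemma tens_act_lin a : is_linear (tens_act a).
Proof. exact: tens_lift_lin (bal_act a). Qed.

Lemma tens_mode_lin v n : is_linear (tens_mode v n).
Proof. exact: tens_lift_lin (bal_mode v n). Qed.

Fact tens_actP : is_action tens_act.
Proof.
have [bl br _] := tb; have [al ar a1 aM] := am_actP X.
split=> [x c a b|a|x|a b x]; last 2 first.
- apply: (tens_lift_uniq (f := tens_act (alg_one A)) (g := id)) => // [|u w].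
    exact: tens_act_lin.
  by rewrite tens_actE a1.
- apply: (tens_lift_uniq (f := tens_act (alg_mul a b))
    (g := fun x => tens_act a (tens_act b x))) => // [|c y z|u w].
  + exact: tens_act_lin.
  + by rewrite !tens_act_lin.
  + by rewrite !tens_actE aM.
- apply: (tens_lift_uniq (f := tens_act (c *: a + b))
    (g := fun x => c *: tens_act a x + tens_act b x)) => [|d y z|u w].
  + exact: tens_act_lin.
  + by rewrite !tens_act_lin !scalerDr !scalerA mulrC addrACA.
  + by rewrite !tens_actE al bl.
- exact: tens_act_lin.
Qed.

Fact tens_mode_bilin : modes_bilinear tens_mode.
Proof.
have [bl br _] := tb; split=> [n x c u v|v n]; last exact: tens_mode_lin.
apply: (tens_lift_uniq (f := tens_mode (c *: u + v) n)
  (g := fun x => c *: tens_mode u n x + tens_mode v n x)) => [|d y z|a w].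
- exact: tens_mode_lin.
- by rewrite !tens_mode_lin !scalerDr !scalerA mulrC addrACA.
- by rewrite !tens_modeE (pm_bilin N).1 br.
Qed.

Definition tens_premodule : premodule V := PreModule tens_mode_bilin.

Fact tens_comm a v n (x : T) :
  tens_act a (tens_mode v n x) = tens_mode v n (tens_act a x).
Proof.
apply: (tens_lift_uniq (f := fun x => tens_act a (tens_mode v n x))
  (g := fun x => tens_mode v n (tens_act a x))) => [c y z|c y z|u w].
- by rewrite tens_mode_lin tens_act_lin.
- by rewrite tens_act_lin tens_mode_lin.
- by rewrite tens_modeE !tens_actE tens_modeE.
Qed.

Definition tens_bimodule : bimodule A V := 
  @BiModule _ _ _ tens_premodule tens_act tens_actP tens_comm.
End TensorBimodule.

Section MultiplicitySpace.
Variables (X : amodule A) (B : bimodule A V).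

Definition is_hom (f : dprod (fun _ : X => B)) : Prop :=
  is_linear f /\ forall a x, f (am_act a x) = bm_act a (f x).

Fact is_hom_subspace : is_subspace is_hom.
Proof.
have [_ ar _ _] := bm_actP B.
have dE c (f g : dprod (fun _ : X => B)) x : (c *: f + g) x = c *: f x + g x by [].
have d0 x : (0 : dprod (fun _ : X => B)) x = 0 by [].
split=> [|c f g [fl fa] [gl ga]]; split=> [d x y|a x].
- by rewrite !d0 scaler0 addr0.
- by rewrite !d0 (is_linear0 (ar a)).
- by rewrite !dE fl gl !scalerDr !scalerA mulrC addrACA.
- by rewrite !dE fa ga ar.
Qed.

Definition hom_lmod : lmodType K := sub_lmod (Subspace is_hom_subspace).

Definition hom_fun (f : hom_lmod) : X -> B := sm_val f.

Lemma hom_funP f : is_hom (hom_fun f). Proof. exact: (sub_eltP f). Qed.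

Fact hom_mode_hom v n (f : hom_lmod) : is_hom (fun x => pm_mode v n (hom_fun f x)).
Proof.
have [fl fa] := hom_funP f; split=> [c x y|a x].
  by rewrite fl (pm_bilin B).2.
by rewrite fa bm_comm.
Qed.

Definition hom_mode v n (f : hom_lmod) : hom_lmod :=
  sub_elt (P := Subspace is_hom_subspace) (hom_mode_hom v n f).

Fact hom_bilin : modes_bilinear hom_mode.
Proof.
split=> [n f c u v|v n c f g]; apply/val_inj/functional_extensionality_dep => x.
  exact: (pm_bilin B).1.
exact: (pm_bilin B).2.
Qed.

(* Hom_A(X, B), with V acting through B *)
Definition mult_space : premodule V := PreModule hom_bilin.
End MultiplicitySpace.

Definition dual_pair B : Prop :=
  (forall X : amodule A, simple_amodule X ->
     [/\ exists f : mult_space X B, f <> 0,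
         is_module (mult_space X B)
       & irreducible (mult_space X B)]) /\
  (forall X Y : amodule A, simple_amodule X -> simple_amodule Y ->
     module_iso (mult_space X B) (mult_space Y B) -> amodule_iso X Y).
End BiModules.

Section StableSet.
Variables (K : numFieldType) (V : voa K) (gT : finGroupType) (G : aut_group V gT).

Record gstable_set := GStableSet {
  gs_idx :> finType;
  gs_mod : gs_idx -> premodule V;
  gs_module : forall s, is_module (gs_mod s);
  gs_irr : forall s, irreducible (gs_mod s);
  gs_ineq : forall s t, module_iso (gs_mod s) (gs_mod t) -> s = t;
  gs_stable : forall s g, exists t, module_iso (twist G (gs_mod s) g) (gs_mod t)
}.

Variable S : gstable_set.
Implicit Types (s t : S) (g h : gT).

(* M . g = N iff M o g is isomorphic to N *)
Definition gs_act s g : S :=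
  odflt s [pick t | `[< module_iso (twist G (gs_mod s) g) (gs_mod t) >]].

Lemma gs_actP s g : module_iso (twist G (gs_mod s) g) (gs_mod (gs_act s g)).
Proof.
rewrite /gs_act; case: pickP => [t /asboolP //|no].
by have [t /asboolP] := gs_stable s g; rewrite no.
Qed.

Lemma gs_act_uniq s t g :
  module_iso (twist G (gs_mod s) g) (gs_mod t) -> gs_act s g = t.
Proof.
move=> st; apply: gs_ineq; apply: module_iso_trans st.
exact/module_iso_sym/gs_actP.
Qed.

Lemma gs_act1 s : gs_act s 1%g = s.
Proof. exact/gs_act_uniq/twist1_iso. Qed.

Lemma gs_actM s g h : gs_act s (g * h)%g = gs_act (gs_act s g) h.
Proof.
apply: gs_act_uniq; apply: module_iso_trans (twistM_iso G _ _ _) _.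
exact: module_iso_trans (twist_iso G h (gs_actP s g)) (gs_actP _ _).
Qed.

Lemma gs_actK s g : gs_act (gs_act s g) g^-1%g = s.
Proof. by rewrite -gs_actM mulgV gs_act1. Qed.

Lemma gs_actVK s g : gs_act (gs_act s g^-1%g) g = s.
Proof. by rewrite -gs_actM mulVg gs_act1. Qed.

Definition gs_orbit s : {set S} := [set gs_act s g | g in [set: gT]].

(* G_M *)
Definition gs_stab s : {set gT} :=
  [set g | `[< module_iso (twist G (gs_mod s) g) (gs_mod s) >]].

Lemma gs_stabP s g : reflect (gs_act s g = s) (g \in gs_stab s).
Proof.
rewrite inE; apply: (iffP idP) => [/asboolP|sg]; first exact: gs_act_uniq.
by apply/asboolP; have := gs_actP s g; rewrite sg.
Qed.

Fact gs_stab_group s : group_set (gs_stab s).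
Proof.
apply/group_setP; split=> [|g h /gs_stabP sg /gs_stabP sh]; apply/gs_stabP.
  exact: gs_act1.
by rewrite gs_actM sg sh.
Qed.

Canonical gs_stab_Group s : {group gT} := Group (gs_stab_group s).

Definition gs_total : premodule V := dsum_premodule (@gs_mod S).

Definition gs_inj s : gs_mod s -> gs_total := dinj (U := @gs_mod S) s.

(* The maps phi_N(x) and the scalars alpha_N(y, x).  The modules N.x^-1.y^-1
   and N.(yx)^-1 coincide, but not by computation: values in them are compared
   inside the direct sum. *)
Record intertwiners := Intertwiners {
  phi : forall s (x : gT), gs_mod s -> gs_mod (gs_act s x^-1%g);
  phi_lin : forall s x, is_linear (@phi s x);
  phi_bij : forall s x, bijective (@phi s x);
  phi_mode : forall s x v n w,
    phi x (pm_mode (p := gs_mod s) v n w) = pm_mode (G x v) n (phi x w);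
  phi_1 : forall s (w : gs_mod s), gs_inj (phi 1%g w) = gs_inj w;
  alpha : S -> gT -> gT -> K;
  alphaE : forall s (y x : gT) (w : gs_mod s),
    gs_inj (phi y (phi x w)) = alpha s y x *: gs_inj (phi (y * x)%g w)
}.
End StableSet.

Section AAlpha.
Variables (K : numFieldType) (V : voa K) (gT : finGroupType) (G : aut_group V gT).
Variables (S : gstable_set G) (F : intertwiners S).
Implicit Types (s t : S) (p q : gT * S).
Local Notation M := (@gs_mod _ _ _ _ S).
Local Notation total := (gs_total S).

Definition gs_coord (w : total) s : M s := dcoord w s.

Local Arguments gs_coord : simpl never.
Local Arguments gs_inj : simpl never.

Lemma gs_coordD c (u v : total) s : gs_coord (c *: u + v) s = c *: gs_coord u s + gs_coord v s.
Proof. exact: dcoordD. Qed.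

Lemma gs_coord_mode v n w s : gs_coord (pm_mode v n w) s = pm_mode v n (gs_coord w s).
Proof. by []. Qed.

(* The operator a (x) e(M) on the sum of all modules, for p = (a, M) *)
Definition gs_op p (w : total) : total := gs_inj (phi F p.1 (gs_coord w p.2)).

Lemma gs_inj_eq s (u : M s) : gs_coord (gs_inj u) s = u.
Proof. exact: dinj_eq. Qed.

Lemma gs_inj_neq s t (u : M s) : s <> t -> gs_coord (gs_inj u) t = 0.
Proof. exact: dinj_neq. Qed.

Lemma gs_inj_inj s : injective (@gs_inj _ _ _ _ S s).
Proof. by move=> u v; apply: dinj_inj. Qed.

Lemma gs_inj_lin s : is_linear (@gs_inj _ _ _ _ S s).
Proof. by move=> c u v; apply: dinjD. Qed.

Lemma gs_coord_lin s : is_linear (fun w : total => gs_coord w s).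
Proof. by move=> c u v; apply: gs_coordD. Qed.

Lemma gs_op_lin p : is_linear (gs_op p).
Proof. by move=> c u v; rewrite /gs_op gs_coordD phi_lin gs_inj_lin. Qed.

Lemma gs_op_inj s g (u : M s) : gs_op (g, s) (gs_inj u) = gs_inj (phi F g u).
Proof. by rewrite /gs_op /= gs_inj_eq. Qed.

Lemma gs_op_inj_eq s t g (u : M t) :
  t = s -> gs_op (g, s) (gs_inj u) = gs_inj (phi F g u).
Proof. by move=> e; subst t; apply: gs_op_inj. Qed.

Lemma gs_op_inj0 s t g (u : M s) : s <> t -> gs_op (g, t) (gs_inj u) = 0.
Proof.
move=> nst; rewrite /gs_op /= gs_inj_neq // (is_linear0 (phi_lin F g)).
exact: is_linear0 (@gs_inj_lin _).
Qed.

Lemma gs_op1 s w : gs_op (1%g, s) w = gs_inj (gs_coord w s).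
Proof. exact: phi_1. Qed.

Definition A_coef p q : K :=
  if gs_act p.2 q.1 == q.2 then alpha F q.2 p.1 q.1 else 0.
Definition A_mul p q : gT * S := ((p.1 * q.1)%g, q.2).
Definition A_one : {ffun gT * S -> K^o} := [ffun p => (p.1 == 1%g)%:R].

Lemma gs_opM p q w : gs_op p (gs_op q w) = A_coef p q *: gs_op (A_mul p q) w.
Proof.
case: p q => [a s] [b t]; rewrite /A_coef /=; case: eqP => [<-|nst].
  apply: etrans (gs_op_inj_eq a (phi F b (gs_coord w (gs_act s b))) _) _.
    exact: gs_actK.
  exact: alphaE.
rewrite scale0r; apply: (gs_op_inj0 a (phi F b (gs_coord w t))) => e.
by apply: nst; rewrite -e gs_actVK.
Qed.

Lemma gs_op_neq0 p : exists w, gs_op p w <> 0.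
Proof.
case: p => g s; have [[u nz_u] _] := gs_irr s; exists (gs_inj u).
rewrite gs_op_inj => e0; apply: nz_u; apply: (bij_inj (phi_bij F s g)).
rewrite (is_linear0 (phi_lin F g)); apply: gs_inj_inj; rewrite e0.
by symmetry; apply: is_linear0 (@gs_inj_lin _).
Qed.

Lemma gs_op_scale c d p : (forall w, c *: gs_op p w = d *: gs_op p w) -> c = d.
Proof.
have [w nz] := gs_op_neq0 p => /(_ w) e; apply/eqP; rewrite -subr_eq0.
have: (c - d) *: gs_op p w == 0 by rewrite scalerBl e subrr.
by rewrite scaler_eq0 => /orP[//|/eqP].
Qed.

Fact A_mulA : associative A_mul.
Proof. by move=> p q k; rewrite /A_mul mulgA. Qed.

Fact A_coefA p q k :
  A_coef p q * A_coef (A_mul p q) k = A_coef q k * A_coef p (A_mul q k).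
Proof.
apply: (@gs_op_scale _ _ (A_mul p (A_mul q k))) => w.
rewrite {1}A_mulA -!scalerA -!gs_opM.
by rewrite -(is_linearZ (gs_op_lin p)) -gs_opM.
Qed.

Lemma A_coef1l s g : A_coef (1%g, gs_act s g^-1%g) (g, s) = 1.
Proof.
apply: (@gs_op_scale _ _ (g, s)) => w; rewrite scale1r.
have := gs_opM (1%g, gs_act s g^-1%g) (g, s) w.
by rewrite {1}/A_mul /= mul1g => <-; rewrite gs_op1 /gs_op /= gs_inj_eq.
Qed.

Lemma A_coef1r s g : A_coef (g, s) (1%g, s) = 1.
Proof.
apply: (@gs_op_scale _ _ (g, s)) => w; rewrite scale1r.
have := gs_opM (g, s) (1%g, s) w.
by rewrite {1}/A_mul /= mulg1 => <-; rewrite gs_op1 /gs_op /= gs_inj_eq.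
Qed.

Fact A_one_l q : \sum_p (A_one p * A_coef p q) *: mono K (A_mul p q) = mono K q.
Proof.
case: q => g s; rewrite (bigD1 (1%g, gs_act s g^-1%g)) //= ffunE eqxx.
rewrite A_coef1l mulr1 scale1r {1}/A_mul mul1g big1 ?addr0 // => -[h t] /= ne.
rewrite ffunE /=; case: eqP => [h1|_]; last by rewrite mul0r scale0r.
rewrite /A_coef /=; case: eqP => [e|_]; last by rewrite mulr0 scale0r.
by case/eqP: ne; rewrite h1 -e gs_actK.
Qed.

Fact A_one_r q : \sum_p (A_one p * A_coef q p) *: mono K (A_mul q p) = mono K q.
Proof.
case: q => g s; rewrite (bigD1 (1%g, s)) //= ffunE eqxx.
rewrite A_coef1r mulr1 scale1r {1}/A_mul mulg1 big1 ?addr0 // => -[h t] /= ne.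
rewrite ffunE /=; case: eqP => [h1|_]; last by rewrite mul0r scale0r.
rewrite /A_coef /=; case: eqP => [e|_]; last by rewrite mulr0 scale0r.
by case/eqP: ne; rewrite h1 -e h1 gs_act1.
Qed.

(* A_alpha(G, S); the basis element a (x) e(M) has index (a, M). *)
Definition A_mono : mono_struct K (gT * S)%type :=
  MonoStruct A_mulA A_coefA A_one_l A_one_r.
Definition A_alpha : assoc_alg K := mono_alg A_mono.

Definition A_act : A_alpha -> total -> total := mono_ext gs_op.

Lemma gs_total_sum (w : total) : \sum_s gs_inj (gs_coord w s) = w.
Proof.
apply: dsum_eqP => t; rewrite -!/(gs_coord _ t) (is_linear_sum (gs_coord_lin t)) (bigD1 t) //= gs_inj_eq.
rewrite big1 ?addr0 // => s /eqP nst; exact: gs_inj_neq.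
Qed.

Fact A_actP : is_action A_act.
Proof.
apply: mono_ext_action => [p|p q u|u]; first exact: gs_op_lin.
  exact: gs_opM.
rewrite -[RHS]gs_total_sum.
transitivity (\sum_g \sum_s A_one (g, s) *: gs_op (g, s) u).
  by rewrite pair_bigA; apply: eq_bigr => -[].
rewrite (bigD1 1%g) //= [X in _ + X]big1 ?addr0 => [|g /negPf ng]; last first.
  by apply: big1 => s _; rewrite ffunE /= ng scale0r.
by apply: eq_bigr => s _; rewrite ffunE eqxx scale1r gs_op1.
Qed.

Lemma gs_inj_mode s v n (w : M s) : gs_inj (pm_mode v n w) = pm_mode v n (gs_inj w).
Proof.
apply: dsum_eqP => t; rewrite -!/(gs_coord _ t) gs_coord_mode.
case: (pselect (s = t)) => [<-|nst]; first by rewrite !gs_inj_eq.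
rewrite !gs_inj_neq //; symmetry; exact: is_linear0 ((pm_bilin (M t)).2 v n).
Qed.

Lemma gs_op_comm p (v : fixed_voa G) n w :
  gs_op p (res_mode v n w) = res_mode v n (gs_op p w).
Proof. by rewrite /gs_op /res_mode gs_coord_mode phi_mode fix_valP gs_inj_mode. Qed.

Fact A_act_comm a (v : fixed_voa G) n (w : total) :
  A_act a (res_mode v n w) = res_mode v n (A_act a w).
Proof.
have lin := (res_bilin G total).2 v n.
rewrite /A_act /mono_ext (is_linear_sum lin); apply: eq_bigr => p _.
by rewrite (is_linearZ lin) gs_op_comm.
Qed.

Definition total_bimodule : bimodule A_alpha (fixed_voa G) :=
  @BiModule _ _ _ (res_premodule G total) A_act A_actP A_act_comm.

Section Stabilizer.
Variable s : S.
Local Notation H := [subg gs_stab_Group s].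

Lemma stab_act (x : H) : gs_act s (sgval x) = s.
Proof. exact/gs_stabP/(subgP x). Qed.

Lemma stab_coef (x y : H) :
  A_coef (sgval x, s) (sgval y, s) = alpha F s (sgval x) (sgval y).
Proof. by rewrite /A_coef /= stab_act eqxx. Qed.

Definition tga_coef (x y : H) : K := alpha F s (sgval x) (sgval y).

Fact tga_coefA (x y z : H) :
  tga_coef x y * tga_coef (x * y)%g z = tga_coef y z * tga_coef x (y * z)%g.
Proof. by rewrite /tga_coef -!stab_coef; apply: A_coefA. Qed.

Fact tga_one_l (y : H) :
  \sum_x (mono K 1%g x * tga_coef x y) *: mono K (x * y)%g = mono K y.
Proof.
rewrite (bigD1 1%g) //= ffunE eqxx mul1r mul1g.
have := A_coef1l s (sgval y); rewrite /A_coef /= gs_actVK eqxx /tga_coef => ->.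
by rewrite scale1r big1 ?addr0 // => x /negPf nx; rewrite ffunE nx mul0r scale0r.
Qed.

Fact tga_one_r (y : H) :
  \sum_x (mono K 1%g x * tga_coef y x) *: mono K (y * x)%g = mono K y.
Proof.
rewrite (bigD1 1%g) //= ffunE eqxx mul1r mulg1.
have := A_coef1r s (sgval y); rewrite /A_coef /= gs_act1 eqxx /tga_coef => ->.
by rewrite scale1r big1 ?addr0 // => x /negPf nx; rewrite ffunE nx mul0r scale0r.
Qed.

Definition tga_mono : mono_struct K H :=
  @MonoStruct K H tga_coef (fun x y => x * y)%g (mono K 1%g)
    (@mulgA _) tga_coefA tga_one_l tga_one_r.
Definition tga : assoc_alg K := mono_alg tga_mono.

Definition stab_op (x : H) (w : M s) : M s := gs_coord (gs_op (sgval x, s) (gs_inj w)) s.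

Lemma stab_op_inj x w : gs_inj (stab_op x w) = gs_op (sgval x, s) (gs_inj w).
Proof.
rewrite /stab_op gs_op_inj.
have e : gs_act s (sgval x)^-1%g = s by rewrite -{1}(stab_act x) gs_actK.
suff h t (u : M t) : t = s -> gs_inj (gs_coord (gs_inj u) s) = gs_inj u by apply: h.
by move=> {}e; subst t; rewrite gs_inj_eq.
Qed.

Lemma stab_op_lin x : is_linear (stab_op x).
Proof. by move=> c u v; rewrite /stab_op gs_inj_lin gs_op_lin gs_coord_lin. Qed.

Definition tga_act : tga -> M s -> M s := mono_ext stab_op.

Fact tga_actP : is_action tga_act.
Proof.
apply: mono_ext_action => [x|x y u|u]; first exact: stab_op_lin.
  apply: gs_inj_inj; rewrite stab_op_inj stab_op_inj gs_opM.
  by rewrite (is_linearZ (gs_inj_lin (s := s))) stab_op_inj stab_coef.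
rewrite /= (bigD1 1%g) //= ffunE eqxx scale1r big1 => [|x /negPf nx]; last first.
  by rewrite ffunE nx scale0r.
by rewrite addr0 /stab_op gs_op1 !gs_inj_eq.
Qed.

Fact tga_act_comm a (v : fixed_voa G) n (w : M s) :
  tga_act a (res_mode v n w) = res_mode v n (tga_act a w).
Proof.
have lin := (res_bilin G (M s)).2 v n.
rewrite /tga_act /mono_ext (is_linear_sum lin); apply: eq_bigr => x _.
rewrite (is_linearZ lin); congr (_ *: _).
apply: gs_inj_inj; rewrite stab_op_inj.
rewrite {1}/res_mode gs_inj_mode (gs_op_comm _ v n (gs_inj w)) -stab_op_inj.
by rewrite /res_mode gs_inj_mode.
Qed.

Definition mod_bimodule : bimodule tga (fixed_voa G) :=
  @BiModule _ _ _ (res_premodule G (M s)) tga_act tga_actP tga_act_comm.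

(* The identification of the twisted group algebra with S(M) *)
Definition tga_inj (x : tga) : A_alpha :=
  \sum_(g : H) (x : {ffun H -> K^o}) g *: (mono K (sgval g, s) : A_alpha).

Lemma tga_inj_lin : is_linear tga_inj.
Proof. exact: (mono_ext_lin (U := A_alpha) (fun g _ => mono K (sgval g, s)) 0). Qed.

Lemma tga_inj_mono (g : H) : tga_inj (mono K g) = mono K (sgval g, s).
Proof. exact: (mono_extE (U := A_alpha) (fun g _ => mono K (sgval g, s)) g 0). Qed.

Lemma tga_injM (x y : tga) : tga_inj (alg_mul x y) = alg_mul (tga_inj x) (tga_inj y).
Proof.
have Al := @alg_mul_linl _ A_alpha; have Ar := @alg_mul_linr _ A_alpha.
have Tl := @alg_mul_linl _ tga; have Tr := @alg_mul_linr _ tga.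
apply: (mono_lin_eq (f := fun x : tga => tga_inj (alg_mul x y))
  (h := fun x : tga => alg_mul (tga_inj x) (tga_inj y))) => [c u v|c u v|g].
- by rewrite Tl tga_inj_lin.
- by rewrite tga_inj_lin Al.
apply: (mono_lin_eq (f := fun y : tga => tga_inj (alg_mul (mono K g : tga) y))
  (h := fun y : tga => alg_mul (tga_inj (mono K g)) (tga_inj y))) => [c u v|c u v|h].
- by rewrite Tr tga_inj_lin.
- by rewrite tga_inj_lin Ar.
rewrite !tga_inj_mono [alg_mul _ _ in LHS]mono_mulE mono_extE mono_shift_mono.
rewrite (is_linearZ tga_inj_lin) tga_inj_mono.
rewrite [alg_mul _ _ in RHS]mono_mulE mono_extE mono_shift_mono.
by congr (_ *: _); rewrite /= stab_coef.
Qed.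

Definition D_pred (f : A_alpha) : Prop :=
  forall p, p.2 != s -> (f : {ffun gT * S -> K^o}) p = 0.

Fact D_subspace : is_subspace D_pred.
Proof.
split=> [p _|c f g Df Dg p ps]; first by rewrite ffunE.
by rewrite !ffunE Df // Dg // [_ *: _]mulr0 addr0.
Qed.

(* D(M) *)
Definition D_lmod : lmodType K := sub_lmod (Subspace D_subspace).

Definition D_val (d : D_lmod) : A_alpha := sm_val d.

Lemma D_valP d : D_pred (D_val d). Proof. exact: (sub_eltP d). Qed.

Lemma D_mono g : D_pred (mono K (g, s)).
Proof. by move=> p ps; rewrite ffunE; case: eqP => // e; rewrite e eqxx in ps. Qed.

Lemma D_sum (J : Type) (r : seq J) (P : pred J) (E : J -> A_alpha) :
  (forall j, D_pred (E j)) -> D_pred (\sum_(j <- r | P j) E j).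
Proof.
move=> DE; elim/big_ind: _ => // [|x y Dx Dy]; first exact: D_subspace.1.
by rewrite -[x]scale1r; apply: D_subspace.2.
Qed.

Lemma D_scale c x : D_pred x -> D_pred (c *: x).
Proof. by move=> Dx; rewrite -[_ *: _]addr0; apply: D_subspace.2 => //; apply: D_subspace.1. Qed.

Lemma D_mul (f g : A_alpha) : D_pred g -> D_pred (alg_mul f g).
Proof.
move=> Dg; apply: D_sum => p; apply: D_sum => -[b t].
case: (eqVneq t s) => [->|nts]; first exact/D_scale/D_mono.
by rewrite (Dg (b, t)) // mulr0 mul0r scale0r; apply: D_subspace.1.
Qed.

Lemma D_tga (x : tga) : D_pred (tga_inj x).
Proof. by apply: D_sum => g; apply/D_scale/D_mono. Qed.

Definition D_left (a : A_alpha) (d : D_lmod) : D_lmod :=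
  sub_elt (P := Subspace D_subspace) (D_mul a (D_valP d)).
Definition D_right (x : tga) (d : D_lmod) : D_lmod :=
  sub_elt (P := Subspace D_subspace) (D_mul (D_val d) (D_tga x)).

Lemma D_left_lin a : is_linear (D_left a).
Proof.
move=> c d d'; apply: val_inj; rewrite sub_valD.
exact: (@alg_mul_linr _ A_alpha a).
Qed.

Lemma D_left_right a x d : D_left a (D_right x d) = D_right x (D_left a d).
Proof. by apply: val_inj; apply: (@alg_mulA _ A_alpha). Qed.

Section Induction.
Variable W : amodule tga.

Definition ind_lmod : lmodType K := btensor D_right (@am_act _ _ W).

Definition ind_act (a : A_alpha) : ind_lmod -> ind_lmod :=
  tens_mapl (r := D_right) (l := @am_act _ _ W) (D_left a).

Let tens0 : D_lmod -> W -> ind_lmod := tens D_right (@am_act _ _ W).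

Let bal_left a :
  balanced D_right (@am_act _ _ W) (fun d w => tens0 (D_left a d) w).
Proof. by apply: balanced_mapl => [|x d]; [apply: D_left_lin | apply: D_left_right]. Qed.

Lemma ind_actE a d w : ind_act a (tens0 d w) = tens0 (D_left a d) w.
Proof. exact: tens_liftE (bal_left a). Qed.

Lemma ind_act_lin a : is_linear (ind_act a).
Proof. exact: tens_lift_lin (bal_left a). Qed.

Fact ind_actP : is_action ind_act.
Proof.
have [bl br _] := tens_balanced D_right (@am_act _ _ W).
split=> [x c a b|a c x y|x|a b x]; last 2 first.
- apply: (tens_lift_uniq (f := ind_act (alg_one A_alpha)) (g := id)) => // [|u w].
    exact: ind_act_lin.
  by rewrite ind_actE; congr (tens0 _ w); apply: val_inj; apply: (@alg_mul1l _ A_alpha).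
- apply: (tens_lift_uniq (f := ind_act (alg_mul a b))
    (g := fun x => ind_act a (ind_act b x))) => // [|c y z|u w].
  + exact: ind_act_lin.
  + by rewrite !ind_act_lin.
  + rewrite !ind_actE; congr (tens0 _ w); apply: val_inj.
    by symmetry; apply: (@alg_mulA _ A_alpha).
- apply: (tens_lift_uniq (f := ind_act (c *: a + b))
    (g := fun x => c *: ind_act a x + ind_act b x)) => [|d y z|u w].
  + exact: ind_act_lin.
  + by rewrite !ind_act_lin !scalerDr !scalerA mulrC addrACA.
  + rewrite !ind_actE -bl; congr (tens0 _ w); apply: val_inj.
    by rewrite sub_valD; apply: (@alg_mul_linl _ A_alpha).
- exact: ind_act_lin.
Qed.

(* D(M) (x)_S(M) W *)
Definition ind_module : amodule A_alpha := AModule ind_actP.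
End Induction.
(* W_lambda induced to A_alpha(G, S), and Hom(W_lambda, M) with V^G acting
   through M, for an irreducible character lambda of the twisted group algebra *)
Definition ind_irr (lambda : irr_char tga) : amodule A_alpha :=
  ind_module (irr_mod lambda).
Definition mult_irr (lambda : irr_char tga) : premodule (fixed_voa G) :=
  mult_space (irr_mod lambda) mod_bimodule.
End Stabilizer.
End AAlpha.

(* Main.v *)
(* A product [u_p v_n] of modes agrees, on any given finite set of vectors, with
   a sum of single modes (Jacobi identity). Hence by the Jacobson density argument
   every linear operator on the sum of the modules of [S] that preserves each of
   them agrees, on a finite set, with a sum of modes of [V]; averaging over [G],
   every operator commuting with [A_alpha(G, S)] agrees there with a sum of modes
   of [V^G].
   As [V] is simple, [v (x) w |-> Y(v, z) w] is injective, so that the argument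
   proving the independence of distinct characters shows that [A_alpha(G, S)]
   acts faithfully. This algebra is separable: Maschke's theorem, Schur's lemma
   and explicit matrix units are available, and density gives the dual pair.
   Finally the simple modules of [A_alpha(G, S)] are the induced modules, by the
   Morita argument with the idempotents [1 (x) e(M^j)], whose corners are the
   twisted group algebras of the stabilizers, and
   [Hom(Ind W, MM) = Hom(W, M^j)] by Frobenius reciprocity. *)
From HB Require Import structures.
From mathcomp Require Import all_boot all_order all_algebra all_fingroup.
From mathcomp Require Import boolp classical_sets cardinality reals complex.
Require Import Defs.

Set Implicit Arguments.
Unset Strict Implicit.
Unset Printing Implicit Defensive.
Import Order.TTheory GRing.Theory Num.Theory.
Local Open Scope ring_scope.

(** * Linear algebra and stable subspaces *)

(** The modules in [S] have infinite dimension, and this shapes the argument. Complements come from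
    Zorn's lemma, eigenvalues for Schur's lemma come from a finite-dimensional weight space, and
    density controls an operator on finitely many vectors only. The last restriction is harmless:
    simple modules of [A_alpha(G, S)] have finite dimension, so a homomorphism from one of them is
    determined on a finite basis. Faithfulness is what makes every simple module [X] occur: a matrix
    unit of [X] acts on the sum of all modules through homomorphisms from [X], so without such
    homomorphisms it would act as zero. The sets [Lambda_j] consist of characters, while the Morita
    argument produces modules. Therefore simple modules of a twisted group algebra with equal
    characters must be shown to be isomorphic; this is where the traces of the matrix units are
    needed. *)

Section Linear.
Variables (K : numFieldType) (U W : lmodType K).

Lemma is_linearN (f : U -> W) u : is_linear f -> f (- u) = - f u.
Proof. by move=> fl; rewrite -scaleN1r is_linearZ // scaleN1r. Qed.

Lemma is_linearB (f : U -> W) u v : is_linear f -> f (u - v) = f u - f v.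
Proof. by move=> fl; rewrite is_linearD // is_linearN. Qed.

Lemma is_linear_comp (X : lmodType K) (f : W -> X) (g : U -> W) :
  is_linear f -> is_linear g -> is_linear (f \o g).
Proof. by move=> fl gl c u v; rewrite /= gl fl. Qed.

Lemma is_linear_bigsum (J : Type) (r : seq J) (P : pred J) (f : J -> U -> W) :
  (forall j, is_linear (f j)) -> is_linear (fun u => \sum_(j <- r | P j) f j u).
Proof.
move=> fl c u v; rewrite scaler_sumr -big_split /=.
by apply: eq_bigr => j _; apply: fl.
Qed.

Lemma subspaceD (P : U -> Prop) u v : is_subspace P -> P u -> P v -> P (u + v).
Proof. by move=> [_ Pl] Pu Pv; rewrite -[u]scale1r; apply: Pl. Qed.

Lemma subspaceZ (P : U -> Prop) c u : is_subspace P -> P u -> P (c *: u).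
Proof. by move=> [P0 Pl] Pu; rewrite -[_ *: _]addr0; apply: Pl. Qed.

Lemma subspaceB (P : U -> Prop) u v : is_subspace P -> P u -> P v -> P (u - v).
Proof. by move=> PS Pu Pv; rewrite addrC -scaleN1r; apply: PS.2. Qed.

Lemma subspace_sum (P : U -> Prop) (J : Type) (r : seq J) (Q : pred J) (f : J -> U) :
  is_subspace P -> (forall j, Q j -> P (f j)) -> P (\sum_(j <- r | Q j) f j).
Proof.
by move=> PS Pf; elim/big_ind: _ => //; [apply: PS.1 | move=> u v; apply: subspaceD].
Qed.

Lemma subspace_preim (f : U -> W) (P : W -> Prop) :
  is_linear f -> is_subspace P -> is_subspace (fun u => P (f u)).
Proof.
move=> fl PS; split=> [|c u v Pu Pv]; first by rewrite is_linear0 //; apply: PS.1.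
by rewrite fl; apply: PS.2.
Qed.

Lemma subspace_eq (f g : U -> W) :
  is_linear f -> is_linear g -> is_subspace (fun u => f u = g u).
Proof.
move=> fl gl; split=> [|c u v e1 e2]; first by rewrite !is_linear0.
by rewrite fl gl e1 e2.
Qed.

Lemma subspace_im (f : U -> W) (P : U -> Prop) : is_linear f -> is_subspace P ->
  is_subspace (fun w => exists2 u, P u & f u = w).
Proof.
move=> fl PS; split=> [|c _ _ [u Pu <-] [v Pv <-]].
  by exists 0; [apply: PS.1 | apply: is_linear0].
by exists (c *: u + v); [apply: PS.2 | apply: fl].
Qed.

Lemma subspace_eq0 : is_subspace (fun u : U => u = 0).
Proof. by split=> // c u v -> ->; rewrite scaler0 addr0. Qed.

Lemma subspace_true : is_subspace (fun _ : U => True).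
Proof. by []. Qed.

Lemma subspaceI (P Q : U -> Prop) :
  is_subspace P -> is_subspace Q -> is_subspace (fun u => P u /\ Q u).
Proof.
move=> PS QS; split=> [|c u v [Pu Qu] [Pv Qv]]; first by split; [apply: PS.1 | apply: QS.1].
by split; [apply: PS.2 | apply: QS.2].
Qed.

Lemma inj_linear (f : U -> W) :
  is_linear f -> (forall u, f u = 0 -> u = 0) -> injective f.
Proof.
move=> fl f0 u v e; apply/eqP; rewrite -subr_eq0; apply/eqP/f0.
by rewrite is_linearB // e subrr.
Qed.

End Linear.

Lemma inj_surj_bijective (T T' : Type) (f : T -> T') :
  injective f -> (forall y, exists x, f x = y) -> bijective f.
Proof.
move=> finj /(_ _)/cid fs; exists (fun y => projT1 (fs y)) => [x|y].
  by apply: finj; case: (fs (f x)).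
by case: (fs y).
Qed.

Section Stable.
Variables (K : numFieldType) (U : lmodType K) (I : Type) (op : I -> U -> U).
Hypothesis op_lin : forall i, is_linear (op i).

Definition stable (P : U -> Prop) : Prop :=
  is_subspace P /\ forall i u, P u -> P (op i u).

Definition simple_sub (P : U -> Prop) : Prop :=
  forall Q : U -> Prop, stable Q -> (forall u, Q u -> P u) ->
    (forall u, Q u -> u = 0) \/ (forall u, P u -> Q u).

Definition sub_add (P Q : U -> Prop) (u : U) : Prop :=
  exists p q, [/\ P p, Q q & u = p + q].

Lemma stable_add P Q : stable P -> stable Q -> stable (sub_add P Q).
Proof.
move=> [PS Po] [QS Qo]; split; first split=> [|c u v].
- by exists 0, 0; rewrite addr0; split=> //; [apply: PS.1 | apply: QS.1].
- move=> [p [q [Pp Qq ->]]] [p' [q' [Pp' Qq' ->]]].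
  exists (c *: p + p'), (c *: q + q'); split; [exact: PS.2 | exact: QS.2 |].
  by rewrite scalerDr addrACA.
- move=> i u [p [q [Pp Qq ->]]]; exists (op i p), (op i q).
  by split; [apply: Po | apply: Qo | apply: is_linearD].
Qed.

Lemma sub_addl P Q u : stable Q -> P u -> sub_add P Q u.
Proof. by move=> [QS _] Pu; exists u, 0; rewrite addr0; split=> //; apply: QS.1. Qed.

Lemma sub_addr P Q u : stable P -> Q u -> sub_add P Q u.
Proof. by move=> [PS _] Qu; exists 0, u; rewrite add0r; split=> //; apply: PS.1. Qed.

Lemma stable_max (Z E : U -> Prop) : stable Z -> (forall u, Z u -> ~ E u) ->
  exists Q, [/\ stable Q, forall u, Z u -> Q u, forall u, Q u -> ~ E u
    & forall Q', stable Q' -> (forall u, Q u -> Q' u) -> (exists2 u, Q' u & ~ Q u) ->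
        exists2 u, Q' u & E u].
Proof.
(* [Z] is joined to every member of the chain, so that the empty chain causes
   no trouble *)
move=> Zst ZE; pose ZU (A : set U) u := Z u \/ A u.
have [|A [[Ast AE] Amax]] :=
  @Zorn_bigcup U (fun A => stable (ZU A) /\ (forall u, ZU A u -> ~ E u)).
  move=> F FP Ftot; split; last first.
    by move=> u [/ZE //|[X FX Xu]]; apply: (FP X FX).2; right.
  split; first split=> [|c u v].
  - by left; apply: Zst.1.1.
  - have join X w : F X -> ZU X w -> ZU (\bigcup_(X in F) X)%classic w.
      by move=> FX [Zw|Xw]; [left | right; exists X].
    case=> [Zu|[X FX Xu]] [Zv|[Y FY Yv]].
    + by left; apply: Zst.1.2.
    + by apply: (join Y _ FY); apply: (FP Y FY).1.1.2; [left | right].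
    + by apply: (join X _ FX); apply: (FP X FX).1.1.2; [right | left].
    + have [XY|YX] := Ftot _ _ FX FY.
        by apply: (join Y _ FY); apply: (FP Y FY).1.1.2; right => //; apply: XY.
      by apply: (join X _ FX); apply: (FP X FX).1.1.2; right => //; apply: YX.
  - move=> i u [Zu|[X FX Xu]]; first by left; apply: Zst.2.
    have [Zw|Xw] := (FP X FX).1.2 i u (or_intror Xu); first by left.
    by right; exists X.
exists (ZU A); split=> // [u Zu|Q' Q'st AQ' [u Q'u nAu]]; first by left.
apply: contrapT => nE.
apply: (Amax Q'); first split.
- by move=> v Av; apply: AQ'; right.
- by move=> Q'A; apply: nAu; right; apply: Q'A.
have ZQ' : ZU Q' = Q'.
  by apply/funext => v; apply/propext; split=> [[Zv|//]|]; [apply: AQ'; left | right].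
by rewrite ZQ'; split=> // v Q'v Ev; apply: nE; exists v.
Qed.

(** A sum of simple submodules is semisimple: for [Q] maximal among the stable subspaces meeting [Z]
    trivially, [Q + Z] contains every [C j], since otherwise [Q + C j] would be a larger candidate.
    The map [f] is the projection onto [Z] along [Q]. *)
Lemma stable_compl (J : Type) (C : J -> U -> Prop) (Z : U -> Prop) :
  (forall j, stable (C j)) -> (forall j, simple_sub (C j)) ->
  (forall Q, stable Q -> (forall j u, C j u -> Q u) -> forall u, Q u) ->
  stable Z ->
  exists f : U -> U, [/\ is_linear f, forall i u, f (op i u) = op i (f u),
    forall u, Z (f u) & forall u, Z u -> f u = u].
Proof.
move=> Cst Csim Cgen Zst.
have st0 : stable (fun u => u = 0).
  by split=> [|i u ->]; [apply: subspace_eq0 | apply: is_linear0].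
have [|Q [Qst _ QZ Qmax]] := @stable_max (fun u => u = 0) (fun u => Z u /\ u <> 0) st0.
  by move=> u u0 [].
have disj u : Q u -> Z u -> u = 0 by move=> /QZ nu Zu; apply: contrapT => ?; apply: nu.
have QZst := stable_add Qst Zst.
have all u : sub_add Q Z u.
  apply: Cgen => // j; pose D u := C j u /\ sub_add Q Z u.
  have Dst : stable D.
    split=> [|i v [Cv Sv]]; first exact: subspaceI (Cst j).1 QZst.1.
    by split; [apply: (Cst j).2 | apply: QZst.2].
  have [|D0|D1 v /D1 [//]] := Csim j D Dst; first by move=> v [].
  move=> v Cv; case: (pselect (Q v)) => [|nQv]; first exact: sub_addl.
  have [||w [q [c [Qq Cc we]]] [Zw nw]] :=
      Qmax (sub_add Q (C j)) (stable_add Qst (Cst j)).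
  - by move=> w; apply: sub_addl.
  - by exists v => //; apply: sub_addr.
  (* [c = w - q] lies in [C j] and in [Q + Z], so it vanishes by [D0]; then [w = q] lies in both [Q]
     and [Z]. *)
  have c0 : c = 0.
    apply: D0; split=> //; exists (- q), w; split=> //; last by rewrite we addKr.
    by rewrite -scaleN1r; apply: subspaceZ Qst.1 _.
  by case: nw; apply: disj => //; rewrite we c0 addr0.
have /(_ _)/cid h : forall u, exists z, Z z /\ Q (u - z).
  by move=> u; have [q [z [Qq Zz ->]]] := all u; exists z; rewrite addrK.
pose f u := projT1 (h u).
have fP u : Z (f u) /\ Q (u - f u) by rewrite /f; case: (h u).
have funi u z : Z z -> Q (u - z) -> f u = z.
  move=> Zz Qz; have [Zf Qf] := fP u; apply/eqP; rewrite -subr_eq0; apply/eqP/disj.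
    rewrite (_ : f u - z = (u - z) - (u - f u)); first exact: subspaceB Qst.1 _ _.
    by rewrite opprB [RHS]addrC addrA subrK.
  exact: subspaceB Zst.1 _ _.
exists f; split=> [c u v|i u|u|u Zu].
- have [Zu Qu] := fP u; have [Zv Qv] := fP v; apply: funi; first exact: Zst.1.2.
  rewrite (_ : _ - _ = c *: (u - f u) + (v - f v)); first exact: Qst.1.2.
  by rewrite scalerBr opprD addrACA.
- have [Zu Qu] := fP u; apply: funi; first exact: Zst.2.
  by rewrite -is_linearB //; apply: Qst.2.
- by case: (fP u).
- by apply: funi => //; rewrite subrr; apply: Qst.1.1.
Qed.

Lemma simple_line u : simple_sub (fun v => exists c, v = c *: u).
Proof.
move=> Q [QS _] Ql; case: (pselect (Q u)) => [Qu|nQu].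
  by right=> _ [c ->]; apply: subspaceZ.
left=> v Qv; have [c ve] := Ql _ Qv; case: (eqVneq c 0) => [c0|nc0].
  by rewrite ve c0 scale0r.
by case: nQu; rewrite -[u](scalerK nc0) -ve; apply: subspaceZ.
Qed.
End Stable.

(** * Projections, functionals and finite bases of vector spaces *)

Section Complement.
Variables (K : numFieldType) (U : lmodType K).

(** A vector space is the sum of its lines, which are simple; this is [stable_compl] for an empty
    family of operators. *)
Lemma linear_proj (Z : U -> Prop) : is_subspace Z ->
  exists f : U -> U, [/\ is_linear f, forall u, Z (f u) & forall u, Z u -> f u = u].
Proof.
move=> Zs; pose op (i : void) (u : U) := u.
have opl i : is_linear (op i) by [].
have [||||f [fl _ fZ fK]] := stable_compl opl (C := fun u v => exists c, v = c *: u) (Z := Z).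
- move=> u; split=> // ; split=> [|c _ _ [a ->] [b ->]]; first by exists 0; rewrite scale0r.
  by exists (c * a + b); rewrite scalerDl scalerA.
- by move=> u; apply: simple_line.
- by move=> Q _ QC u; apply: (QC u); exists 1; rewrite scale1r.
- by split.
by exists f.
Qed.

Lemma exists_functional (u : U) : u <> 0 ->
  exists f : U -> K^o, is_linear f /\ f u = 1.
Proof.
move=> nz; have [|f [fl fZ fK]] := @linear_proj (fun v => exists c, v = c *: u).
  split=> [|c _ _ [a ->] [b ->]]; first by exists 0; rewrite scale0r.
  by exists (c * a + b); rewrite scalerDl scalerA.
pose g v : K^o := projT1 (cid (fZ v)).
have gP v : f v = g v *: u by rewrite /g; case: cid.
have uni a b : a *: u = b *: u -> a = b.
  move/eqP; rewrite -subr_eq0 -scalerBl scaler_eq0 subr_eq0.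
  by case/orP=> [/eqP|/eqP].
exists g; split=> [c v w|]; apply: uni.
  by rewrite -gP fl !gP scalerDl scalerA.
by rewrite -gP fK ?scale1r //; exists 1; rewrite scale1r.
Qed.

End Complement.

Lemma linear_retract (K : numFieldType) (U W : lmodType K) (f : U -> W) :
  is_linear f -> injective f -> exists2 g : W -> U, is_linear g & cancel f g.
Proof.
move=> fl fi; have [g [gl gZ gK]] := linear_proj (subspace_im fl (subspace_true U)).
have /(_ _)/cid2 h : forall w, exists2 u, True & f u = g w by move=> w; apply: gZ.
exists (fun w => s2val (h w)) => [c v w|u]; apply: fi; last first.
  by rewrite (s2valP' (h _)) gK //; exists u.
by rewrite fl !(s2valP' (h _)) gl.
Qed.

Section FiniteDim.
Variables (K : numFieldType) (U : lmodType K).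

Definition is_basis n (e : 'I_n -> U) (x : 'I_n -> U -> K^o) : Prop :=
  [/\ forall i, is_linear (x i), forall u, u = \sum_i x i u *: e i
    & forall i j, x i (e j) = (i == j)%:R].

Definition spans (P : U -> Prop) n (e : 'I_n -> U) : Prop :=
  forall u, P u -> exists c : 'I_n -> K, u = \sum_i c i *: e i.

Lemma span_drop (P : U -> Prop) n (e : 'I_n.+1 -> U) (c : 'I_n.+1 -> K) i :
  spans P e -> \sum_i c i *: e i = 0 -> c i != 0 -> spans P (e \o lift i).
Proof.
move=> eP ce0 nci u /eP [d ->].
have ei : e i = \sum_k (- (c i)^-1 * c (lift i k)) *: e (lift i k).
  move: ce0; rewrite (bigD1_ord i) //= => /eqP; rewrite addr_eq0 => /eqP ce.
  apply: (scalerI nci); rewrite ce scaler_sumr -sumrN; apply: eq_bigr => k _.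
  by rewrite scalerA mulrA mulrN divff // mulN1r scaleNr.
exists (fun k => d i * (- (c i)^-1 * c (lift i k)) + d (lift i k)).
rewrite (bigD1_ord i) //= {1}ei scaler_sumr -big_split; apply: eq_bigr => k _ /=.
by rewrite scalerDl scalerA.
Qed.

(** A spanning family of least length is free, by [span_drop]. *)
Lemma exists_basis : fin_dim (fun _ : U => True) ->
  exists n (e : 'I_n -> U) x, is_basis e x.
Proof.
move=> fd; have : exists n, `[< exists e : 'I_n -> U, spans (fun _ => True) e >].
  by have [n [e h]] := fd; exists n; apply/asboolP; exists e.
move/ex_minnP => [n /asboolP[e eP] nmin].
have free c : \sum_i c i *: e i = 0 -> forall i, c i = 0.
  move=> ce0 i; apply/eqP/negP => /negP nci.
  case: n => [|n] in e eP nmin c ce0 i nci *; first by case: i nci => [].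
  suff: (n < n)%N by rewrite ltnn.
  apply: nmin; apply/asboolP.
  by exists (e \o lift i); apply: span_drop ce0 nci.
pose x i u : K^o := projT1 (cid (eP u I)) i.
have xP u : u = \sum_i x i u *: e i by rewrite /x; case: cid.
have uni c d : \sum_i c i *: e i = \sum_i d i *: e i -> forall i, c i = d i.
  move=> cd i; apply/eqP; rewrite -subr_eq0; apply/eqP.
  apply: (free (fun i => c i - d i)); rewrite (eq_bigr _ (fun i _ => scalerBl _ _ _)).
  by rewrite sumrB cd subrr.
exists n, e, x; split=> // [i c u v|i j].
  apply: (uni (x^~ _) (fun i => c * x i u + x i v)).
  rewrite -xP (eq_bigr _ (fun i _ => scalerDl _ _ _)) big_split /=.
  rewrite (eq_bigr (fun i => c *: (x i u *: e i))) => [|k _]; last by rewrite scalerA.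
  by rewrite -scaler_sumr -!xP.
apply: (uni (x^~ _) (fun i => (i == j)%:R)); rewrite -xP (bigD1 j) //= eqxx scale1r.
by rewrite big1 ?addr0 // => k /negPf ->; rewrite scale0r.
Qed.

Lemma basis_uniq n (e : 'I_n -> U) x (c : 'I_n -> K) : is_basis e x ->
  forall i, x i (\sum_j c j *: e j) = c i.
Proof.
move=> [xl _ xe] i; rewrite is_linear_sum // (bigD1 i) //= is_linearZ // xe eqxx.
rewrite [_ *: _]mulr1 big1 ?addr0 // => j /negPf ji.
by rewrite is_linearZ // xe eq_sym ji [_ *: _]mulr0.
Qed.

Lemma fin_dim_sub (P : U -> Prop) : is_subspace P -> fin_dim P ->
  exists (n : nat) (e : 'I_n -> U), (forall i, P (e i)) /\ spans P e.
Proof.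
move=> PS [n [e eP]]; have [f [fl fP fK]] := linear_proj PS.
exists n, (f \o e); split=> [i|u Pu]; first exact: fP.
have [c ue] := eP u Pu; exists c; rewrite -[LHS]fK // ue is_linear_sum //.
by apply: eq_bigr => i _; rewrite is_linearZ.
Qed.

Lemma fin_dim_finType (I : finType) (e : I -> U) (P : U -> Prop) :
  (forall u, P u -> exists c : I -> K, u = \sum_i c i *: e i) -> fin_dim P.
Proof.
move=> eP; exists #|I|, (e \o enum_val) => u /eP [c ->]; exists (c \o enum_val).
rewrite (reindex_onto enum_val enum_rank) /= => [|i _]; last exact: enum_rankK.
by apply: eq_bigl => i; rewrite enum_valK eqxx.
Qed.
End FiniteDim.

Lemma exists_eigenvec (K : numClosedFieldType) (U : lmodType K) (f : U -> U)
    (P : U -> Prop) : is_linear f -> is_subspace P -> fin_dim P ->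
  (forall u, P u -> P (f u)) -> (exists2 u, P u & u <> 0) ->
  exists c u, [/\ P u, u <> 0 & f u = c *: u].
Proof.
move=> fl PS Pf Pst [u0 Pu0 nu0].
pose S : lmodType K := sub_lmod (Subspace PS).
have vall : is_linear (val : S -> U) by move=> c u v; apply: sub_valD.
have [|n [e [x exB]]] := @exists_basis _ S.
  have [n [e [eP eS]]] := fin_dim_sub PS Pf.
  exists n, (fun i => sub_elt (P := Subspace PS) (eP i)) => u _.
  have [c ue] := eS _ (sub_eltP u); exists c; apply: val_inj; rewrite ue.
  by rewrite (is_linear_sum vall); apply: eq_bigr => i _; rewrite (is_linearZ vall).
have [xl ex xe] := exB.
pose g (u : S) : S := sub_elt (P := Subspace PS) (Pst _ (sub_eltP u)).
have gE u : val (g u) = f (val u) by [].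
have gl : is_linear g by move=> c u v; apply: val_inj; rewrite gE !vall fl !gE.
(* Row [i] holds the coordinates of [g (e i)], so that the row eigenvector given by [eigenvalueP] is
   itself the coordinate vector of an eigenvector of [g]. *)
pose A : 'M[K]_n := \matrix_(i, j) x j (g (e i)).
have [c /eigenvalueP[v vA nv]] : exists c, eigenvalue A c.
  have /closed_rootP[c rc] : size (char_poly A) != 1%N.
    rewrite size_char_poly eqSS; case: n => [|//] in e x exB xl ex xe A *.
    case: nu0; pose s0 : S := sub_elt (P := Subspace PS) Pu0.
    by have := congr1 val (ex s0); rewrite big_ord0.
  by exists c; rewrite eigenvalue_root_char.
pose u : S := \sum_i v 0 i *: e i.
exists c, (val u); split; first exact: (@sub_eltP _ _ (Subspace PS) u).
  move=> vu0; have uE0 : u = 0 by apply: val_inj; rewrite vu0 (is_linear0 vall).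
  case/eqP: nv; apply/rowP => i; rewrite mxE.
  by rewrite -(basis_uniq (fun i => v 0 i) exB i) -/u uE0 (is_linear0 (xl i)).
rewrite -[f _]/(val (g u)) -(is_linearZ vall); congr val.
rewrite /u (is_linear_sum gl) scaler_sumr.
transitivity (\sum_j (v *m A) 0 j *: e j); last first.
  by apply: eq_bigr => j _; rewrite vA mxE scalerA.
transitivity (\sum_i \sum_j (v 0 i * A i j) *: e j).
  apply: eq_bigr => i _; rewrite (is_linearZ gl) {1}(ex (g (e i))) scaler_sumr.
  by apply: eq_bigr => j _; rewrite scalerA mxE.
rewrite exchange_big; apply: eq_bigr => j _.
by rewrite mxE scaler_suml.
Qed.
(** * Modules over separable algebras *)

Section Trace.
Variables (K : numFieldType) (U : lmodType K).

(** Both sides equal the double sum of [x' j (e i) * x i (f (e' j))]. *)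
Lemma trace_basis n m (e : 'I_n -> U) x (e' : 'I_m -> U) x' (f : U -> U) :
  is_basis e x -> is_basis e' x' -> is_linear f ->
  \sum_i x i (f (e i)) = \sum_j x' j (f (e' j)).
Proof.
move=> [xl ex _] [xl' ex' _] fl.
transitivity (\sum_i \sum_j x' j (e i) *: x i (f (e' j))).
  apply: eq_bigr => i _; rewrite {1}(ex' (e i)) (is_linear_sum fl) (is_linear_sum (xl i)).
  by apply: eq_bigr => j _; rewrite (is_linearZ fl) (is_linearZ (xl i)).
rewrite exchange_big; apply: eq_bigr => j _.
rewrite [in RHS](ex (f (e' j))) (is_linear_sum (xl' j)); apply: eq_bigr => i _.
by rewrite (is_linearZ (xl' j)) [LHS]mulrC.
Qed.

(** This is the trace of the rank one operator [v |-> f v *: u]; it fixes the constant of the matrix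
    units and separates characters. *)
Lemma trace_rank1 n (e : 'I_n -> U) x (f : U -> K^o) u :
  is_basis e x -> is_linear f -> \sum_i x i (f (e i) *: u) = f u.
Proof.
move=> [xl ex _] fl; rewrite [in RHS](ex u) (is_linear_sum fl).
by apply: eq_bigr => i _; rewrite (is_linearZ (xl i)) (is_linearZ fl) [LHS]mulrC.
Qed.
End Trace.

(** Unique coordinates become coordinate functionals [x], the form in which traces are computed
    below. *)
Lemma affordsP (K : numFieldType) (A : assoc_alg K) (U : amodule A) (chi : A -> K) :
  affords U chi <-> exists n (e : 'I_n -> U) x,
    is_basis e x /\ forall a, chi a = \sum_i x i (am_act a (e i)).
Proof.
split=> [[n [e [mx [eP mxP chiE]]]]|[n [e [x [exB chiE]]]]].
  pose x i u : K^o := projT1 (cid (eP u)) 0 i.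
  have xP u : u = \sum_i x i u *: e i by rewrite /x; case: cid => /= c [].
  have uni c d : \sum_i c i *: e i = \sum_i d i *: e i -> forall i, c i = d i.
    move=> cd i; have [r [_ ru]] := eP (\sum_i c i *: e i).
    have rc : r = \row_j c j by apply: ru; apply: eq_bigr => j _; rewrite mxE.
    have rd : r = \row_j d j by apply: ru; rewrite cd; apply: eq_bigr => j _; rewrite mxE.
    by have := congr1 (fun r : 'rV_n => r 0 i) (etrans (esym rc) rd); rewrite !mxE.
  have xe c i : x i (\sum_j c j *: e j) = c i by apply: (uni (x^~ _)); rewrite -xP.
  exists n, e, x; split; first split=> // [i c u v|i j].
  - rewrite -[RHS](xe (fun j => c * x j u + x j v)); congr (x i _).
    rewrite (eq_bigr _ (fun i _ => scalerDl _ _ _)) big_split /=.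
    rewrite (eq_bigr (fun i => c *: (x i u *: e i))) => [|k _]; last by rewrite scalerA.
    by rewrite -scaler_sumr -!xP.
  - rewrite -[RHS](xe (fun i => (i == j)%:R)); congr (x i _); rewrite (bigD1 j) //=.
    by rewrite eqxx scale1r big1 ?addr0 // => k /negPf ->; rewrite scale0r.
  - by move=> a; rewrite chiE; apply: eq_bigr => i _; rewrite mxP xe.
have [xl ex xe] := exB.
exists n, e, (fun a => \matrix_(i, j) x i (am_act a (e j))); split=> [u|a j|a].
- exists (\row_i x i u); split=> [|c ->].
    by rewrite {1}(ex u); apply: eq_bigr => i _; rewrite mxE.
  by apply/rowP => i; rewrite mxE (basis_uniq (fun i => c 0 i) exB).
- by rewrite {1}(ex (am_act a _)); apply: eq_bigr => i _; rewrite mxE.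
- by rewrite chiE; apply: eq_bigr => i _; rewrite mxE.
Qed.

Section AlgebraModules.
Variables (K : numFieldType) (A : assoc_alg K).

Definition amod_hom (X Y : amodule A) (f : X -> Y) : Prop :=
  is_linear f /\ forall c x, f (am_act c x) = am_act c (f x).

Section OneModule.
Variable X : amodule A.

Lemma am_act_lin c : is_linear (@am_act K A X c).
Proof. by have [] := am_actP X. Qed.

Lemma am_act_linl x : is_linear (fun c => @am_act K A X c x).
Proof. by have [] := am_actP X. Qed.

Lemma am_act1 (x : X) : am_act (alg_one A) x = x.
Proof. by have [] := am_actP X. Qed.

Lemma am_actM c d (x : X) : am_act (alg_mul c d) x = am_act c (am_act d x).
Proof. by have [] := am_actP X. Qed.

Section Submodule.
Variable P : X -> Prop.
Hypothesis Pst : stable (@am_act K A X) P.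

Definition sub_am_act c (x : sub_lmod (Subspace Pst.1)) : sub_lmod (Subspace Pst.1) :=
  sub_elt (P := Subspace Pst.1) (Pst.2 c _ (sub_eltP x)).

Fact sub_am_actP : is_action sub_am_act.
Proof.
have vD c (x y : sub_lmod (Subspace Pst.1)) : val (c *: x + y) = c *: val x + val y.
  exact: sub_valD.
have vE c x : val (sub_am_act c x) = @am_act K A X c (val x) by [].
split=> [x c d e|c d x y|x|c d x]; apply: val_inj; rewrite ?vD !vE ?vD.
- exact: am_act_linl.
- exact: am_act_lin.
- exact: am_act1.
- exact: am_actM.
Qed.

Definition sub_amod : amodule A := AModule sub_am_actP.

Definition sub_incl (x : sub_amod) : X := val (x : sub_lmod (Subspace Pst.1)).

Lemma sub_incl_hom : amod_hom sub_incl.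
Proof. by split=> // c x y; apply: sub_valD. Qed.

Lemma sub_incl_inj : injective sub_incl. Proof. exact: val_inj. Qed.

Lemma sub_inclP x : P (sub_incl x). Proof. exact: (@sub_eltP _ _ (Subspace Pst.1) x). Qed.

Lemma sub_incl_surj x : P x -> exists y, sub_incl y = x.
Proof. by move=> Px; exists (sub_elt (P := Subspace Pst.1) Px). Qed.

Lemma sub_amod_simple : (exists2 x, P x & x <> 0) ->
  simple_sub (@am_act K A X) P -> simple_amodule sub_amod.
Proof.
have [il ia] := sub_incl_hom; move=> [x Px nx] Psim; split=> [|Q QS Qact].
  have [y yx] := sub_incl_surj Px; exists y => y0; apply: nx.
  by rewrite -yx y0; apply: is_linear0.
have [||Q0|Q1] := Psim (fun x => exists2 y, Q y & sub_incl y = x).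
- split; first exact: subspace_im.
  move=> c _ [y Qy <-]; exists (am_act c y); [exact: Qact | exact: ia].
- by move=> _ [y _ <-]; apply: sub_inclP.
- left=> y Qy; apply: sub_incl_inj; rewrite (is_linear0 il).
  by apply: Q0; exists y.
- right=> y; have [z Qz zy] := Q1 _ (sub_inclP y).
  by rewrite -(sub_incl_inj zy).
Qed.
End Submodule.

Lemma simple_cyclic (x y : X) : simple_amodule X -> x <> 0 -> exists c : A, am_act c x = y.
Proof.
move=> [_ Xs] nx.
have [|d _ [c <-]|X0|X1] := Xs (fun y => exists c : A, am_act c x = y).
- split=> [|c _ _ [d <-] [e <-]]; first by exists 0; apply: is_linear0 (am_act_linl x).
  by exists (c *: d + e); apply: am_act_linl.
- by exists (alg_mul d c); apply: am_actM.
- by case: nx; apply: X0; exists (alg_one A); apply: am_act1.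
- exact: X1.
Qed.

Lemma simple_fin_dim : fin_dim (fun _ : A => True) -> simple_amodule X ->
  fin_dim (fun _ : X => True).
Proof.
move=> [n [e eP]] Xs; have [x nx] := Xs.1.
exists n, (fun i => am_act (e i) x) => y _.
have [c <-] := simple_cyclic y Xs nx; have [d ->] := eP c I.
exists d; rewrite (is_linear_sum (am_act_linl x)); apply: eq_bigr => i _.
exact: is_linearZ (am_act_linl x) _ _.
Qed.
End OneModule.
Arguments am_act_lin : clear implicits.

Lemma amod_hom_ker (X Y : amodule A) (f : X -> Y) : amod_hom f ->
  stable (@am_act K A X) (fun x => f x = 0).
Proof.
move=> [fl fa]; split=> [|c x fx].
  split=> [|c x y fx fy]; first exact: is_linear0.
  by rewrite fl fx fy scaler0 addr0.
by rewrite fa fx; apply: is_linear0 (am_act_lin _ _).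
Qed.

Lemma amod_hom_im (X Y : amodule A) (f : X -> Y) : amod_hom f ->
  stable (@am_act K A Y) (fun y => exists2 x, True & f x = y).
Proof.
move=> [fl fa]; split=> [|c _ [x _ <-]]; first exact: subspace_im (subspace_true _).
by exists (am_act c x).
Qed.

Lemma amod_hom_comp (X Y Z : amodule A) (f : Y -> Z) (g : X -> Y) :
  amod_hom f -> amod_hom g -> amod_hom (f \o g).
Proof.
move=> [fl fa] [gl ga]; split=> [|c x]; first exact: is_linear_comp.
by rewrite /= ga fa.
Qed.

Lemma schur_inj (X Y : amodule A) (f : X -> Y) : simple_amodule X ->
  amod_hom f -> (exists x, f x <> 0) -> injective f.
Proof.
move=> [_ Xs] fh [x nfx]; apply: inj_linear fh.1 _ => y fy.
have [Ks Ka] := amod_hom_ker fh.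
by have [|K1] := Xs _ Ks Ka; [apply | case: nfx; apply: K1].
Qed.

Lemma schur_iso (X Y : amodule A) (f : X -> Y) : simple_amodule X -> simple_amodule Y ->
  amod_hom f -> (exists x, f x <> 0) -> amodule_iso X Y.
Proof.
move=> Xs Ys fh nf; exists f; last exact: fh.2.
split; first exact: fh.1.
apply: inj_surj_bijective; first exact: schur_inj nf.
have [Is Ia] := amod_hom_im fh; have [x nfx] := nf.
have [I0|I1 y] := Ys.2 _ Is Ia; first by case: nfx; apply: I0; exists x.
by have [z _ <-] := I1 y; exists z.
Qed.

Lemma amodule_iso_sym (X Y : amodule A) : amodule_iso X Y -> amodule_iso Y X.
Proof.
case=> f [fl [g fK gK]] fa; exists g.
  split; last by exists f.
  by move=> c x y; rewrite -[x in LHS]gK -[y in LHS]gK -fl fK.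
by move=> c x; rewrite -[x in LHS]gK -fa fK.
Qed.

Lemma affords_iso (X Y : amodule A) chi :
  amodule_iso X Y -> affords X chi -> affords Y chi.
Proof.
case=> f [fl [g fK gK]] fa /affordsP [n [e [x [[xl ex xe] chiE]]]]; apply/affordsP.
have gl : is_linear g by move=> c u v; rewrite -[u in LHS]gK -[v in LHS]gK -fl fK.
exists n, (f \o e), (fun i => x i \o g); split=> [|a].
  split=> [i|y|i j]; [exact: is_linear_comp | | by rewrite /= fK].
  rewrite -[LHS]gK [in LHS](ex (g y)) (is_linear_sum fl).
  by apply: eq_bigr => i _; rewrite (is_linearZ fl).
by rewrite chiE; apply: eq_bigr => i _; rewrite /= -fa fK.
Qed.

Lemma affords_uniq (X : amodule A) chi psi : affords X chi -> affords X psi -> chi = psi.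
Proof.
move=> /affordsP [n [e [x [exB chiE]]]] /affordsP [m [e' [x' [exB' psiE]]]].
by apply/funext => a; rewrite chiE psiE; apply: trace_basis => //; apply: am_act_lin.
Qed.

Lemma irr_mod_simple (chi : irr_char A) : simple_amodule (irr_mod chi).
Proof. exact: s2valP (cid2 (proj2_sig chi)). Qed.

Lemma irr_mod_affords (chi : irr_char A) : affords (irr_mod chi) (proj1_sig chi).
Proof. exact: s2valP' (cid2 (proj2_sig chi)). Qed.

Lemma irr_mod_inj (chi psi : irr_char A) :
  amodule_iso (irr_mod chi) (irr_mod psi) -> chi = psi.
Proof.
move=> iso; have : proj1_sig chi = proj1_sig psi.
  apply: (@affords_uniq (irr_mod psi)); last exact: irr_mod_affords.
  exact: affords_iso iso (irr_mod_affords chi).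
case: chi psi {iso} => [c1 p1] [c2 p2] /= e; subst c2.
by rewrite (Prop_irrelevance p1 p2).
Qed.
End AlgebraModules.
Arguments am_act_lin {K A} X c.

Lemma schur_scalar (K : numClosedFieldType) (A : assoc_alg K) (X : amodule A) (f : X -> X) :
  fin_dim (fun _ : X => True) -> simple_amodule X -> amod_hom f ->
  exists c, forall x, f x = c *: x.
Proof.
move=> Xf Xs [fl fa]; have [u nu] := Xs.1.
have [//||c [v [_ nv fv]]] := exists_eigenvec fl (subspace_true X) Xf; first by exists u.
exists c; have [||S0|//] := Xs.2 (fun x => f x = c *: x).
- apply: subspace_eq => // d x y; by rewrite scalerDr !scalerA mulrC.
- by move=> d x fx; rewrite fa fx (is_linearZ (am_act_lin X d)).
- by case: nv; apply: S0.
Qed.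

Section Separable.
Variables (K : numClosedFieldType) (A : assoc_alg K) (J : finType) (a b : J -> A).

(* [\sum_i a i (x) b i] is a separability element, required in addition to
   multiply to [1] in the opposite order. *)
Definition separability : Prop :=
  [/\ \sum_i alg_mul (a i) (b i) = alg_one A, \sum_i alg_mul (b i) (a i) = alg_one A
    & forall (Z : lmodType K) (f : A -> A -> Z),
        (forall y, is_linear (f^~ y)) -> (forall x, is_linear (f x)) ->
        forall c, \sum_i f (alg_mul c (a i)) (b i) = \sum_i f (a i) (alg_mul (b i) c)].

Hypothesis sepA : separability.
Hypothesis finA : fin_dim (fun _ : A => True).

Definition average (X Y : amodule A) (f : X -> Y) (x : X) : Y :=
  \sum_i am_act (a i) (f (am_act (b i) x)).

(** The separability identity, applied to the bilinear map sending [u, v] to [u f(v x)], moves [c]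
    from the left of [a i] to the right of [b i]. *)
Lemma average_hom (X Y : amodule A) (f : X -> Y) : is_linear f -> amod_hom (average f).
Proof.
have [_ _ sep] := sepA; move=> fl; split=> [|c x].
  apply: is_linear_bigsum => i; apply: is_linear_comp (am_act_lin Y _) _.
  exact: is_linear_comp fl (am_act_lin X _).
have := sep Y (fun u v => am_act u (f (am_act v x))) _ _ c.
rewrite (is_linear_sum (am_act_lin Y c)) /average => sepc.
transitivity (\sum_i am_act (a i) (f (am_act (alg_mul (b i) c) x))).
  by apply: eq_bigr => i _; rewrite am_actM.
rewrite -sepc => [|v|u d v w]; first by apply: eq_bigr => i _; rewrite am_actM.
  exact: am_act_linl.
by rewrite (am_act_linl x) fl; apply: am_act_lin.
Qed.

Lemma average_id (X Y : amodule A) (f : X -> Y) : amod_hom f -> average f =1 f.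
Proof.
have [sep _ _] := sepA; move=> [fl fa] x.
rewrite -[in RHS](am_act1 x) -sep (is_linear_sum (am_act_linl x)) (is_linear_sum fl).
by rewrite /average; apply: eq_bigr => i _; rewrite am_actM !fa.
Qed.

Lemma maschke_proj (X : amodule A) (Z : X -> Prop) : stable (@am_act K A X) Z ->
  exists f : X -> X, [/\ amod_hom f, forall x, Z (f x) & forall x, Z x -> f x = x].
Proof.
move=> Zst; have [f [fl fZ fK]] := linear_proj Zst.1.
exists (average f); split=> [|x|x Zx]; first exact: average_hom.
  by apply: subspace_sum => [|i _]; [exact: Zst.1 | apply: Zst.2].
rewrite -[RHS](average_id (f := id)) // /average; apply: eq_bigr => i _.
by rewrite fK //; apply: Zst.2.
Qed.

Lemma hom_retract (X Y : amodule A) (f : X -> Y) : amod_hom f -> injective f ->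
  exists2 g : Y -> X, amod_hom g & cancel f g.
Proof.
move=> [fl fa] fi; have [g gl gK] := linear_retract fl fi.
exists (average g); first exact: average_hom.
move=> x; rewrite -[RHS](average_id (f := id)) // /average; apply: eq_bigr => i _.
by rewrite -fa gK.
Qed.

(* A complement of a submodule maximal among those containing [Z] and not
   containing [w] is simple. *)
Lemma simple_sub_outside (X : amodule A) (Z : X -> Prop) w :
  stable (@am_act K A X) Z -> ~ Z w ->
  exists C, [/\ stable (@am_act K A X) C, simple_sub (@am_act K A X) C,
    exists2 u, C u & u <> 0 & forall u, C u -> Z u -> u = 0].
Proof.
move=> Zst nZw; have actl := am_act_lin X.
have [|Q [Qst ZQ Qw Qmax]] := stable_max (E := fun u => u = w) Zst.
  by move=> u Zu uw; rewrite uw in Zu.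
have nQw : ~ Q w by move=> /Qw; apply.
have [f [fh fQ fK]] := maschke_proj Qst.
have QC u : Q u -> f u = 0 -> u = 0 by move=> /fK fu f0; rewrite -fu f0.
exists (fun u => f u = 0); split=> [|D Dst DC||u /[swap] /ZQ]; last exact: QC.
- exact: amod_hom_ker.
- case: (pselect (forall u, D u -> u = 0)) => [|nD]; first by left.
  right=> c fc; apply: contrapT => nDc.
  have [d [Dd nd]] : exists d, D d /\ d <> 0.
    by apply: contrapT => no; apply: nD => u Du; apply: contrapT => nu; apply: no; exists u.
  have [g [gh gD gK]] := maschke_proj Dst.
  have gst : stable (@am_act K A X) (fun u => f u = 0 /\ g u = 0).
    split=> [|e u [fu gu]]; last by split; [apply: (amod_hom_ker fh).2 | apply: (amod_hom_ker gh).2].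
    by apply: subspaceI; [apply: (amod_hom_ker fh).1 | apply: (amod_hom_ker gh).1].
  have wQ (E : X -> Prop) e : stable (@am_act K A X) E -> (forall u, E u -> f u = 0) ->
      E e -> e <> 0 -> sub_add Q E w.
    move=> Est EC Ee ne; have [u||u Su <- //] := Qmax (sub_add Q E) (stable_add actl Qst Est).
      exact: (sub_addl Est).
    by exists e; [apply: (sub_addr Qst) | move=> Qe; apply: ne; apply: QC => //; apply: EC].
  (* By maximality of [Q], both [Q + D] and [Q] plus the complement of [D] in [C] contain [w]. As
     [Q] meets [C] trivially, the two components [d1], [d2] of [w] in [C] agree, hence vanish, and
     [w] falls into [Q]. *)
  have [q [d1 [Qq Dd1 wE]]] := wQ D d Dst DC Dd nd.
  have [|||q' [d2 [Qq' [fd2 gd2] wE']]] := wQ _ (c - g c) gst.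
  + by move=> u [].
  + split; first by rewrite (is_linearB _ _ fh.1) fc (DC _ (gD c)) subrr.
    by rewrite (is_linearB _ _ gh.1) (gK (g c)) ?subrr.
  + by move/eqP; rewrite subr_eq0 => /eqP cg; apply: nDc; rewrite cg.
  have d12 : d1 = d2.
    apply/eqP; rewrite -subr_eq0; apply/eqP/QC.
      rewrite (_ : d1 - d2 = q' - q); first exact: subspaceB Qst.1 _ _.
      by apply: (addrI q); rewrite addrA -wE wE' addrK [RHS]addrC subrK.
    by rewrite (is_linearB _ _ fh.1) fd2 DC ?subr0.
  by apply: nQw; rewrite wE -(gK d1) // d12 gd2 addr0.
- exists (w - f w); first by rewrite (is_linearB _ _ fh.1) (fK (f w)) ?subrr.
  by move/eqP; rewrite subr_eq0 => /eqP wf; apply: nQw; rewrite wf.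
Qed.

(** If [Z] missed a vector, [simple_sub_outside] would give a simple submodule meeting [Z]
    trivially, whose inclusion nevertheless has its values in [Z]. *)
Lemma span_simple (X : amodule A) (Z : X -> Prop) : stable (@am_act K A X) Z ->
  (forall (Y : amodule A) (f : Y -> X), simple_amodule Y -> amod_hom f -> forall y, Z (f y)) ->
  forall x, Z x.
Proof.
move=> Zst Zsim x; apply: contrapT => nZx.
have [C [Cst Csim [u Cu nu] CZ]] := simple_sub_outside Zst nZx.
apply: (nu); apply: CZ => //; have [y <-] := sub_incl_surj Cst Cu.
apply: (Zsim _ _ _ (sub_incl_hom Cst)); apply: sub_amod_simple Csim.
by exists u.
Qed.

(* By Schur's lemma this element acts as zero on the simple modules not
   isomorphic to [X], and as a multiple of the rank one operator
   [y |-> f y *: x] on [X] itself. *)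
Definition matrix_unit (X : amodule A) (f : X -> K^o) (x : X) : A :=
  \sum_i f (am_act (b i) x) *: a i.

Section MatrixUnit.
Variables (X : amodule A) (f : X -> K^o).
Hypotheses (Xs : simple_amodule X) (fl : is_linear f).

Lemma matrix_unitE (Y : amodule A) (y : Y) x :
  am_act (matrix_unit f x) y = average (fun x : X => f x *: y) x.
Proof.
rewrite (is_linear_sum (am_act_linl y)) /average; apply: eq_bigr => i _.
by rewrite (is_linearZ (am_act_linl y)) (is_linearZ (am_act_lin Y _)).
Qed.

Let rank1_lin (Y : amodule A) (y : Y) : is_linear (fun x : X => f x *: y).
Proof. by move=> c u v; rewrite fl scalerDl scalerA. Qed.

Lemma matrix_unit_neq (Y : amodule A) (y : Y) x : simple_amodule Y ->
  ~ amodule_iso X Y -> am_act (matrix_unit f x) y = 0.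
Proof.
move=> Ys nXY; rewrite matrix_unitE; apply: contrapT => nz; apply: nXY.
by apply: schur_iso (average_hom (rank1_lin y)) _ => //; exists x.
Qed.

(** The average of [x |-> f x *: y] is a scalar [c] by Schur's lemma. Its trace is [n * c], and also
    the sum over [k] of [f (b k (a k y))], which is [f y] because the products [b k a k] sum to [1].
    Hence the factor [n]. *)
Lemma matrix_unit_eq n (e : 'I_n -> X) z x y : is_basis e z ->
  n%:R *: am_act (matrix_unit f x) y = f y *: x.
Proof.
have [_ sep _] := sepA; move=> ezB; have [zl ez ze] := ezB.
have [c avgE] := schur_scalar (simple_fin_dim finA Xs) Xs (average_hom (rank1_lin y)).
have nc : n%:R * c = f y.
  transitivity (\sum_i z i (average (fun x : X => f x *: y) (e i))).
    rewrite (eq_bigr (fun=> c)) => [|i _]; first by rewrite sumr_const card_ord mulr_natl.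
    by rewrite avgE (is_linearZ (zl i)) ze eqxx [LHS]mulr1.
  rewrite -[in RHS](am_act1 y) -sep (is_linear_sum (am_act_linl y)) (is_linear_sum fl).
  under eq_bigr do rewrite (is_linear_sum (zl _)).
  rewrite exchange_big; apply: eq_bigr => k _; rewrite am_actM.
  have /= <- := trace_rank1 (am_act (a k) y) ezB (is_linear_comp fl (am_act_lin X (b k))).
  by apply: eq_bigr => i _; rewrite (is_linearZ (am_act_lin X _)).
by rewrite matrix_unitE avgE scalerA nc.
Qed.
End MatrixUnit.

(** The dimension has the form [n.+1] so that it is visibly invertible in [K]. *)
Lemma simple_basis (X : amodule A) : simple_amodule X ->
  exists n (e : 'I_n.+1 -> X) x, is_basis e x.
Proof.
move=> Xs; have [[|n] [e [x exB]]] := exists_basis (simple_fin_dim finA Xs).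
  by have [u nu] := Xs.1; case: nu; have [_ ex _] := exB; rewrite (ex u) big_ord0.
by exists n, e, x.
Qed.
End Separable.
(** * Isotypic decomposition *)

Section DirectSums.
Variables (K : numFieldType) (I : Type) (U : I -> lmodType K).

Lemma dsum_ind (P : dsum U -> Prop) : is_subspace P ->
  (forall i (u : U i), P (dinj i u)) -> forall x, P x.
Proof.
move=> PS Pinj x; have /(@finite_seqP {classic I})[s xs] := sub_eltP x.
have {}xs i : dcoord x i <> 0 -> (i : {classic I}) \in s.
  by move=> nx; have : [set` s]%classic i by rewrite -xs.
elim: s x xs => [|j s IH] x xs.
  rewrite (_ : x = 0); first exact: PS.1.
  by apply: dsum_eqP => i; apply: contrapT => /xs.
rewrite -[x](subrK (dinj (j : I) (dcoord x j))); apply: subspaceD => //.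
have dB i : dcoord (x - dinj (j : I) (dcoord x j)) i =
    dcoord x i - dcoord (dinj (j : I) (dcoord x j)) i.
  by rewrite addrC -scaleN1r dcoordD scaleN1r addrC.
apply: IH => i; rewrite dB; case: (pselect (j = i)) => [<-|nji].
  by rewrite dinj_eq subrr.
rewrite dinj_neq // subr0 => /xs; rewrite inE => /orP[/eqP ij|//].
by case: nji.
Qed.
End DirectSums.

Lemma tens_ind (K : numFieldType) (U W : lmodType K) (I : Type) (r : I -> U -> U)
    (l : I -> W -> W) (P : btensor r l -> Prop) :
  is_subspace P -> (forall u w, P (tens r l u w)) -> forall x, P x.
Proof. by move=> PS Pt x; rewrite (tens_sum x); apply: subspace_sum. Qed.

Section Isotypic.
Variables (K : numClosedFieldType) (A : assoc_alg K) (J : finType) (a b : J -> A).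
Hypotheses (sepA : separability a b) (finA : fin_dim (fun _ : A => True)).
Variables (V : voa K) (B : bimodule A V).
Variables (T : Type) (X : T -> amodule A) (N : T -> premodule V).
(** [N t] is a model of [Hom_A(X t, B)], with evaluation [ev]. It stays abstract so that the space
    [Hom(W, M^j)] over a stabilizer can be used directly, Frobenius reciprocity being the
    evaluation. *)
Variable ev : forall t, N t -> X t -> B.
Hypotheses
  (Xsim : forall t, simple_amodule (X t))
  (Xinj : forall t u, amodule_iso (X t) (X u) -> t = u)
  (Xall : forall Y, simple_amodule Y -> exists t, amodule_iso (X t) Y)
  (ev_lin : forall t x, is_linear (fun n : N t => ev n x))
  (ev_hom : forall t (n : N t), amod_hom (Y := bm_amod B) (ev n))
  (ev_inj : forall t (n : N t), (forall x, ev n x = 0) -> n = 0)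
  (ev_surj : forall t (f : X t -> B), amod_hom (Y := bm_amod B) f ->
     exists n : N t, ev n =1 f)
  (ev_mode : forall t v k (n : N t) x, ev (pm_mode v k n) x = pm_mode v k (ev n x)).

Let ten t (x : X t) (n : N t) : tensor (X t) (N t) := tens (@no_op _) (@no_op _) x n.

Let ten_bal t : balanced (@no_op (X t)) (@no_op (N t)) (@ten t).
Proof. exact: tens_balanced. Qed.

Lemma isotypic_ind (P : B -> Prop) :
  is_subspace P -> (forall t (n : N t) x, P (ev n x)) -> forall w, P w.
Proof.
move=> PS Pev w.
(* [Z] is the span of all values of [ev], written as an intersection of subspaces; it is a submodule
   containing the image of every simple module. *)
pose Z w := forall Q : B -> Prop, is_subspace Q -> (forall t (n : N t) x, Q (ev n x)) -> Q w.
suff Zall : forall w, Z w by apply: Zall.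
apply: (span_simple (X := bm_amod B) (Z := Z) sepA) => [|Y f Ys fh y Q QS Qev].
  split=> [|c u Zu Q QS Qev].
    split=> [Q QS _|c u v Zu Zv Q QS Qev]; first exact: QS.1.
    by apply: QS.2; [apply: Zu | apply: Zv].
  apply: (Zu (fun u => Q (am_act (a := bm_amod B) c u))).
    exact: subspace_preim (am_act_lin (bm_amod B) c) QS.
  by move=> t n x; rewrite -(ev_hom n).2.
have [t [g [gl [h gK hK]] ga]] := Xall Ys.
have [|n nE] := ev_surj (t := t) (f := f \o g); first exact: (amod_hom_comp fh).
by rewrite -[y]hK -[f _]nE.
Qed.

(** Let [m i w] be the homomorphism sending [x] to [E w], where [E] is the matrix unit of [z i] and
    [x]. For [w = ev n y] it is [z i y] times [n], divided by the dimension, so the sum of the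
    [e i (x) m i w], multiplied by the dimension, is [y (x) n]. *)
Lemma isotypic_component t : exists th : B -> tensor (X t) (N t),
  [/\ is_linear th, forall (n : N t) x, th (ev n x) = ten x n
    & forall u (n : N u) x, u <> t -> th (ev n x) = 0].
Proof.
have [d [e [z ezB]]] := simple_basis finA (Xsim t); have [zl ez _] := ezB.
have nd : d.+1%:R != 0 :> K by rewrite pnatr_eq0.
have /(_ _)/(_ _)/cid hm : forall i w, exists n : N t,
    ev n =1 fun x => am_act (a := bm_amod B) (matrix_unit a b (z i) x) w.
  move=> i w; apply: ev_surj; pose g x : bm_amod B := z i x *: w.
  have gl : is_linear g by move=> c x y; rewrite /g zl scalerDl scalerA.
  have [al ah] := average_hom sepA gl.
  by split=> [c x y|c x]; rewrite !matrix_unitE; [apply: al | apply: ah].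
pose m i w := projT1 (hm i w).
have mE i w x : ev (m i w) x = am_act (a := bm_amod B) (matrix_unit a b (z i) x) w.
  by rewrite /m; case: (hm i w) => n /= ->.
have evB (n n' : N t) : (forall x, ev n x = ev n' x) -> n = n'.
  move=> nn; apply/eqP; rewrite -subr_eq0; apply/eqP/ev_inj => x.
  by rewrite (is_linearB _ _ (ev_lin x)) nn subrr.
have ml i : is_linear (m i).
  move=> c u v; apply: evB => x; rewrite (ev_lin x) !mE; exact: (am_act_lin (bm_amod B) _ c u v).
have [bl br _] := ten_bal t.
exists (fun w => d.+1%:R *: \sum_i ten (e i) (m i w)); split=> [c u v|n x|u n x nut].
- have lin : is_linear (fun w => \sum_i ten (e i) (m i w)).
    by apply: is_linear_bigsum => i; apply: is_linear_comp (br _) (ml i).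
  by rewrite lin scalerDr !scalerA mulrC.
- rewrite scaler_sumr [in RHS](ez x) (is_linear_sum (bl n)); apply: eq_bigr => i _.
  rewrite (is_linearZ (bl n)) -(is_linearZ (br _)) -(is_linearZ (br _)); congr ten.
  apply: evB => y; rewrite !(is_linearZ (ev_lin y)) mE -(ev_hom n).2.
  by rewrite -!(is_linearZ (ev_hom n).1) (matrix_unit_eq sepA finA (Xsim t) (zl i) _ _ ezB).
- rewrite (eq_bigr (fun=> 0)) => [|i _]; first by rewrite big1 ?scaler0.
  rewrite (_ : m i _ = 0) ?(is_linear0 (br _)) //; apply: ev_inj => y.
  rewrite mE -(ev_hom n).2 (matrix_unit_neq sepA (Xsim t) (zl i)) //.
    exact: is_linear0 (ev_hom n).1.
  by move/Xinj => tu; apply: nut.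
Qed.

Theorem isotypic_decomposition :
  bimodule_iso B (dsum_bimodule (fun t => tens_bimodule (X t) (N t))).
Proof.
have [th thP] : exists th : forall t, B -> tensor (X t) (N t), forall t,
    [/\ is_linear (th t), forall (n : N t) x, th t (ev n x) = ten x n
      & forall u (n : N u) x, u <> t -> th t (ev n x) = 0].
  by exists (fun t => projT1 (cid (isotypic_component t))) => t; case: cid.
have thl t : is_linear (th t) by case: (thP t).
have Bl v k : is_linear (fun w : B => pm_mode v k w) by exact: (pm_bilin B).2.
(* The index type [T] may be infinite; finiteness of the support is checked on the generators
   [ev n x], which live in a single component. *)
have fin w : fin_supp (th^~ w).
  have fS := fin_supp_subspace (fun t => tensor (X t) (N t)).
  apply: (isotypic_ind (P := fun w => fin_supp (th^~ w))) => [|t n x].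
    have e0 : (th^~ 0 : dprod (fun t => tensor (X t) (N t))) = 0.
      by apply: functional_extensionality_dep => t; apply: is_linear0.
    split=> [|c u v fu fv]; first by rewrite e0; apply: fS.1.
    have -> : (th^~ (c *: u + v) : dprod (fun t => tensor (X t) (N t))) =
        c *: (th^~ u : dprod (fun t => tensor (X t) (N t))) + th^~ v.
      by apply: functional_extensionality_dep => t; apply: thl.
    exact: fS.2.
  apply: sub_finite_set (finite_set1 t) => u /= nz; apply: contrapT => ut.
  by apply: nz; case: (thP u) => _ _ -> // tu; apply: ut.
pose D := dsum_bimodule (fun t => tens_bimodule (X t) (N t)).
pose Th w : D := sub_elt (P := Subspace (fin_supp_subspace _)) (fin w).
have ThE t (n : N t) x : Th (ev n x) = dinj t (ten x n).
  apply: dsum_eqP => u; transitivity (th u (ev n x)); first by [].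
  case: (pselect (t = u)) => [<-|ntu]; first by rewrite dinj_eq; have [_ -> _] := thP t.
  by rewrite dinj_neq //; case: (thP u) => _ _ ->.
have Thl : is_linear Th.
  by move=> c u v; apply: dsum_eqP => t; rewrite dcoordD; apply: thl.
have evA t (n : N t) c x : ev n (am_act c x) = bm_act c (ev n x) by exact: (ev_hom n).2.
have Tha c w : Th (bm_act c w) = bm_act c (Th w).
  have cl := am_act_lin (bm_amod B) c; have cl' := am_act_lin (bm_amod D) c.
  move: w; apply: isotypic_ind => [|t n x].
    exact: subspace_eq (is_linear_comp Thl cl) (is_linear_comp cl' Thl).
  rewrite -evA !ThE; apply: dsum_eqP => u; rewrite dsum_actE.
  case: (pselect (t = u)) => [<-|ntu]; rewrite ?dinj_eq ?dinj_neq //.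
    exact/esym/(tens_actE c x n).
  exact/esym/is_linear0/(tens_act_lin (X := X u) (N := N u) c).
have Thm v k w : Th (pm_mode v k w) = pm_mode v k (Th w).
  have cl : is_linear (fun w : D => pm_mode v k w) by exact: (pm_bilin D).2.
  move: w; apply: isotypic_ind => [|t n x].
    exact: subspace_eq (is_linear_comp Thl (Bl v k)) (is_linear_comp cl Thl).
  rewrite -ev_mode !ThE; apply: dsum_eqP => u; rewrite dsum_modeE.
  case: (pselect (t = u)) => [<-|ntu]; rewrite ?dinj_eq ?dinj_neq //.
    exact/esym/(tens_modeE v k x n).
  exact/esym/is_linear0/(tens_mode_lin (X := X u) (N := N u) v k).
exists Th; split=> //; apply: inj_surj_bijective.
(* A nonzero kernel contains a simple submodule, the image of some [ev n]. There [x (x) n = 0], and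
   the linear map sending [x (x) n] to [ev n x] gives [ev n x = 0], although [ev n] is injective. *)
- apply: (inj_linear Thl) => w Thw; apply: contrapT => nw.
  have Thh : amod_hom (X := bm_amod B) (Y := bm_amod D) Th.
    by split; [exact: Thl | exact: Tha].
  have Kst := amod_hom_ker Thh; have [z zw] := sub_incl_surj Kst Thw.
  have [||C [Cst Csim [y Cy ny] _]] :=
      @simple_sub_outside _ _ _ _ _ sepA (sub_amod Kst) (fun y => y = 0) z.
  + split=> [|c y ->]; first exact: subspace_eq0.
    exact: is_linear0 (am_act_lin (sub_amod Kst) c).
  + by move=> z0; apply: nw; rewrite -zw z0; apply: is_linear0 (sub_incl_hom Kst).1.
  have Csimple := sub_amod_simple Cst (ex_intro2 _ _ y Cy ny) Csim.
  have [t [g [gl [h gK hK]] ga]] := Xall Csimple.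
  have [|n nE] := ev_surj (t := t) (f := sub_incl (Pst := Kst) \o (sub_incl (Pst := Cst) \o g)).
    exact: amod_hom_comp (sub_incl_hom Kst) (amod_hom_comp (sub_incl_hom Cst) _).
  have [x nx] := (Xsim t).1.
  have : ten x n = 0.
    have := congr1 (fun y => dcoord y t) (ThE t n x); rewrite dinj_eq => <-.
    by rewrite nE [Th _](sub_inclP (Pst := Kst) (sub_incl (g x))).
  have evbal : balanced (@no_op (X t)) (@no_op (N t)) (fun x n => ev n x).
    by split=> // m; apply: (ev_hom m).1.
  move/(congr1 (tens_lift (fun x n => ev n x))).
  rewrite (tens_liftE _ _ evbal) (is_linear0 (tens_lift_lin evbal)) nE => e0.
  apply: nx; have g0 : g x = 0.
    apply: (sub_incl_inj (Pst := Cst)); apply: (sub_incl_inj (Pst := Kst)); rewrite [LHS]e0.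
    by rewrite (is_linear0 (sub_incl_hom Cst).1) (is_linear0 (sub_incl_hom Kst).1).
  by rewrite -[x]gK g0 -(is_linear0 gl) gK.
- have imS := subspace_im Thl (subspace_true B).
  move=> y; suff [w _ <-] : exists2 w, True & Th w = y by exists w.
  move: y; apply: (dsum_ind imS) => t.
  have dl : is_linear (fun u => dinj t u : D) by move=> c u v; apply: dinjD.
  apply: (tens_ind (subspace_preim dl imS)) => x n.
  by exists (ev n x).
Qed.
End Isotypic.
Local Arguments dcoord : simpl never.
Local Arguments dinj : simpl never.

(** * Density of the modes of a vertex operator algebra *)

Lemma finType_bound_nat (I : finType) (P : I -> nat -> Prop) :
  (forall i, exists N, forall k, (N <= k)%N -> P i k) ->
  exists N, forall i k, (N <= k)%N -> P i k.
Proof.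
move=> /(_ _)/cid h; exists (\max_i projT1 (h i)) => i k Nk.
by case: (h i) (leq_trans (leq_bigmax i) Nk) => /= N; apply.
Qed.

Lemma finType_bound_int (I : finType) (P : I -> int -> Prop) :
  (forall i, exists N : int, forall k, N <= k -> P i k) ->
  exists N : int, forall i k, N <= k -> P i k.
Proof.
move=> /(_ _)/cid h; exists (\sum_i `|projT1 (h i)|) => i k Nk.
have : projT1 (h i) <= k.
  apply: le_trans Nk; apply: le_trans (ler_norm _) _.
  by rewrite (bigD1 i) //= lerDl sumr_ge0.
by case: (h i) => /= N; apply.
Qed.

Lemma binz0 (K : numFieldType) x : binz K x 0 = 1.
Proof. by rewrite /binz big_ord0 divr1. Qed.

(** The induction that truncation calls for: modes of large index vanish, and a mode is reduced to
    modes of larger index. *)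
Lemma int_down_ind (P : int -> Prop) (N : int) :
  (forall n, N <= n -> P n) -> (forall n, (forall k : nat, P (n + k.+1%:Z)) -> P n) ->
  forall n, P n.
Proof.
move=> PN Pstep; suff h k n : N - k%:Z <= n -> P n.
  by move=> n; apply: (h `|N - n|%N); rewrite lerBlDr -lerBlDl ler_norm.
elim: k n => [|k IH] n; first by rewrite subr0; apply: PN.
move=> kn; apply: Pstep => j; apply: IH.
rewrite lerBlDr in kn; rewrite lerBlDr; apply: le_trans kn _.
by rewrite -addrA lerD2l lez_nat addSnnS leq_addl.
Qed.

Section Modes.
Variables (K : numClosedFieldType) (V : voa K).

Section OneModule.
Variable M : premodule V.
Implicit Types (w : M) (L : seq (V * int)).

Definition mode_op (p : V * int) : M -> M := pm_mode p.1 p.2.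

Lemma pm_mode_lin v n : is_linear (@pm_mode K V M v n).
Proof. exact: (pm_bilin M).2. Qed.

Lemma pm_mode_linl n w : is_linear (fun v => @pm_mode K V M v n w).
Proof. exact: (pm_bilin M).1. Qed.

Lemma mode_op_lin p : is_linear (mode_op p).
Proof. exact: pm_mode_lin. Qed.

Definition mode_sum L w : M := \sum_(p <- L) pm_mode p.1 p.2 w.

Definition mode_span w (u : M) : Prop := exists L, mode_sum L w = u.

Lemma mode_sum_lin L : is_linear (mode_sum L).
Proof. by apply: is_linear_bigsum => p; apply: pm_mode_lin. Qed.

Lemma mode_span_subspace w : is_subspace (mode_span w).
Proof.
split=> [|c _ _ [L <-] [L' <-]]; first by exists [::]; rewrite /mode_sum big_nil.
exists ([seq (c *: p.1, p.2) | p <- L] ++ L'); rewrite /mode_sum big_cat big_map /=.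
rewrite scaler_sumr; congr (_ + _); apply: eq_bigr => p _.
exact: is_linearZ (pm_mode_linl _ _) _ _.
Qed.

Lemma mode_span1 v n w : mode_span w (pm_mode v n w).
Proof. by exists [:: (v, n)]; rewrite /mode_sum big_seq1. Qed.

Hypothesis Mweak : is_weak_module M.

Lemma mode_span_id w : mode_span w w.
Proof.
have [_ vacE _] := Mweak; have := mode_span1 (vac V) (-1) w.
by rewrite vacE eqxx.
Qed.

(* In the component of the Jacobi identity with [m] so large that the modes
   [u_(m + i)] kill [w], the product [u_p v_n w] is the leading term. *)
Lemma mode_span_mul u p v n w : mode_span w (pm_mode u p (pm_mode v n w)).
Proof.
have [trunc _ jacobi] := Mweak; have spS := mode_span_subspace w.
have [N vN] := trunc v w; have [m um] := trunc u w.
move: n p; apply: (int_down_ind (N := N)) => [n /vN -> p|n IH p].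
  by rewrite (is_linear0 (pm_mode_lin u p)); apply: spS.1.
(* With [l = p - m] the leading term is [u_p v_n w]. The other terms on the left contain [v_(n + i)]
   with [i > 0] and fall under the induction; the right-hand side consists of single modes. *)
have [k /(_ _ (leqnSn k))] := jacobi u v w (p - m) m n.
rewrite [X in _ - _ *: X]big1 ?scaler0 ?subr0 => [|i _]; last first.
  rewrite um ?lerDl // (is_linear0 (pm_mode_lin _ _)); exact: scaler0.
rewrite big_ord_recl /= expr0 mul1r binz0 scale1r subr0 addr0 subrK.
move/(canRL (addrK _)) ->; apply: (subspaceB spS).
  by apply: subspace_sum => // i _; apply: subspaceZ => //; apply: mode_span1.
by apply: subspace_sum => // i _; apply: subspaceZ => //; apply: IH.
Qed.

(** Together with [mode_span_id], this makes [mode_span w] the submodule generated by [w], although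
    its elements involve no products of modes. *)
Lemma mode_span_stable w : stable mode_op (mode_span w).
Proof.
split=> [|[u p] _ [L <-]]; first exact: mode_span_subspace.
rewrite (is_linear_sum (mode_op_lin _)); apply: subspace_sum => [|q _].
  exact: mode_span_subspace.
exact: mode_span_mul.
Qed.
End OneModule.

Definition mode_hom (M N : premodule V) (f : M -> N) : Prop :=
  is_linear f /\ forall v n w, f (pm_mode v n w) = pm_mode v n (f w).

Lemma mode_hom_zero_or_iso (M N : premodule V) (f : M -> N) :
  irreducible M -> irreducible N -> mode_hom f -> (forall w, f w = 0) \/ module_iso M N.
Proof.
move=> [_ Mi] [_ Ni] [fl fm].
have [|v n w fw0|K0|] := Mi (fun w => f w = 0); last by left.
- by apply: (subspace_preim (P := fun u => u = 0)) => //; apply: subspace_eq0.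
- by rewrite fm fw0 (is_linear0 (pm_mode_lin v n)).
have [|v n _ [u _ <-]|I0|I1] := Ni (fun w => exists2 u, True & f u = w).
- exact: subspace_im (subspace_true M).
- by exists (pm_mode v n u).
- by left=> w; apply: I0; exists w.
right; exists f; last exact: fm.
split=> //; apply: inj_surj_bijective; first exact: inj_linear.
by move=> y; have [x _ <-] := I1 y; exists x.
Qed.

Definition mode_schur (M : premodule V) : Prop :=
  forall f : M -> M, mode_hom f -> exists c, forall w, f w = c *: w.

(** An endomorphism commutes with [L(0)] and so preserves the weight space of [a]; an eigenvalue is
    found there, [M] itself being of infinite dimension in general. *)
Lemma weight_space_schur (M : premodule V) a : irreducible M ->
  fin_dim (@weight_vec _ _ M a) -> (exists2 w : M, weight_vec a w & w <> 0) -> mode_schur M.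
Proof.
move=> [_ Mi] Pf Pn f [fl fm].
have ol := pm_mode_lin (M := M) (omega V) 1.
have PS : is_subspace (@weight_vec _ _ M a).
  by apply: subspace_eq => // c u v; rewrite scalerDr !scalerA mulrC.
have [w|c [u [_ nu fu]]] := exists_eigenvec fl PS Pf _ Pn.
  by rewrite /weight_vec /eigenvec -fm => ->; rewrite (is_linearZ fl).
exists c; have [|v n w fw|S0|//] := Mi (fun w => f w = c *: w).
- by apply: subspace_eq => // d x y; rewrite scalerDr !scalerA mulrC.
- by rewrite fm fw (is_linearZ (pm_mode_lin v n)).
- by case: nu; apply: S0.
Qed.

Lemma module_schur (M : premodule V) : is_module M -> irreducible M -> mode_schur M.
Proof.
move=> [_ gr fd _] Mirr; have [w nw] := Mirr.1.
have [d [wt [x [wx xwt]]]] := gr w.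
have [i nxi] : exists i, x i <> 0.
  apply: contrapT => no; apply: nw; rewrite wx big1 // => i _.
  by apply: contrapT => nx; apply: no; exists i.
by apply: (weight_space_schur Mirr (fd (wt i))); exists (x i).
Qed.

Section FiniteSums.
Variables (I : finType) (F : I -> premodule V).

Lemma dsum_decomp (x : dsum_premodule F) : x = \sum_i dinj i (dcoord x i).
Proof.
apply: dsum_eqP => j.
have cl : is_linear (fun y : dsum F => dcoord y j) by move=> c u v; apply: dcoordD.
rewrite [RHS](is_linear_sum cl) (bigD1 j) //= dinj_eq big1 ?addr0 // => i ij.
by rewrite dinj_neq // => e; rewrite e eqxx in ij.
Qed.

Lemma dsum_weak : (forall i, is_weak_module (F i)) -> is_weak_module (dsum_premodule F).
Proof.
move=> Fw; split=> [u w|n w|u v w l m n].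
- have [|N uN] := @finType_bound_int I (fun i n => pm_mode u n (dcoord w i) = 0).
    by move=> i; have [tr _ _] := Fw i; apply: tr.
  by exists N => n Nn; apply: dsum_eqP => i; apply: uN.
- apply: dsum_eqP => i; have [_ vacE _] := Fw i; rewrite dsum_modeE vacE.
  by case: ifP.
- have cl i : is_linear (fun y : dsum F => dcoord y i) by move=> c x y; apply: dcoordD.
  have [|N jac] := @finType_bound_nat I (fun i k =>
    \sum_(h < k) ((-1) ^+ h * binz K l h) *:
      pm_mode u (l + m - h%:Z) (pm_mode v (n + h%:Z) (dcoord w i))
    - ((-1) ^ l) *: \sum_(h < k) ((-1) ^+ h * binz K l h) *:
      pm_mode v (l + n - h%:Z) (pm_mode u (m + h%:Z) (dcoord w i))
    = \sum_(h < k) binz K m h *: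
      pm_mode (voa_mode u (l + h%:Z) v) (m + n - h%:Z) (dcoord w i)).
    by move=> i; have [_ _ jac] := Fw i; apply: jac.
  exists N => k Nk; apply: dsum_eqP => i.
  rewrite (is_linearB _ _ (cl i)) (is_linearZ (cl i)) !(is_linear_sum (cl i)).
  under eq_bigr do rewrite (is_linearZ (cl i)).
  under [X in _ - _ *: X]eq_bigr do rewrite (is_linearZ (cl i)).
  under [RHS]eq_bigr do rewrite (is_linearZ (cl i)).
  exact: jac.
Qed.
End FiniteSums.

Section Density.
Variables (S : Type) (M : S -> premodule V).
Hypotheses
  (Mweak : forall s, is_weak_module (M s))
  (Mirr : forall s, irreducible (M s))
  (Mineq : forall s t, module_iso (M s) (M t) -> s = t)
  (Mschur : forall s, mode_schur (M s)).

(** Between pairwise inequivalent irreducible modules all homomorphisms are zero or scalar, so any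
    family of linear maps, one on each module, is natural. *)
Lemma mode_hom_natural (T : forall s, M s -> M s) s t (f : M s -> M t) :
  (forall s, is_linear (@T s)) -> mode_hom f -> forall w, f (T s w) = T t (f w).
Proof.
move=> Tl fh w; have [f0|st] := mode_hom_zero_or_iso (Mirr s) (Mirr t) fh.
  by rewrite !f0 (is_linear0 (Tl t)).
move: (Mineq st) f fh => e; subst t => f fh {st}.
by have [c fE] := Mschur fh; rewrite !fE (is_linearZ (Tl s)).
Qed.

(* The submodule generated by a tuple has a complement, and the projection onto
   it commutes with [T] because its entries are scalars. *)
Lemma mode_density (I : finType) (sg : I -> S) (w : forall i, M (sg i))
    (T : forall s, M s -> M s) : (forall s, is_linear (@T s)) ->
  exists L, forall i, mode_sum L (w i) = T (sg i) (w i).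
Proof.
move=> Tl; pose F i := M (sg i); pose U := dsum_premodule F.
have Uweak : is_weak_module U by apply: dsum_weak => i; apply: Mweak.
have cl i : is_linear (fun y : U => dcoord y i) by move=> c u v; apply: dcoordD.
have jl i : is_linear (fun x : F i => dinj i x : U) by move=> c u v; apply: dinjD.
have jm i v n (x : F i) : (dinj i (pm_mode v n x) : U) = pm_mode v n (dinj i x : U).
  apply: dsum_eqP => j; rewrite dsum_modeE.
  case: (pselect (i = j)) => [<-|nij]; first by rewrite !dinj_eq.
  by rewrite !dinj_neq // (is_linear0 (pm_mode_lin v n)).
pose w0 : U := \sum_i dinj i (w i).
have w0E i : dcoord w0 i = w i.
  rewrite (is_linear_sum (cl i)) (bigD1 i) //= dinj_eq big1 ?addr0 // => j ji.
  by rewrite dinj_neq // => e; rewrite e eqxx in ji.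
have [||P Pst gen u||p [pl pm pZ pK]] := stable_compl (@mode_op_lin U)
    (C := fun i (u : U) => exists2 x : F i, True & dinj i x = u) (Z := mode_span w0).
- move=> i; split; first exact: subspace_im (subspace_true (F i)).
  by move=> [v n] _ [x _ <-]; exists (pm_mode v n x) => //; apply: jm.
- move=> i Q [QS Qop] QC.
  have [|v n x Qx|Q0|Q1] := (Mirr (sg i)).2 (fun x => Q (dinj i x)).
  + exact: subspace_preim (jl i) QS.
  + by rewrite jm; apply: (Qop (v, n)).
  + by left=> u Qu; have [x _ xu] := QC u Qu; rewrite -xu (Q0 x) ?(is_linear0 (jl i)) ?xu.
  + by right=> _ [x _ <-].
- rewrite (dsum_decomp u); apply: subspace_sum => [|i _]; first exact: Pst.1.
  by apply: (gen i); exists (dcoord u i).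
- exact: mode_span_stable.
pose T0 (u : U) : U := \sum_i dinj i (T (sg i) (dcoord u i)).
have T0E u i : dcoord (T0 u) i = T (sg i) (dcoord u i).
  rewrite (is_linear_sum (cl i)) (bigD1 i) //= dinj_eq big1 ?addr0 // => j ji.
  by rewrite dinj_neq // => e; rewrite e eqxx in ji.
have T0p u : T0 (p u) = p (T0 u).
  apply: dsum_eqP => j; rewrite T0E.
  rewrite (is_linear_sum pl) (is_linear_sum (cl j)) {1}(dsum_decomp u).
  rewrite (is_linear_sum pl) (is_linear_sum (cl j)) (is_linear_sum (Tl _)).
  apply: eq_bigr => i _; symmetry.
  apply: (mode_hom_natural (f := fun x => dcoord (p (dinj i x)) j)) => //.
  split=> [c x y|v n x]; first by rewrite (jl i) pl (cl j).
  by rewrite jm (pm (v, n)).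
(* As [w0] is fixed by [p], [T0 w0 = T0 (p w0) = p (T0 w0)] lies in the image of [p], the submodule
   generated by [w0]. *)
have [L LE] : mode_span w0 (T0 w0).
  by rewrite -{2}(pK w0) ?T0p //; apply: mode_span_id.
exists L => i; rewrite -w0E -T0E -LE /mode_sum (is_linear_sum (cl i)).
by apply: eq_bigr.
Qed.
End Density.
End Modes.

(** * Independence of twisted homomorphisms *)

Section Adjoint.
Variables (K : numClosedFieldType) (V : voa K).

Definition adjoint : premodule V := PreModule (voa_bilin V).

Lemma adjoint_weak : is_weak_module adjoint.
Proof. by split; [apply: voa_trunc | apply: voa_vac | apply: voa_jacobi]. Qed.

(** [x_(-k-1) 1] is [L(-1)^k x / k!] and [L(-1) = omega_0]; each step of the induction contributes
    one factor [omega_0] and one division by [k + 1]. *)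
Lemma translate_closed (P : V -> Prop) : is_subspace P ->
  (forall u n v, P v -> P (voa_mode u n v)) ->
  forall (k : nat) x, P x -> P (voa_mode x (- k.+1%:Z) (vac V)).
Proof.
move=> PS Pl; elim=> [|k IH] x Px; first by rewrite voa_creation.
have := IH (voa_mode (omega V) 0 x) (Pl _ _ _ Px); rewrite voa_deriv opprK.
rewrite (_ : - k.+1%:Z - 1 = - k.+2%:Z); last by rewrite -opprD -PoszD addn1.
move/(subspaceZ (k.+1%:~R^-1) PS); rewrite scalerA mulVf ?scale1r //.
by rewrite intr_eq0.
Qed.

(* Skew symmetry, in the component of the Jacobi identity at the vacuum with
   [m = -1] and [n = 0]. *)
Lemma left_ideal_two_sided (P : V -> Prop) : is_subspace P ->
  (forall u n v, P v -> P (voa_mode u n v)) ->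
  forall u n v, P u -> P (voa_mode u n v).
Proof.
move=> PS Pl u l v Pu; have [N uN] := voa_trunc u v.
move: l; apply: (int_down_ind (N := N)) => [l /uN ->|l IH]; first exact: PS.1.
have al := (voa_bilin V).2.
(* The creation axioms kill the first sum and leave only [v_l u] in the second. On the right the
   term [i = 0] is [u_l v], and the others are modes at the vacuum of [u_(l + i) v] with [i > 0],
   which lie in [P] by induction. *)
have [k /(_ _ (leqnSn k))] := voa_jacobi u v (vac V) l (-1) 0.
rewrite big1 ?sub0r => [|i _]; last first.
  by rewrite add0r voa_creation0 // (is_linear0 (al _ _)) scaler0.
rewrite big_ord_recl big1 => [|i _]; last first.
  by rewrite (voa_creation0 u) ?(is_linear0 (al _ _)) ?scaler0.
rewrite [in RHS]big_ord_recl /= !addr0 ?subr0 !expr0 !mul1r !binz0 !scale1r.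
rewrite !voa_creation => /esym/(canRL (addrK _)) ->; apply: subspaceB => //.
  by rewrite -scaleN1r; do 2!apply: subspaceZ => //; apply: Pl.
apply: subspace_sum => // i _; apply: subspaceZ => //.
rewrite (_ : -1 - _ = - (bump 0 i).+1%:Z); last by rewrite -opprD -PoszD add1n.
exact: translate_closed.
Qed.

Lemma adjoint_irreducible : simple_voa V -> vac V <> 0 -> irreducible adjoint.
Proof.
move=> Vs nvac; split=> [|P PS Pl]; first by exists (vac V).
by apply: Vs => //; apply: left_ideal_two_sided.
Qed.

Lemma adjoint_schur : simple_voa V -> vac V <> 0 -> mode_schur adjoint.
Proof.
move=> Vs nvac; have [d [wt [x [vx xwt]]]] := voa_graded (vac V).
have [i nxi] : exists i, x i <> 0.
  apply: contrapT => no; apply: nvac; rewrite vx big1 // => i _.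
  by apply: contrapT => nx; apply: no; exists i.
apply: (@weight_space_schur _ _ adjoint (wt i)%:~R); first exact: adjoint_irreducible.
  exact: voa_findim.
by exists (x i); first exact: xwt.
Qed.

Section TensorInjective.
Variables (N : premodule V) (I : finType) (y : I -> N).
Hypothesis Nweak : is_weak_module N.

(** The kernel of [v (x) y |-> Y(v, z) y] is stable under the modes of [V] on the left factor. In
    the Jacobi identity at [l, m, n - m], with [m] so large that the [a_(m + h)] kill all [y i], the
    first sum vanishes by the relation and the second by the choice of [m]. In what remains the
    terms [h > 0] vanish by downward induction on [l], and [binz m 0 = 1]. *)
Lemma mode_relation_closed (v : I -> V) a :
  (forall n, \sum_i pm_mode (v i) n (y i) = 0) ->
  forall l n, \sum_i pm_mode (voa_mode a l (v i)) n (y i) = 0.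
Proof.
move=> rel; have [trunc _ jacobi] := Nweak.
have [|Nv vN] := @finType_bound_int I (fun i n => voa_mode a n (v i) = 0).
  by move=> i; apply: voa_trunc.
have [|m mN] := @finType_bound_int I (fun i n => pm_mode a n (y i) = 0).
  by move=> i; apply: trunc.
apply: (int_down_ind (N := Nv)) => [l Nl n|l IH n].
  by apply: big1 => i _; rewrite vN // (is_linear0 (pm_mode_linl _ _)).
have [|k jac] := @finType_bound_nat I (fun i k =>
    \sum_(h < k) ((-1) ^+ h * binz K l h) *:
      pm_mode a (l + m - h%:Z) (pm_mode (v i) (n - m + h%:Z) (y i))
    - ((-1) ^ l) *: \sum_(h < k) ((-1) ^+ h * binz K l h) *:
      pm_mode (v i) (l + (n - m) - h%:Z) (pm_mode a (m + h%:Z) (y i))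
    = \sum_(h < k) binz K m h *:
      pm_mode (voa_mode a (l + h%:Z) (v i)) (m + (n - m) - h%:Z) (y i)).
  by move=> i; apply: jacobi.
have := eq_bigr (r := index_enum I) (P := xpredT) (op := +%R) (idx := 0) _
  (fun i _ => jac i k.+1 (leqnSn k)).
rewrite sumrB exchange_big /= big1 ?sub0r => [|h _]; last first.
  rewrite -scaler_sumr -(is_linear_sum (pm_mode_lin _ _)) rel.
  by rewrite (is_linear0 (pm_mode_lin _ _)) scaler0.
rewrite big1 ?oppr0 => [|i _]; last first.
  rewrite big1 ?scaler0 // => h _; rewrite mN ?lerDl //.
  by rewrite (is_linear0 (pm_mode_lin _ _)) scaler0.
rewrite exchange_big big_ord_recl /= [X in _ + X]big1 => [|h _]; last first.
  by rewrite -scaler_sumr IH scaler0.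
rewrite addr0 => rel0; rewrite [RHS]rel0; apply: eq_bigr => i _.
by rewrite binz0 scale1r addr0 subr0 addrC subrK.
Qed.

(* The map [v (x) y |-> Y(v, z) y] is injective on [V (x) N]. *)
Lemma mode_tensor_inj (v : I -> V) (f : V -> K^o) : simple_voa V -> is_linear f ->
  (forall n, \sum_i pm_mode (v i) n (y i) = 0) -> \sum_i f (v i) *: y i = 0.
Proof.
move=> Vs fl rel; have [_ vacE _] := Nweak.
have vac1 u : pm_mode (vac V) (-1) u = u :> N by rewrite vacE eqxx.
case: (pselect (vac V = 0)) => [vac0|nvac].
  by apply: big1 => i _; rewrite -[y i]vac1 vac0 (is_linear0 (pm_mode_linl _ _)) scaler0.
(* Density on the adjoint module replaces the operator [u |-> f u *: 1] by a sum of modes on the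
   vectors [v i]. The relation survives these modes, and [1_(-1)] is the identity on [N]. *)
have [s t _|s||L LE] := @mode_density _ _ unit (fun=> adjoint) (fun=> adjoint_weak)
    (fun=> adjoint_irreducible Vs nvac) _ _ I (fun=> tt) v (fun _ u => f u *: vac V).
- by case: s; case: t.
- exact: adjoint_schur.
- by move=> _ c x z; rewrite fl scalerDl scalerA.
suff: \sum_i pm_mode (f (v i) *: vac V) (-1) (y i) = 0.
  move=> e0; apply: etrans e0; apply: eq_bigr => i _.
  by rewrite (is_linearZ (pm_mode_linl _ _)) vac1.
transitivity (\sum_i pm_mode (mode_sum (M := adjoint) L (v i)) (-1) (y i)).
  by apply: eq_bigr => i _; rewrite LE.
rewrite /mode_sum; under eq_bigr do rewrite (is_linear_sum (pm_mode_linl _ _)).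
by rewrite exchange_big big1 // => p _; apply: mode_relation_closed.
Qed.
End TensorInjective.

(* Linear independence of automorphisms: a shortest relation would yield the
   relations with coefficients [c g * f (g u)], hence a shorter one. *)
Lemma twisted_hom_independent (gT : finGroupType) (G : aut_group V gT) (M N : premodule V)
    (Phi : gT -> M -> N) (c : gT -> K) :
  simple_voa V -> is_weak_module N -> (forall g, is_linear (Phi g)) ->
  (forall g v n w, Phi g (pm_mode v n w) = pm_mode (G g v) n (Phi g w)) ->
  (forall g, exists w, Phi g w <> 0) ->
  (forall w, \sum_g c g *: Phi g w = 0) -> forall g, c g = 0.
Proof.
move=> Vs Nweak Pl Pm Pn; have [n] := ubnP #|[set g | c g != 0]|.
elim: n c => // n IH c cn rel g; apply: contrapT => ncg.
have [h] : exists h, h <> g /\ c h <> 0.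
  apply: contrapT => no; have [w nw] := Pn g; apply: nw.
  have := rel w; rewrite (bigD1 g) //= big1 ?addr0 => [/eqP|h /eqP hg].
    by rewrite scaler_eq0 => /orP[/eqP|/eqP].
  by rewrite (_ : c h = 0) ?scale0r //; apply: contrapT => nch; apply: no; exists h.
move=> [hg nch]; have [u nu] : exists u, G g u <> G h u.
  apply: contrapT => no; apply: hg; apply/esym/(ag_inj (a := G)) => u.
  by apply: contrapT => nu; apply: no; exists u.
have [|f [fl f1]] := @exists_functional _ V (G g u - G h u).
  by move/eqP; rewrite subr_eq0 => /eqP.
(* Subtracting [f (h u)] times the relation removes the term at [h], while [f1] leaves the
   coefficient [c g] unchanged at [g]. *)
apply: ncg; have := IH (fun k => c k * (f (G k u) - f (G h u))) _ _ g.
rewrite -(is_linearB _ _ fl) f1 mulr1; apply=> [|w].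
  rewrite -ltnS; apply: leq_trans cn; rewrite ltnS.
  apply: proper_card; apply/properP; split=> [|]; first apply/fintype.subsetP => k.
    by rewrite !inE mulf_eq0 negb_or => /andP[].
  by exists h; rewrite !inE ?subrr ?mulr0 ?eqxx //; apply/eqP.
(* The original relation at [u_m w], for every [m], says that the sum of the [G k u (x) c k Phi k w]
   is annihilated by all modes; injectivity allows [f] to be applied to the left factors. *)
have rel2 : \sum_k f (G k u) *: (c k *: Phi k w) = 0.
  apply: (mode_tensor_inj Nweak (v := fun k => G k u)) => // m.
  rewrite -[RHS](rel (pm_mode u m w)); apply: eq_bigr => k _.
  by rewrite Pm (is_linearZ (pm_mode_lin _ _)).
transitivity (\sum_k (f (G k u) *: (c k *: Phi k w) - f (G h u) *: (c k *: Phi k w))).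
  by apply: eq_bigr => k _; rewrite -scalerBl scalerA mulrC.
by rewrite sumrB rel2 -scaler_sumr rel scaler0 subr0.
Qed.
End Adjoint.

(** * Multiplicity spaces *)

Section Graded.
Variables (K : numFieldType) (U : lmodType K) (L : U -> U).
Hypothesis Ll : is_linear L.

Definition graded (u : U) : Prop := exists (d : nat) (wt : 'I_d -> K) (x : 'I_d -> U),
  u = \sum_i x i /\ forall i, eigenvec L (wt i) (x i).

Lemma graded_finType (I : finType) (wt : I -> K) (x : I -> U) :
  (forall i, eigenvec L (wt i) (x i)) -> graded (\sum_i x i).
Proof.
move=> xwt; exists #|I|, (wt \o enum_val), (x \o enum_val); split=> [|i]; last exact: xwt.
rewrite (reindex_onto enum_val enum_rank) /= => [|i _]; last exact: enum_rankK.
by apply: eq_bigl => i; rewrite enum_valK eqxx.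
Qed.

Lemma gradedD u v : graded u -> graded v -> graded (u + v).
Proof.
move=> [d [wt [x [-> xwt]]]] [d' [wt' [x' [-> xwt']]]].
pose y (i : 'I_d + 'I_d') := match i with inl i => x i | inr i => x' i end.
rewrite (_ : _ + _ = \sum_i y i); last by rewrite big_sumType.
apply: (@graded_finType _ (fun i => match i with inl i => wt i | inr i => wt' i end)).
by case=> i; [apply: xwt | apply: xwt'].
Qed.

Lemma graded_sum (I : finType) (x : I -> U) :
  (forall i, graded (x i)) -> graded (\sum_i x i).
Proof.
move=> xg; elim/big_ind: _ => //; last exact: gradedD.
by exists 0%N, (fun=> 0), (fun=> 0); split=> [|[]//]; rewrite big_ord0.
Qed.

(* The homogeneous components of [u] are polynomials in [L] applied to [u]. *)
Lemma graded_sub (P : U -> Prop) u : is_subspace P -> (forall v, P v -> P (L v)) ->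
  P u -> graded u -> exists (d : nat) (wt : 'I_d -> K) (x : 'I_d -> U),
    [/\ u = \sum_i x i, forall i, eigenvec L (wt i) (x i) & forall i, P (x i)].
Proof.
move=> PS PL Pu [d [wt [x [ux xwt]]]].
(* Lagrange interpolation: with [s] the list of all indices, [D k s] is the product of the
   [(L - wt j) / (wt k - wt j)] over the [j] with [wt j] different from [wt k], the projection to
   the eigenvalue [wt k]. *)
pose D k (s : seq 'I_d) (v : U) : U := foldr (fun j v =>
  if wt j == wt k then v else (wt k - wt j)^-1 *: (L v - wt j *: v)) v s.
have DP k s v : P v -> P (D k s v).
  elim: s => //= j s IH /IH Pv; case: ifP => // _.
  by apply: subspaceZ => //; apply: subspaceB => //; [apply: PL | apply: subspaceZ].
have Dl k s : is_linear (D k s).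
  elim: s => [|j s IH] c v w //=; case: ifP => // _.
  rewrite -/(D k s _) IH Ll scalerA (mulrC c) -scalerA -scalerDr; congr (_ *: _).
  by rewrite !scalerDr !scalerN !scalerA (mulrC c) opprD addrACA.
have DE k s i : D k s (x i) = (\prod_(j <- s)
    if wt j == wt k then 1 else (wt i - wt j) / (wt k - wt j)) *: x i.
  elim: s => [|j s IH]; first by rewrite big_nil scale1r.
  rewrite big_cons /= -/(D k s _) IH; case: ifP => _; first by rewrite mul1r.
  rewrite (is_linearZ Ll) xwt !scalerA -scalerBl scalerA; congr (_ *: _).
  by rewrite [wt j * _]mulrC -mulrBr mulrCA [RHS]mulrC [_^-1 * _]mulrC.
(* [r] selects one index for each weight. The components of equal weight are collected at that
   index, and the entries at all other indices are zero. *)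
pose r i : 'I_d := odflt i [pick k | wt k == wt i].
have wtr i : wt (r i) = wt i by rewrite /r; case: pickP => [k /eqP|].
have rE i j : wt i = wt j -> r i = r j.
  rewrite /r => ->; case: pickP => // no; by have := no j; rewrite eqxx.
exists d, wt, (fun k => \sum_(i | r i == k) x i); split=> [|k|k].
- by rewrite ux (partition_big r xpredT).
- rewrite /eigenvec (is_linear_sum Ll) scaler_sumr; apply: eq_bigr => i /eqP <-.
  by rewrite wtr xwt.
case: (eqVneq (r k) k) => [rk|nrk]; last first.
  rewrite big_pred0 => [|i]; first exact: PS.1.
  by apply/negP => /eqP rik; case/eqP: nrk; rewrite -rik; apply: rE; apply: wtr.
rewrite (_ : \sum_(i | _) _ = D k (enum 'I_d) u); first exact: DP.
rewrite ux (is_linear_sum (Dl _ _)) big_mkcond; apply: eq_bigr => i _; rewrite DE.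
case: eqP => [rik|nrik].
  rewrite big1 ?scale1r // => j _; case: eqP => // nj.
  by rewrite -(wtr i) rik divff // subr_eq0; apply/eqP => e; apply: nj.
rewrite (bigD1_seq i) ?mem_enum ?enum_uniq //= subrr mul0r; case: eqP => [e|_].
  by case: nrik; rewrite (rE _ _ e).
by rewrite mul0r scale0r.
Qed.
End Graded.

Lemma graded_map (K : numFieldType) (U W : lmodType K) (L : U -> U) (L' : W -> W)
    (f : U -> W) : is_linear f -> (forall u, f (L u) = L' (f u)) ->
  forall u, graded L u -> graded L' (f u).
Proof.
move=> fl fL u [d [wt [x [-> xwt]]]]; rewrite (is_linear_sum fl).
apply: (@graded_finType _ _ _ _ wt) => i.
by rewrite /eigenvec -fL xwt (is_linearZ fl).
Qed.

Section ModuleConstructions.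
Variables (K : numClosedFieldType) (V : voa K).

Lemma dsum_module (I : finType) (F : I -> premodule V) :
  (forall i, is_module (F i)) -> is_module (dsum_premodule F).
Proof.
move=> Fm; pose U := dsum_premodule F.
have jl i : is_linear (fun x : F i => dinj i x : U) by move=> c u v; apply: dinjD.
have jm i v n (x : F i) : (dinj i (pm_mode v n x) : U) = pm_mode v n (dinj i x : U).
  apply: dsum_eqP => j; rewrite dsum_modeE.
  case: (pselect (i = j)) => [<-|nij]; first by rewrite !dinj_eq.
  by rewrite !dinj_neq // (is_linear0 (pm_mode_lin v n)).
have wtc a (w : U) i : weight_vec a w -> weight_vec a (dcoord w i).
  by move=> /(congr1 (fun y => dcoord y i)); rewrite /weight_vec /eigenvec dsum_modeE => ->.
split=> [|w|a|a].
- by apply: dsum_weak => i; case: (Fm i).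
- rewrite (dsum_decomp w); apply: graded_sum => i.
  apply: (graded_map (L := pm_mode (omega V) 1) (f := fun x : F i => dinj i x : U)) => //.
  by case: (Fm i) => _ gr _ _; apply: gr.
- have /(_ _)/cid h : forall i, exists p : {d : nat & 'I_d -> F i},
      forall u, weight_vec a u -> exists c : 'I_(projT1 p) -> K, u = \sum_k c k *: projT2 p k.
    by move=> i; case: (Fm i) => _ _ /(_ a)[d [e eP]] _; exists (existT _ d e).
  pose p i := projT1 (h i).
  apply: (@fin_dim_finType _ _ {i : I & 'I_(projT1 (p i))}
    (fun k => dinj (tag k) (projT2 (p (tag k)) (tagged k)))) => w wa.
  have hc i := cid (projT2 (h i) _ (wtc a w i wa)).
  exists (fun k => projT1 (hc (tag k)) (tagged k)).
  pose t i k : dsum F := projT1 (hc i) k *: dinj i (projT2 (p i) k).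
  transitivity (\sum_i \sum_k t i k); last by rewrite (sig_big_dep _ (fun=> xpredT) t).
  rewrite [LHS]dsum_decomp; apply: eq_bigr => i _.
  rewrite [in LHS](projT2 (hc i)) (is_linear_sum (jl i)); apply: eq_bigr => k _.
  exact: is_linearZ (jl i) _ _.
- have /(_ _)/cid h : forall i, exists N : int, forall n : int, n < N ->
      forall w : F i, weight_vec (a + n%:~R) w -> w = 0.
    by move=> i; case: (Fm i) => _ _ _; apply.
  exists (- \sum_i `|projT1 (h i)|) => n nN w wa; apply: dsum_eqP => i.
  apply: (projT2 (h i) n _ _ (wtc _ _ i wa)); apply: lt_le_trans nN _.
  rewrite lerNl; apply: le_trans (_ : `|projT1 (h i)| <= _); first by rewrite -normrN ler_norm.
  by rewrite (bigD1 i) //= lerDl sumr_ge0.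
Qed.

Lemma res_module (gT : finGroupType) (G : aut_group V gT) (M : premodule V) :
  is_module M -> is_module (res_premodule G M).
Proof.
move=> [[tr vacE jac] gr fd bd]; split=> //; split=> [u w|n w|u v w l m n].
- exact: tr.
- exact: vacE.
- exact: jac.
Qed.

Lemma module_iso_module (M N : premodule V) : module_iso M N -> is_module M -> is_module N.
Proof.
case=> f [fl [g fK gK]] fm [[tr vacE jac] gr fd bd].
have gl : is_linear g by move=> c u v; rewrite -[u in LHS]gK -[v in LHS]gK -fl fK.
have gm v n w : g (pm_mode v n w) = pm_mode v n (g w) by rewrite -[w in LHS]gK -fm fK.
have wtg a w : weight_vec a w -> weight_vec a (g w).
  by rewrite /weight_vec /eigenvec -gm => ->; apply: is_linearZ.
split; first split=> [u w|n w|u v w l m n].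
- by have [n trn] := tr u (g w); exists n => k /trn e; rewrite -[w]gK -fm e (is_linear0 fl).
- by rewrite -[w]gK -fm vacE; case: ifP => // _; apply: is_linear0.
- have [k jack] := jac u v (g w) l m n; exists k => h /jack e.
  apply: (can_inj gK); rewrite (is_linearB _ _ gl) (is_linearZ gl) !(is_linear_sum gl).
  under eq_bigr do rewrite (is_linearZ gl) !gm.
  under [X in _ - _ *: X]eq_bigr do rewrite (is_linearZ gl) !gm.
  by under [RHS]eq_bigr do rewrite (is_linearZ gl) !gm.
- move=> w; rewrite -[w]gK.
  by apply: (graded_map (L := pm_mode (omega V) 1) fl) => //; apply: gr.
- move=> a; have [d [e eP]] := fd a; exists d, (f \o e) => w /wtg /eP [c gw].
  exists c; rewrite -[w]gK gw (is_linear_sum fl).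
  by apply: eq_bigr => i _; apply: is_linearZ.
- move=> a; have [n nP] := bd a; exists n => k /nP kn w /wtg /kn e.
  by rewrite -[w]gK e (is_linear0 fl).
Qed.

Lemma module_iso_irreducible (M N : premodule V) :
  module_iso M N -> irreducible M -> irreducible N.
Proof.
case=> f [fl [g fK gK]] fm [[w nw] Mi]; split=> [|P PS Pm].
  by exists (f w) => fw; apply: nw; rewrite -[w]fK fw -(is_linear0 fl) fK.
have [||P0|P1] := Mi (fun w => P (f w)); first exact: subspace_preim.
- by move=> v n u; rewrite fm; apply: Pm.
- left=> u Pu; rewrite -[u]gK (P0 (g u)) ?gK //; exact: is_linear0.
- by right=> u; rewrite -[u]gK.
Qed.

Section MultSpace.
Variables (A : assoc_alg K) (J : finType) (a b : J -> A).
Hypotheses (sepA : separability a b).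
Variables (B : bimodule A V) (X : amodule A).
Hypotheses (Bmod : is_module B) (Xfin : fin_dim (fun _ : X => True)).

Lemma hom_eqP (f g : mult_space X B) : hom_fun f =1 hom_fun g -> f = g.
Proof. by move=> fg; apply/val_inj/functional_extensionality_dep. Qed.

Lemma hom_fun_lin x : is_linear (fun f : mult_space X B => hom_fun f x).
Proof. by move=> c f g; apply: (congr1 (fun h => h x) (sub_valD c f g)). Qed.

Lemma exists_hom (f : X -> B) : amod_hom (Y := bm_amod B) f ->
  exists h : mult_space X B, hom_fun h = f.
Proof. by move=> fh; exists (sub_elt (P := Subspace (is_hom_subspace X B)) fh). Qed.

(** A homomorphism is determined by its values on a finite basis of [X], so the bounds in the
    truncation and Jacobi axioms can be chosen uniformly over [X]. *)
Lemma mult_space_module : is_module (mult_space X B).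
Proof.
have [[tr vacE jac] gr fd bd] := Bmod.
have [n [e [z [zl ez ze]]]] := exists_basis Xfin.
have homE (f : mult_space X B) x : hom_fun f x = \sum_i z i x *: hom_fun f (e i).
  have [fl _] := hom_funP f; rewrite {1}(ez x) (is_linear_sum fl).
  by apply: eq_bigr => i _; rewrite (is_linearZ fl).
have hom_ext (f g : mult_space X B) : (forall i, hom_fun f (e i) = hom_fun g (e i)) -> f = g.
  by move=> fg; apply: hom_eqP => x; rewrite !homE; apply: eq_bigr => i _; rewrite fg.
have hl := hom_fun_lin.
have wth c (f : mult_space X B) x : weight_vec c f -> weight_vec c (hom_fun f x).
  by move=> /(congr1 (fun h : mult_space X B => hom_fun h x)); rewrite (is_linearZ (hl x)).
split; first split=> [u f|k f|u v f l m k].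
- have [|N trN] := @finType_bound_int _ (fun i k => pm_mode u k (hom_fun f (e i)) = 0).
    by move=> i; apply: tr.
  exists N => k Nk; apply: hom_ext => i.
  by rewrite (is_linear0 (hl (e i))); apply: trN.
- by apply: hom_ext => i; rewrite [LHS]vacE; case: ifP.
- have [|N jacN] := @finType_bound_nat 'I_n (fun i k' =>
    \sum_(h < k') ((-1) ^+ h * binz K l h) *:
      pm_mode u (l + m - h%:Z) (pm_mode v (k + h%:Z) (hom_fun f (e i)))
    - ((-1) ^ l) *: \sum_(h < k') ((-1) ^+ h * binz K l h) *:
      pm_mode v (l + k - h%:Z) (pm_mode u (m + h%:Z) (hom_fun f (e i)))
    = \sum_(h < k') binz K m h *:
      pm_mode (voa_mode u (l + h%:Z) v) (m + k - h%:Z) (hom_fun f (e i))).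
    by move=> i; apply: jac.
  exists N => k' Nk; apply: hom_ext => i; have cl := hl (e i).
  rewrite (is_linearB _ _ cl) (is_linearZ cl) !(is_linear_sum cl).
  under eq_bigr do rewrite (is_linearZ cl).
  under [X in _ - _ *: X]eq_bigr do rewrite (is_linearZ cl).
  under [RHS]eq_bigr do rewrite (is_linearZ cl).
  exact: jacN.
(* In the space of all maps from [X] to [B], [f] is a finite sum of rank one maps and therefore
   graded; [graded_sub] then shows that its homogeneous components are again homomorphisms. *)
- move=> f; pose U := dprod (fun _ : X => B).
  pose L (g : U) : U := fun x => pm_mode (omega V) 1 (g x).
  have Ll : is_linear L.
    by move=> c g h; apply: functional_extensionality_dep => x; apply: pm_mode_lin.
  have fg : graded L (hom_fun f : U).
    pose j i (w : B) : U := fun x => z i x *: w.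
    have jl i : is_linear (j i).
      move=> c u v; apply: functional_extensionality_dep => x.
      rewrite [LHS]scalerDr scalerA mulrC -scalerA; exact: erefl.
    have -> : (hom_fun f : U) = \sum_i j i (hom_fun f (e i)).
      apply: functional_extensionality_dep => x; rewrite homE.
      pose cx (g : U) : B := g x; have cxl : is_linear cx by [].
      by rewrite -[RHS]/(cx _) (is_linear_sum cxl).
    apply: graded_sum => i; apply: (graded_map (L := pm_mode (omega V) 1)) (jl i) _ _ (gr _).
    move=> w; apply: functional_extensionality_dep => x.
    by rewrite /L /j (is_linearZ (pm_mode_lin _ _)).
  have [|d [wt [y [fy ywt yh]]]] := graded_sub Ll (is_hom_subspace X B) _ (hom_funP f) fg.
    by move=> g gh; have [h <-] := exists_hom gh; apply: (hom_funP (hom_mode (omega V) 1 h)).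
  exists d, wt, (fun i => sub_elt (P := Subspace (is_hom_subspace X B)) (yh i)).
  have vl : is_linear (val : mult_space X B -> U) by move=> c g h; apply: sub_valD.
  split; first by apply: val_inj; rewrite (is_linear_sum vl).
  move=> i; apply: val_inj; rewrite (is_linearZ vl); exact: ywt.
(* The rank one maps [z i (-) *: y j], with the [y j] spanning the weight space, span a space
   containing [f]. Averaging fixes [f], so their averages span the weight space of homomorphisms. *)
- move=> c; have [d [y yP]] := fd c.
  pose g (p : 'I_n * 'I_d) (x : X) : bm_amod B := z p.1 x *: y p.2.
  have gl p : is_linear (g p) by move=> k u v; rewrite /g zl scalerDl scalerA.
  have /(_ _)/cid h : forall p, exists f : mult_space X B, hom_fun f = average a b (g p).
    by move=> p; apply: exists_hom; apply: average_hom.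
  apply: (@fin_dim_finType _ _ ('I_n * 'I_d)%type (fun p => projT1 (h p))) => f fc.
  have hc i := cid (yP _ (wth c f (e i) fc)).
  exists (fun p => projT1 (hc p.1) p.2); apply: hom_eqP => x.
  rewrite (is_linear_sum (hl x)).
  rewrite -[LHS](average_id (X := X) (Y := bm_amod B) sepA (hom_funP f)).
  under [RHS]eq_bigr => p _ do rewrite (is_linearZ (hl x)) (projT2 (h p)) /average scaler_sumr.
  rewrite exchange_big; apply: eq_bigr => k _.
  rewrite homE (is_linear_sum (am_act_lin (bm_amod B) _)).
  rewrite -(pair_bigA _ (fun i j => projT1 (hc i) j *: am_act (a k) (g (i, j) (am_act (b k) x)))).
  apply: eq_bigr => i _; rewrite [in LHS](projT2 (hc i)) scaler_sumr.
  rewrite (is_linear_sum (am_act_lin (bm_amod B) _)); apply: eq_bigr => j _.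
  by rewrite scalerA mulrC -scalerA (is_linearZ (am_act_lin (bm_amod B) _)).
- move=> c; have [N NP] := bd c; exists N => k /NP kN f fc.
  apply: hom_eqP => x; rewrite (is_linear0 (hl x)); exact/kN/wth.
Qed.
End MultSpace.
End ModuleConstructions.

(** * The dual pair *)

Lemma mono_mul_mono (K : numFieldType) (I : finType) (m : mono_struct K I) i j :
  mono_mul m (mono K i) (mono K j) = ms_coef m i j *: mono K (ms_mul m i j).
Proof. by rewrite mono_mulE mono_extE mono_shift_mono. Qed.

Lemma mono_fin_dim (K : numFieldType) (I : finType) (m : mono_struct K I) :
  fin_dim (fun _ : mono_alg m => True).
Proof.
have spanm (f : mono_alg m) : True ->
    exists c : I -> K, f = \sum_i c i *: (mono K i : mono_alg m).
  by move=> _; exists (fun i => (f : {ffun I -> K^o}) i); apply: mono_dec.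
exact: fin_dim_finType spanm.
Qed.

Section Orbifold.
Variables (K : numClosedFieldType) (V : voa K) (gT : finGroupType) (G : aut_group V gT).
Variables (S : gstable_set G) (F : intertwiners S).
Implicit Types (s t : S) (g h : gT).
Local Notation M := (@gs_mod _ _ _ _ S).
Local Notation total := (gs_total S).
Local Notation A := (A_alpha F).
Local Arguments gs_coord : simpl never.
Local Arguments gs_inj : simpl never.
Local Arguments gs_op : simpl never.

Lemma total_module : is_module total.
Proof. by apply: dsum_module => s; apply: gs_module. Qed.

(** Commuting with the idempotents [1 (x) e(M)] means preserving each summand, so [T] is a family
    [T_], and [mode_density] applies to all components of all [y i]. *)
Lemma total_density (T : total -> total) (I : finType) (y : I -> total) :
  is_linear T -> (forall s w, T (gs_op F (1%g, s) w) = gs_op F (1%g, s) (T w)) ->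
  exists L, forall i, mode_sum L (y i) = T (y i).
Proof.
move=> Tl Te; pose T_ s (w : M s) : M s := gs_coord (T (gs_inj w)) s.
have TE s (w : M s) : T (gs_inj w) = gs_inj (T_ s w).
  have e : gs_op F (1%g, s) (gs_inj w) = gs_inj w by rewrite gs_op1 gs_inj_eq.
  by rewrite -{1}e Te gs_op1.
have [s|s|s|s c u v|L LE] := @mode_density _ _ S M _ _ (@gs_ineq _ _ _ _ S) _
    (I * S)%type (fun p => p.2) (fun p => gs_coord (y p.1) p.2) T_.
- by case: (gs_module s).
- exact: gs_irr.
- by apply: module_schur; [apply: gs_module | apply: gs_irr].
- by rewrite /T_ gs_inj_lin Tl gs_coord_lin.
exists L => i; rewrite -[in RHS](gs_total_sum (y i)) (is_linear_sum Tl).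
rewrite -[LHS]gs_total_sum; apply: eq_bigr => s _; rewrite TE -(LE (i, s)); congr gs_inj.
rewrite /mode_sum (is_linear_sum (gs_coord_lin s)).
by apply: eq_bigr => p _; rewrite gs_coord_mode.
Qed.

Lemma gs_op_mode p v n (w : total) :
  gs_op F p (pm_mode v n w) = pm_mode (G p.1 v) n (gs_op F p w).
Proof. by rewrite /gs_op gs_coord_mode phi_mode gs_inj_mode. Qed.

Lemma alpha_neq0 s g h : alpha F s g h != 0.
Proof.
apply/eqP => a0; have [[w nw] _] := gs_irr s; apply: nw.
have := alphaE F g h w; rewrite a0 scale0r => e0.
apply: (bij_inj (phi_bij F s h)); apply: (bij_inj (phi_bij F _ g)).
rewrite !(is_linear0 (phi_lin F _)); apply: gs_inj_inj; rewrite e0.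
by rewrite (is_linear0 (@gs_inj_lin _ _ _ _ S _)).
Qed.

Lemma A_coef_neq0 p q : gs_act p.2 q.1 = q.2 -> A_coef F p q != 0.
Proof. by rewrite /A_coef => ->; rewrite eqxx alpha_neq0. Qed.

Lemma gs_op_surj g s (w : total) :
  exists t z, gs_op F (g, t) z = gs_inj (gs_coord w s).
Proof.
have nc : A_coef F (g, gs_act s g) (g^-1%g, s) != 0 by apply: A_coef_neq0; rewrite /= gs_actK.
exists (gs_act s g), ((A_coef F (g, gs_act s g) (g^-1%g, s))^-1 *: gs_op F (g^-1%g, s) w).
by rewrite (is_linearZ (gs_op_lin F _)) gs_opM scalerK // /A_mul mulgV gs_op1.
Qed.

(* Averaging a sum of modes of elements of [V] over [G] conjugates it by the
   operators [gs_op], with which [T] commutes. *)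
Lemma fixed_density (T : total -> total) (I : finType) (y : I -> total) :
  is_linear T -> (forall p w, T (gs_op F p w) = gs_op F p (T w)) ->
  exists L, forall i, mode_sum (M := res_premodule G total) L (y i) = T (y i).
Proof.
move=> Tl Tc; pose J := (gT * I * S)%type.
have /(_ _)/cid hz : forall p : J, exists tz : S * total,
    gs_op F (p.1.1, tz.1) tz.2 = gs_inj (gs_coord (y p.1.2) p.2).
  by move=> p; have [t [z tz]] := gs_op_surj p.1.1 p.2 (y p.1.2); exists (t, z).
pose tz p := projT1 (hz p).
have tzP p : gs_op F (p.1.1, (tz p).1) (tz p).2 = gs_inj (gs_coord (y p.1.2) p.2).
  exact: projT2 (hz p).
have [|L LE] := @total_density T J (fun p => (tz p).2) Tl; first by move=> s w; apply: Tc.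
exists [seq (fix_avg G p.1, p.2) | p <- L] => i; rewrite /mode_sum big_map /=.
(* Each component of [y i] is the image under an operator [gs_op] of group part [g] of a vector on
   which [L] represents [T]; moving the modes through [gs_op] applies [g] to them. *)
have twist g : \sum_(p <- L) pm_mode (G g p.1) p.2 (y i) = T (y i).
  rewrite -[in RHS](gs_total_sum (y i)) (is_linear_sum Tl).
  rewrite -{1}(gs_total_sum (y i)).
  under eq_bigr do rewrite (is_linear_sum (pm_mode_lin _ _)).
  rewrite exchange_big; apply: eq_bigr => s _.
  rewrite -(tzP (g, i, s)) Tc -(LE (g, i, s)) /mode_sum (is_linear_sum (gs_op_lin F _)).
  by apply: eq_bigr => p _; rewrite gs_op_mode.
transitivity (\sum_(p <- L) #|gT|%:R^-1 *: \sum_g pm_mode (G g p.1) p.2 (y i)).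
  apply: eq_bigr => p _.
  transitivity (pm_mode (#|gT|%:R^-1 *: \sum_g G g p.1) p.2 (y i)); first by [].
  by rewrite (is_linearZ (pm_mode_linl _ _)) (is_linear_sum (pm_mode_linl _ _)).
rewrite -scaler_sumr exchange_big /= (eq_bigr (fun=> T (y i))) => [|g _]; last exact: twist.
rewrite sumr_const -scaler_nat scalerA mulVf ?scale1r //.
by rewrite pnatr_eq0 -lt0n; apply/card_gt0P; exists 1%g.
Qed.

Lemma A_mul_mono p q :
  alg_mul (mono K p : A) (mono K q) = A_coef F p q *: (mono K (A_mul p q) : A).
Proof. exact: mono_mul_mono. Qed.

Lemma A_act_mono p (w : total) : A_act (mono K p : A) w = gs_op F p w.
Proof. exact: mono_extE. Qed.

(** The inverse of [a (x) e(M)] in the sense of a groupoid: the two products with it are the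
    idempotents of [M] and of [M . a^-1]. *)
Definition A_inv (p : gT * S) : A :=
  (alpha F p.2 p.1^-1%g p.1)^-1 *: (mono K (p.1^-1%g, gs_act p.2 p.1^-1%g) : A).

Let mulZl c (x y : A) : alg_mul (c *: x) y = c *: alg_mul x y.
Proof. exact: is_linearZ (@alg_mul_linl _ A y) c x. Qed.

Let mulZr c (x y : A) : alg_mul x (c *: y) = c *: alg_mul x y.
Proof. exact: is_linearZ (@alg_mul_linr _ A x) c y. Qed.

(** Associativity of [g g^-1 g] compares the two scalars; it makes the left inverse [A_inv] a right
    inverse as well. *)
Lemma alpha_inv s g : alpha F (gs_act s g^-1%g) g g^-1%g = alpha F s g^-1%g g.
Proof.
have := A_coefA F (g, s) (g^-1%g, gs_act s g^-1%g) (g, s).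
rewrite /A_mul /= mulVg mulgV A_coef1l A_coef1r !mulr1.
by rewrite /A_coef /= gs_actVK !eqxx.
Qed.

Lemma A_inv_mull g s : alg_mul (A_inv (g, s)) (mono K (g, s) : A) = mono K (1%g, s).
Proof.
rewrite mulZl A_mul_mono /A_coef /= gs_actVK eqxx scalerK ?alpha_neq0 //.
by rewrite /A_mul /= mulVg.
Qed.

Lemma A_inv_mulr g s :
  alg_mul (mono K (g, s) : A) (A_inv (g, s)) = mono K (1%g, gs_act s g^-1%g).
Proof.
rewrite mulZr A_mul_mono /A_coef /= eqxx alpha_inv scalerK ?alpha_neq0 //.
by rewrite /A_mul /= mulgV.
Qed.

Lemma A_mul_id_mono g s :
  alg_mul (mono K (1%g, gs_act s g^-1%g) : A) (mono K (g, s)) = mono K (g, s).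
Proof. by rewrite A_mul_mono A_coef1l scale1r /A_mul /= mul1g. Qed.

Lemma A_mul_mono_id g s : alg_mul (mono K (g, s) : A) (mono K (1%g, s)) = mono K (g, s).
Proof. by rewrite A_mul_mono A_coef1r scale1r /A_mul /= mulg1. Qed.

Lemma A_mul_mono0 p q : gs_act p.2 q.1 <> q.2 -> alg_mul (mono K p : A) (mono K q) = 0.
Proof. by rewrite A_mul_mono /A_coef; case: eqP => // _ _; rewrite scale0r. Qed.

(** The scalar is the one in the product of [(h, t)] with [(g, s)]. Hence the reindexing of [g] by
    [h g] turns multiplication on one side of the separability element into multiplication on the
    other. *)
Lemma A_inv_transl g h s t :
  alg_mul (A_inv ((h * g)%g, s)) (mono K (h, t) : A) = A_coef F (h, t) (g, s) *: A_inv (g, s).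
Proof.
case: (eqVneq t (gs_act s g^-1%g)) => [->|nt].
  have idr : alg_mul (mono K (1%g, s) : A) (A_inv (g, s)) = A_inv (g, s).
    rewrite mulZr A_mul_mono; congr (_ *: _).
    have := A_coef1l F (gs_act s g^-1%g) g^-1%g; rewrite invgK gs_actVK => ->.
    by rewrite scale1r /A_mul /= mul1g.
  rewrite -[in RHS]idr -(A_inv_mull (h * g)%g s).
  have -> : alg_mul (A_inv ((h * g)%g, s)) (mono K (h, gs_act s g^-1%g) : A) =
      alg_mul (alg_mul (A_inv ((h * g)%g, s))
        (alg_mul (mono K (h, gs_act s g^-1%g) : A) (mono K (g, s)))) (A_inv (g, s)).
    rewrite -!alg_mulA A_inv_mulr; congr (alg_mul _ _).
    by rewrite A_mul_mono_id.
  by rewrite A_mul_mono (mulZr (A_coef _ _ _)) (mulZl (A_coef _ _ _)).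
have -> : A_coef F (h, t) (g, s) = 0.
  rewrite /A_coef /=; case: eqP => // ts.
  by case/eqP: nt; rewrite -ts gs_actK.
rewrite scale0r /A_inv mulZl A_mul_mono0 ?scaler0 //= invMg gs_actM gs_actVK => st.
by case/eqP: nt.
Qed.

Lemma A_oneE : alg_one A = \sum_s (mono K (1%g, s) : A).
Proof.
rewrite [LHS](mono_dec (A_one S)).
transitivity (\sum_g \sum_s A_one S (g, s) *: (mono K (g, s) : A)).
  by rewrite pair_bigA; apply: eq_bigr => -[].
rewrite (bigD1 1%g) //= [X in _ + X]big1 ?addr0 => [|g /negPf ng]; last first.
  by apply: big1 => s _; rewrite ffunE /= ng scale0r.
by apply: eq_bigr => s _; rewrite ffunE eqxx scale1r.
Qed.

Let card_neq0 : #|gT|%:R != 0 :> K.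
Proof. by rewrite pnatr_eq0 -lt0n; apply/card_gt0P; exists 1%g. Qed.

(** In either order the products of basis elements with their inverses run through the idempotents
    [1 (x) e(M)], each [#|gT|] times, which explains the factor [#|gT|%:R^-1]. *)
Lemma A_separability :
  separability (fun p => #|gT|%:R^-1 *: (mono K p : A)) A_inv.
Proof.
have avg (x : A) : \sum_(g : gT) #|gT|%:R^-1 *: x = x.
  by rewrite sumr_const -scaler_nat scalerA divff // scale1r.
split=> [||Z f fl fr c].
- rewrite A_oneE; transitivity (\sum_(g : gT) \sum_s
      #|gT|%:R^-1 *: (mono K (1%g, gs_act s g^-1%g) : A)).
    by rewrite [RHS]pair_bigA; apply: eq_bigr => -[g s] _; rewrite mulZl A_inv_mulr.
  rewrite -[RHS]avg; apply: eq_bigr => g _; rewrite scaler_sumr.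
  rewrite [RHS](reindex_onto (fun s => gs_act s g^-1%g) (fun s => gs_act s g)) /= => [|s _].
    by apply: eq_bigl => s; rewrite gs_actVK eqxx.
  exact: gs_actK.
- rewrite A_oneE; transitivity (\sum_(g : gT) \sum_s #|gT|%:R^-1 *: (mono K (1%g, s) : A)).
    by rewrite [RHS]pair_bigA; apply: eq_bigr => -[g s] _; rewrite mulZr A_inv_mull.
  by rewrite -[RHS]avg; apply: eq_bigr => g _; rewrite scaler_sumr.
pose lhs c := \sum_p f (alg_mul c (#|gT|%:R^-1 *: (mono K p : A))) (A_inv p).
pose rhs c := \sum_p f (#|gT|%:R^-1 *: (mono K p : A)) (alg_mul (A_inv p) c).
have lhsl : is_linear lhs.
  apply: is_linear_bigsum => p; apply: is_linear_comp (fl (A_inv p)) _.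
  exact: (@alg_mul_linl _ A).
have rhsl : is_linear rhs.
  by apply: is_linear_bigsum => p; apply: is_linear_comp (fr _) (@alg_mul_linr _ A _).
move: c; apply: (mono_lin_eq (f := lhs) (h := rhs) lhsl rhsl) => -[h t].
have pairE (E : gT * S -> Z) : \sum_p E p = \sum_g \sum_s E (g, s).
  by rewrite [RHS]pair_bigA; apply: eq_bigr => -[].
rewrite /lhs /rhs [LHS]pairE [RHS]pairE [RHS](reindex_inj (mulgI h)).
apply: eq_bigr => g _; apply: eq_bigr => s _; cbv beta.
rewrite mulZr A_inv_transl A_mul_mono; move: (A_inv (g, s)) => x.
by rewrite (is_linearZ (fr _)) !(is_linearZ (fl _)) !scalerA mulrC.
Qed.

Lemma A_fin_dim : fin_dim (fun _ : A => True).
Proof. exact: mono_fin_dim. Qed.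

Hypothesis Vsimple : simple_voa V.

(** Evaluating on vectors of [M s] isolates the coefficients at [(g, s)]. The maps
    [w |-> gs_inj (phi F g w)] are twisted homomorphisms from [M s] to the total space, and these
    are independent. *)
Lemma A_faithful (c : A) : (forall w : total, A_act c w = 0) -> c = 0.
Proof.
move=> c0; apply/ffunP => -[g s]; rewrite ffunE.
apply: (twisted_hom_independent (G := G) (M := M s) (N := total)
  (Phi := fun g w => gs_inj (phi F g w)) (c := fun g => (c : {ffun gT * S -> K^o}) (g, s))).
- exact: Vsimple.
- by case: total_module.
- by move=> h k u v; rewrite phi_lin gs_inj_lin.
- by move=> h v n w; rewrite phi_mode gs_inj_mode.
- move=> h; have [[w nw] _] := gs_irr s; exists w => e0; apply: nw.
  apply: (bij_inj (phi_bij F s h)); rewrite (is_linear0 (phi_lin F _)).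
  by apply: gs_inj_inj; rewrite e0 (is_linear0 (@gs_inj_lin _ _ _ _ S _)).
move=> w; rewrite -[RHS](c0 (gs_inj w)) /A_act /mono_ext.
transitivity (\sum_h \sum_t (c : {ffun gT * S -> K^o}) (h, t) *: gs_op F (h, t) (gs_inj w)).
  apply: eq_bigr => h _; rewrite (bigD1 s) //= gs_op_inj big1 ?addr0 // => t /eqP nts.
  by rewrite gs_op_inj0 ?scaler0 // => st; apply: nts.
by rewrite pair_bigA; apply: eq_bigr => -[].
Qed.

Local Notation BT := (total_bimodule F).

(** A matrix unit of [X] acts on the total space by averages, that is, by values of homomorphisms
    from [X]. If these are all zero, the matrix units vanish by faithfulness. *)
Lemma exists_nonzero_hom (X : amodule A) : simple_amodule X ->
  exists f : mult_space X BT, f <> 0.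
Proof.
move=> Xs; apply: contrapT => no; have [x nx] := Xs.1.
have mu0 f : is_linear f -> matrix_unit (fun p => #|gT|%:R^-1 *: (mono K p : A)) A_inv f x = 0.
  move=> fl; apply: A_faithful => w; rewrite -[LHS]/(am_act (a := bm_amod BT) _ w).
  rewrite matrix_unitE //; pose h (x : X) : bm_amod BT := f x *: (w : total).
  have hl : is_linear h by move=> d u v; rewrite /h fl scalerDl scalerA.
  have [k kE] := exists_hom (average_hom A_separability hl).
  rewrite -[average _ _ _ _]/(average _ _ h x).
  rewrite -kE (_ : k = 0) //; apply: contrapT => nk; apply: no; by exists k.
(* The coordinate at [p] of the matrix unit of [f] and [x] is [f (A_inv p x)] up to the factor
   [#|gT|%:R^-1]. All functionals thus vanish at [A_inv p x], and [x] is a combination of images of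
   these vectors. *)
have b0 p : am_act (A_inv p) x = 0.
  apply: contrapT => nb; have [f [fl f1]] := exists_functional nb.
  have := congr1 (fun c : {ffun gT * S -> K^o} => c p) (mu0 f fl).
  rewrite /matrix_unit; pose cp (c : A) : K^o := (c : {ffun gT * S -> K^o}) p.
  have cpl : is_linear cp by move=> d u v; rewrite /cp !ffunE.
  rewrite -[LHS]/(cp _) (is_linear_sum cpl) (bigD1 p) //= f1 scale1r big1 => [|q nqp]; last first.
    by rewrite !(is_linearZ cpl) /cp ffunE eq_sym (negPf nqp) !scaler0.
  rewrite addr0 (is_linearZ cpl) /cp !ffunE eqxx [_ *: _]mulr1 => /eqP.
  by rewrite invr_eq0 (negPf card_neq0).
have [one _ _] := A_separability; apply: nx.
rewrite -[x](am_act1 (A := A)) -one (is_linear_sum (am_act_linl x)) big1 // => p _.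
by rewrite am_actM b0 (is_linear0 (am_act_lin X _)).
Qed.

Lemma mult_space_total_module (X : amodule A) : simple_amodule X -> is_module (mult_space X BT).
Proof.
move=> Xs; apply: (mult_space_module A_separability).
  exact: res_module total_module.
exact: simple_fin_dim A_fin_dim Xs.
Qed.

(** Since each [Y i] has a finite basis, agreement on finitely many vectors becomes an equality of
    homomorphisms. A family [Y] is allowed so that the same modes can act on two multiplicity spaces
    at once. *)
Lemma hom_density (I : finType) (Y : I -> amodule A) (f : forall i, mult_space (Y i) BT)
    (T : bm_amod BT -> bm_amod BT) : (forall i, simple_amodule (Y i)) -> amod_hom T ->
  exists L, forall i x, hom_fun (mode_sum L (f i)) x = T (hom_fun (f i) x).
Proof.
move=> Ys [Tl Ta].
have /(_ _)/cid he : forall i, exists p : {n : nat & ('I_n -> Y i) * ('I_n -> Y i -> K^o)}%type,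
    is_basis (projT2 p).1 (projT2 p).2.
  move=> i; have [n [e [z ezB]]] := exists_basis (simple_fin_dim A_fin_dim (Ys i)).
  by exists (existT _ n (e, z)).
pose n i := projT1 (projT1 (he i)).
have [|L LE] := @fixed_density T {i : I & 'I_(n i)}
    (fun k => hom_fun (f (tag k)) ((projT2 (projT1 (he (tag k)))).1 (tagged k))) Tl.
  by move=> p w; have := Ta (mono K p : A) w; rewrite /= !A_act_mono.
exists L => i x; have [zl ez _] := projT2 (he i); have [fl _] := hom_funP (f i).
rewrite (_ : hom_fun (mode_sum L (f i)) x = mode_sum (M := res_premodule G total) L (hom_fun (f i) x)).
  rewrite (ez x) (is_linear_sum fl) (is_linear_sum (mode_sum_lin _)) (is_linear_sum Tl).
  apply: eq_bigr => k _; rewrite (is_linearZ fl) (is_linearZ (mode_sum_lin _)) (is_linearZ Tl).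
  by congr (_ *: _); apply: (LE (existT _ i k)).
by rewrite (is_linear_sum (hom_fun_lin x)).
Qed.

Lemma hom_extend (X : amodule A) (f : mult_space X BT) : simple_amodule X -> f <> 0 ->
  exists2 r : bm_amod BT -> X, amod_hom r & cancel (hom_fun f) r.
Proof.
move=> Xs nf; apply: (hom_retract A_separability (hom_funP f : amod_hom (Y := bm_amod BT) _)).
apply: (schur_inj (Y := bm_amod BT) Xs (hom_funP f)); apply: contrapT => no; apply: nf.
by apply: hom_eqP => x; apply: contrapT => nx; apply: no; exists x.
Qed.

(** For an equivariant retraction [r] of [f], the operator [h \o r] commutes with the algebra and
    sends [f] to [h]; by density so does a sum of modes of [V^G]. *)
Lemma mult_space_total_irreducible (X : amodule A) : simple_amodule X ->
  irreducible (mult_space X BT).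
Proof.
move=> Xs; split=> [|P PS Pm]; first exact: exists_nonzero_hom.
case: (pselect (exists2 f, P f & f <> 0)) => [[f Pf nf]|no]; last first.
  by left=> f Pf; apply: contrapT => nf; apply: no; exists f.
right=> h; have [r rh rK] := hom_extend Xs nf.
have Th : amod_hom (X := bm_amod BT) (Y := bm_amod BT) (hom_fun h \o r).
  exact: (amod_hom_comp (Y := X) (Z := bm_amod BT) (hom_funP h) rh).
have [//|L LE] := @hom_density unit (fun=> X) (fun=> f) _ _ Th.
rewrite (_ : h = mode_sum L f); last by apply: hom_eqP => x; rewrite (LE tt) /= rK.
by apply: subspace_sum => // p _; apply: Pm.
Qed.

(** The projection [f \o r] fixes [f] and, if [X] and [Y] are not isomorphic, kills [th f] by
    Schur's lemma. One sum of modes would then do both, although [th] is an isomorphism. *)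
Lemma mult_space_total_inj (X Y : amodule A) : simple_amodule X -> simple_amodule Y ->
  module_iso (mult_space X BT) (mult_space Y BT) -> amodule_iso X Y.
Proof.
move=> Xs Ys [th [thl thb] thm]; have [f nf] := exists_nonzero_hom Xs.
have [r rh rK] := hom_extend Xs nf.
have Th : amod_hom (X := bm_amod BT) (Y := bm_amod BT) (hom_fun f \o r).
  exact: (amod_hom_comp (Y := X) (Z := bm_amod BT) (hom_funP f) rh).
apply: contrapT => nXY.
have rth0 y : r (hom_fun (th f) y) = 0.
  apply: contrapT => nr; apply: nXY; apply: amodule_iso_sym.
  by apply: schur_iso (amod_hom_comp (Y := bm_amod BT) rh (hom_funP (th f))) _ => //; exists y.
pose Z (i : bool) := if i then X else Y.
pose k i : mult_space (Z i) BT := if i is true as i return mult_space (Z i) BT then f else th f.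
have [[]//|L LE] := @hom_density bool Z k _ _ Th.
have Lf : mode_sum L f = f by apply: hom_eqP => x; rewrite (LE true) /= rK.
have Lth : mode_sum L (th f) = 0.
  apply: hom_eqP => y; rewrite (LE false) /= rth0; exact: is_linear0 (hom_funP f).1.
apply: nf; apply: (bij_inj thb); rewrite (is_linear0 thl) -Lth -{1}Lf.
by rewrite (is_linear_sum thl); apply: eq_bigr => p _; rewrite thm.
Qed.

Lemma total_dual_pair : dual_pair BT.
Proof.
split=> [X Xs|X Y Xs Ys]; last exact: mult_space_total_inj.
split; first exact: exists_nonzero_hom.
  exact: mult_space_total_module.
exact: mult_space_total_irreducible.
Qed.
End Orbifold.

(** * Induction from the stabilizers *)

Section Corner.
Variables (K : numClosedFieldType) (V : voa K) (gT : finGroupType) (G : aut_group V gT).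
Variables (S : gstable_set G) (F : intertwiners S).
Implicit Types (s t : S) (g h : gT).
Local Notation A := (A_alpha F).
Local Notation total := (gs_total S).
Local Notation BT := (total_bimodule F).
Local Arguments gs_coord : simpl never.
Local Arguments gs_inj : simpl never.
Local Arguments gs_op : simpl never.

(* The idempotent [1 (x) e(M)] *)
Definition A_idem s : A := mono K (1%g, s).

Let mulZl c (x y : A) : alg_mul (c *: x) y = c *: alg_mul x y.
Proof. exact: is_linearZ (@alg_mul_linl _ A y) c x. Qed.

Let mulZr c (x y : A) : alg_mul x (c *: y) = c *: alg_mul x y.
Proof. exact: is_linearZ (@alg_mul_linr _ A x) c y. Qed.

Lemma A_ind (P : A -> Prop) : is_subspace P -> (forall p, P (mono K p)) -> forall c, P c.
Proof.
move=> PS Pm c; rewrite (mono_dec (c : {ffun gT * S -> K^o})).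
by apply: (subspace_sum (U := A)) => // p _; apply: (subspaceZ (U := A)).
Qed.

Lemma A_inv_idem g s : alg_mul (A_idem s) (A_inv F (g, s)) = A_inv F (g, s).
Proof.
rewrite /A_inv mulZr A_mul_mono; congr (_ *: _).
have := A_coef1l F (gs_act s g^-1%g) g^-1%g; rewrite invgK gs_actVK => ->.
by rewrite scale1r /A_mul /= mul1g.
Qed.

Lemma exists_idem_neq0 (Y : amodule A) (y : Y) :
  y <> 0 -> exists t, am_act (A_idem t) y <> 0.
Proof.
move=> ny; apply: contrapT => no; apply: ny.
rewrite -[y](am_act1 (A := A)) A_oneE (is_linear_sum (am_act_linl y)) big1 // => t _.
by apply: contrapT => nt; apply: no; exists t.
Qed.

(** The groupoid element from [M . g] to [M] carries the component at one module of an orbit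
    injectively to the component at any other. *)
Lemma idem_orbit (Y : amodule A) (y : Y) s g : am_act (A_idem (gs_act s g)) y <> 0 ->
  exists c, am_act (A_idem s) (am_act c y) = am_act c y /\ am_act c y <> 0.
Proof.
move=> ny; exists (A_inv F (g^-1%g, s)); rewrite -am_actM A_inv_idem; split=> // c0.
apply: ny; have := A_inv_mulr F g^-1%g s; rewrite invgK /A_idem => <-.
by rewrite am_actM c0; apply: is_linear0 (am_act_lin Y _).
Qed.

Variable s : S.
Local Notation Q := (tga F s).
Local Notation e := (A_idem s).

Lemma tga_inj1 : tga_inj (alg_one Q) = e.
Proof. exact: (tga_inj_mono F (1%g : [subg gs_stab_Group s])). Qed.

Lemma tga_inj_idem (x : Q) : alg_mul e (tga_inj x) = tga_inj x.
Proof. by rewrite -tga_inj1 -tga_injM (@alg_mul1l _ Q). Qed.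

Lemma D_mul_idem (d : A) : D_pred s d -> alg_mul d e = d.
Proof.
move=> Dd; rewrite {2}(mono_dec (d : {ffun gT * S -> K^o})).
rewrite [in LHS](mono_dec (d : {ffun gT * S -> K^o})).
rewrite (is_linear_sum (U := A) (@alg_mul_linl _ A e)); apply: eq_bigr => -[g t] _.
case: (eqVneq t s) => [->|nts]; last first.
  by rewrite (Dd (g, t)) // !scale0r (is_linear0 (@alg_mul_linl _ A e)).
by rewrite (mulZl _ (mono K (g, s))) A_mul_mono_id.
Qed.

(* [e A e] is the twisted group algebra of the stabilizer *)
Lemma corner_tga (c : A) : exists x : Q, alg_mul e (alg_mul c e) = tga_inj x.
Proof.
have el : is_linear (fun c : A => alg_mul e (alg_mul c e)).
  by move=> k u v; rewrite (@alg_mul_linl _ A) (@alg_mul_linr _ A).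
move: c; apply: A_ind => [|[g t]].
  split=> [|k u v [x ux] [y vy]].
    by exists 0; rewrite (is_linear0 el) (is_linear0 (@tga_inj_lin _ _ _ _ _ F s)).
  by exists (k *: x + y); rewrite el ux vy tga_inj_lin.
case: (eqVneq t s) => [->|nts]; last first.
  exists 0; rewrite (is_linear0 (@tga_inj_lin _ _ _ _ _ F s)) (_ : alg_mul (mono K (g, t) : A) e = 0).
    exact: is_linear0 (@alg_mul_linr _ A e).
  by apply: A_mul_mono0; rewrite /= gs_act1 => st; case/eqP: nts.
rewrite A_mul_mono_id; case: (boolP (g \in gs_stab s)) => [gs|ngs]; last first.
  exists 0; rewrite (is_linear0 (@tga_inj_lin _ _ _ _ _ F s)); apply: A_mul_mono0 => /=.
  by move=> sg; case/negP: ngs; apply/gs_stabP.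
exists (mono K (subg (gs_stab_Group s) g)); rewrite tga_inj_mono subgK //.
have := A_mul_id_mono F g s; rewrite (_ : gs_act s g^-1%g = s) //.
by rewrite -{1}(gs_stabP _ _ gs) gs_actK.
Qed.

(** * The corner [e Y] as a module over the twisted group algebra *)

Section CornerModule.
Variable Y : amodule A.

Fact corner_subspace : is_subspace (fun y : Y => am_act e y = y).
Proof. by apply: subspace_eq; [exact: am_act_lin |]. Qed.

Definition corner_lmod : lmodType K := sub_lmod (Subspace corner_subspace).

Fact corner_stable (x : Q) (y : Y) : am_act e (am_act (tga_inj x) y) = am_act (tga_inj x) y.
Proof. by rewrite -am_actM tga_inj_idem. Qed.

Definition corner_act (x : Q) (y : corner_lmod) : corner_lmod :=
  sub_elt (P := Subspace corner_subspace) (corner_stable x (val y)).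

Fact corner_actP : is_action corner_act.
Proof.
have vD c (x y : corner_lmod) : val (c *: x + y) = c *: val x + val y by exact: sub_valD.
have vE c x : val (corner_act c x) = am_act (tga_inj c) (val x) by [].
split=> [x c d k|c d x y|x|c d x]; apply: val_inj; rewrite ?vD !vE ?vD.
- by rewrite tga_inj_lin (am_act_linl (val x)).
- exact: am_act_lin.
- rewrite tga_inj1; exact: (@sub_eltP _ _ (Subspace corner_subspace) x).
- by rewrite tga_injM am_actM.
Qed.

Definition corner_mod : amodule Q := AModule corner_actP.

Definition corner_val (y : corner_mod) : Y := val (y : corner_lmod).

Lemma corner_val_lin : is_linear corner_val.
Proof. by move=> c x y; apply: sub_valD. Qed.

Lemma corner_valP y : am_act e (corner_val y) = corner_val y.
Proof. exact: (@sub_eltP _ _ (Subspace corner_subspace) y). Qed.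

Lemma corner_val_act x y : corner_val (am_act x y) = am_act (tga_inj x) (corner_val y).
Proof. by []. Qed.

(** If [u] and [w] lie in the corner and [w = c u], then [w = (e c e) u], and [e c e] belongs to the
    twisted group algebra. *)
Lemma corner_simple : simple_amodule Y -> (exists2 y : Y, am_act e y = y & y <> 0) ->
  simple_amodule corner_mod.
Proof.
move=> Ys [y ey ny]; split=> [|P PS Pa].
  exists (sub_elt (P := Subspace corner_subspace) ey : corner_lmod).
  by move/(congr1 corner_val); rewrite (is_linear0 corner_val_lin) => /ny.
case: (pselect (exists2 u, P u & u <> 0)) => [[u Pu nu]|no]; last first.
  by left=> u Pu; apply: contrapT => nu; apply: no; exists u.
right=> w; have [|c cw] := simple_cyclic (corner_val w) Ys (x := corner_val u).
  by rewrite -(is_linear0 corner_val_lin) => /val_inj.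
have [x xc] := corner_tga c; rewrite (_ : w = am_act x u); first exact: Pa.
apply: val_inj; rewrite -!/(corner_val _) corner_val_act -xc !am_actM corner_valP.
by rewrite cw corner_valP.
Qed.
End CornerModule.

(** * Induced modules and their corners *)

Section Induced.
Variable W : amodule Q.
Local Notation ten := (tens (@D_right K V gT G S F s) (@am_act K Q W)).
Local Notation IndW := (ind_module W).

Let ten_bal : balanced (@D_right K V gT G S F s) (@am_act K Q W) ten.
Proof. exact: tens_balanced. Qed.

Lemma D_val_lin : is_linear (@D_val K V gT G S F s).
Proof. by move=> c x y; apply: sub_valD. Qed.

Definition D_idem : D_lmod F s := sub_elt (P := Subspace (D_subspace F s)) (D_mono F (s := s) 1%g).

Definition ind_unit (w : W) : IndW := ten D_idem w.

Lemma ind_unit_lin : is_linear ind_unit.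
Proof. by case: ten_bal => _ br _; apply: br. Qed.

Lemma ind_ten_unit d w : am_act (D_val d) (ind_unit w) = ten d w :> IndW.
Proof.
rewrite [LHS]ind_actE; congr (ten _ w); apply: val_inj.
exact: D_mul_idem (D_valP d).
Qed.

Lemma ind_unit_act x w : ind_unit (am_act x w) = am_act (tga_inj x) (ind_unit w).
Proof.
have [_ _ bb] := ten_bal; rewrite /ind_unit -bb [RHS]ind_actE; congr (ten _ w).
apply: val_inj; transitivity (alg_mul e (tga_inj x)); first by [].
by rewrite tga_inj_idem -[LHS](D_mul_idem (D_tga x)).
Qed.

Lemma ind_unit_idem w : am_act e (ind_unit w) = ind_unit w.
Proof. exact: (ind_ten_unit D_idem w). Qed.

Lemma ind_lift (Y : amodule A) (f : W -> Y) : is_linear f ->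
  (forall x w, f (am_act x w) = am_act (tga_inj x) (f w)) ->
  exists2 h : IndW -> Y, amod_hom h & forall d w, h (ten d w) = am_act (D_val d) (f w).
Proof.
move=> fl fa.
have bal : balanced (@D_right K V gT G S F s) (@am_act K Q W) (fun d w => am_act (D_val d) (f w)).
  split=> [w c u v|d|x d w].
  - by rewrite D_val_lin (am_act_linl (f w)).
  - exact: is_linear_comp (am_act_lin Y _) fl.
  - by rewrite fa -am_actM.
exists (tens_lift (fun d w => am_act (D_val d) (f w))); last by move=> d w; rewrite tens_liftE.
split=> [|c z]; first exact: tens_lift_lin bal.
have hl := tens_lift_lin bal.
move: z; apply: tens_ind => [|d w].
  apply: subspace_eq; first exact: is_linear_comp hl (am_act_lin IndW c).
  exact: is_linear_comp (am_act_lin Y c) hl.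
rewrite [am_act c _]ind_actE !tens_liftE //.
by rewrite -am_actM.
Qed.

(** Restricting coefficients to the stabilizer is a retraction from [D(M)] to [S(M)] of right
    [S(M)]-modules; tensored with [W] it gives a left inverse of [ind_unit]. *)
Fact tga_res_bal : balanced (@D_right K V gT G S F s) (@am_act K Q W)
  (fun d w => am_act ([ffun h => (D_val d : {ffun gT * S -> K^o}) (sgval h, s)] : Q) w).
Proof.
pose res (d : A) : Q := [ffun h => (d : {ffun gT * S -> K^o}) (sgval h, s)].
have resl : is_linear res by move=> c u v; apply/ffunP => h; rewrite !ffunE.
have res_tga x : res (tga_inj x) = x.
  apply: (mono_lin_eq (f := fun x => res (tga_inj x)) (h := id)) => // [c u v|h].
    by rewrite tga_inj_lin resl.
  rewrite tga_inj_mono; apply/ffunP => k; rewrite !ffunE xpair_eqE eqxx andbT.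
  by rewrite (inj_eq val_inj).
have resM d x : res (alg_mul d (tga_inj x)) = alg_mul (res d) x.
  have res_in g : g \in gs_stab s -> res (mono K (g, s)) = mono K (subg (gs_stab_Group s) g).
    move=> gs; apply/ffunP => k; rewrite !ffunE xpair_eqE eqxx andbT.
    by rewrite -(inj_eq val_inj) /= -/(sgval _) subgK.
  have res_out g t : (g \notin gs_stab s) || (t != s) -> res (mono K (g, t)) = 0.
    move=> gst; apply/ffunP => k; rewrite !ffunE xpair_eqE.
    case: eqP => [kg|//]; case: eqP => [st|//].
    by move: gst; rewrite -kg -st eqxx orbF (subgP k).
  have Ql := @alg_mul_linl _ Q; have Qr := @alg_mul_linr _ Q.
  have Al := @alg_mul_linl _ A; have Ar := @alg_mul_linr _ A.
  have il := @tga_inj_lin _ _ _ _ _ F s.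
  move: d; apply: A_ind => [|[g t]].
    apply: subspace_eq => [c u v|c u v]; first by rewrite Al resl.
    by rewrite resl Ql.
  apply: (mono_lin_eq (f := fun x => res (alg_mul (mono K (g, t) : A) (tga_inj x)))
    (h := fun x => alg_mul (res (mono K (g, t))) x)) => [c u v|c u v|h].
  - by rewrite il Ar resl.
  - exact: Qr.
  rewrite tga_inj_mono A_mul_mono; case: (eqVneq t s) => [->|nts]; last first.
    rewrite (res_out g t) ?nts ?orbT // (is_linear0 (Ql _)) /A_coef /=; case: eqP => [ts|_].
      case/eqP: nts; apply: etrans (esym (gs_actK t (sgval h))) _; rewrite ts.
      by have := gs_actK s (sgval h); rewrite stab_act.
    by rewrite scale0r (is_linear0 resl).
  have mE : A_mul (g, s) (sgval h, s) = ((g * sgval h)%g, s) by [].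
  rewrite (is_linearZ resl) mE; case: (boolP (g \in gs_stab s)) => gs; last first.
    have ghs : (g * sgval h)%g \notin gs_stab s.
      apply: contra gs => gh; rewrite -(mulgK (sgval h) g).
      by rewrite (groupM (G := gs_stab_Group s)) // (groupV (gs_stab_Group s)) subgP.
    by rewrite (res_out _ s) ?ghs // (res_out g s) ?gs // (is_linear0 (Ql _)) scaler0.
  rewrite !res_in ?(groupM (G := gs_stab_Group s)) ?subgP //.
  rewrite [RHS]mono_mul_mono /= /tga_coef /A_coef /= subgK // stab_act eqxx.
  by congr (_ *: mono K _); apply: val_inj; rewrite /= !subgK ?groupM ?subgP.
split=> [w c u v|d|x d w].
- by rewrite -[LHS]/(am_act (res _) w) D_val_lin resl (am_act_linl w).
- exact: am_act_lin.
- by rewrite -[LHS]/(am_act (res _) w) resM am_actM.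
Qed.

Lemma ind_unit_inj : injective ind_unit.
Proof.
apply: (can_inj (g := tens_lift (fun d w =>
  am_act ([ffun h => (D_val d : {ffun gT * S -> K^o}) (sgval h, s)] : Q) w))) => w.
rewrite (tens_liftE _ _ tga_res_bal) -[RHS](am_act1 (A := Q)); congr (am_act _ w).
apply/ffunP => k; rewrite !ffunE xpair_eqE eqxx andbT.
by rewrite -(inj_eq val_inj).
Qed.

Lemma ind_corner (z : IndW) : exists2 w, True & ind_unit w = am_act e z.
Proof.
have imS := subspace_im ind_unit_lin (subspace_true W).
move: z; apply: (tens_ind (subspace_preim (am_act_lin IndW e) imS)) => d w.
have [x xE] := corner_tga (D_val d); exists (am_act x w) => //.
by rewrite ind_unit_act -xE !am_actM ind_unit_idem ind_ten_unit.
Qed.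

Lemma ind_stable_all (P : IndW -> Prop) : stable (@am_act K A IndW) P ->
  (forall w, P (ind_unit w)) -> forall z, P z.
Proof.
move=> [PS Pa] Pu; apply: (tens_ind PS) => d w.
by rewrite -ind_ten_unit; apply: Pa.
Qed.

Lemma ind_idem0 t (z : IndW) : (forall g, gs_act s g <> t) -> am_act (A_idem t) z = 0.
Proof.
move=> nst; have tl := am_act_lin IndW (A_idem t).
move: z; apply: (tens_ind (subspace_preim tl (subspace_eq0 IndW))) => d w.
rewrite -ind_ten_unit -am_actM (_ : alg_mul _ _ = 0); first exact: is_linear0 (am_act_linl _).
have Ar := @alg_mul_linr _ A (A_idem t).
rewrite [D_val d](mono_dec (D_val d : {ffun gT * S -> K^o})) (is_linear_sum (U := A) Ar).
apply: big1 => -[g t'] _; case: (eqVneq t' s) => [->|nts]; last first.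
  by rewrite (D_valP d) // scale0r (is_linear0 Ar).
rewrite (mulZr _ _ (mono K (g, s))) A_mul_mono0 ?scaler0 //= => ts.
by apply: (nst g^-1%g); rewrite -ts gs_actK.
Qed.

(** A nonzero submodule has a nonzero component at some module of the orbit, which [idem_orbit]
    moves to the corner at [s]. The corner is [W], which is simple and generates the induced
    module. *)
Lemma ind_simple : simple_amodule W -> simple_amodule IndW.
Proof.
move=> [[w0 nw0] Ws]; split=> [|P PS Pa].
  by exists (ind_unit w0); rewrite -(is_linear0 ind_unit_lin) => /ind_unit_inj.
case: (pselect (exists2 z, P z & z <> 0)) => [[z Pz nz]|no]; last first.
  by left=> z Pz; apply: contrapT => nz; apply: no; exists z.
right; have [t nt] := exists_idem_neq0 nz.
have [g gt] : exists g, gs_act s g = t.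
  apply: contrapT => no; apply: nt; apply: ind_idem0 => g gt.
  by apply: no; exists g.
rewrite -gt in nt; have [c [ec nc]] := idem_orbit nt.
have [w _ wc] := ind_corner (am_act c z); rewrite ec in wc.
have nw : w <> 0 by move=> w00; apply: nc; rewrite -wc w00 (is_linear0 ind_unit_lin).
apply: ind_stable_all => // u; have [x <-] := simple_cyclic u (conj (ex_intro _ w0 nw0) Ws) nw.
by rewrite ind_unit_act wc; do 2!apply: (Pa).
Qed.
End Induced.

Section InducedPair.
Variables (W W' : amodule Q).
Hypotheses (Wsim : simple_amodule W) (W'sim : simple_amodule W').

Lemma ind_iso_inv :
  amodule_iso (ind_module W) (ind_module W') -> amodule_iso W W'.
Proof.
move=> [th [thl thb] tha].
have /(_ _)/cid2 h : forall w : W, exists2 w' : W', True & ind_unit w' = th (ind_unit w).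
  move=> w; have [w' _ ww'] := ind_corner (th (ind_unit w)); exists w' => //.
  by rewrite ww' -tha ind_unit_idem.
pose f w := s2val (h w).
have fE w : ind_unit (f w) = th (ind_unit w) by exact: s2valP' (h w).
apply: (schur_iso (f := f)) => //.
  split=> [c u v|x w]; apply: ind_unit_inj.
    by rewrite ind_unit_lin !fE ind_unit_lin thl.
  by rewrite fE !ind_unit_act tha fE.
have [w nw] := Wsim.1; exists w => fw0; apply: nw.
apply: ind_unit_inj; apply: (bij_inj thb); rewrite -fE fw0.
by rewrite !(is_linear0 (@ind_unit_lin _)) (is_linear0 thl).
Qed.

(* Were [W] and [W'] not isomorphic, compressing a matrix unit of [Ind W] to the
   corner would give an element with nonzero trace on [W], acting as zero on [W']. *)
Lemma character_inj chi : affords W chi -> affords W' chi -> amodule_iso W W'.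
Proof.
move=> /affordsP [n [b [z [bzB chiE]]]] /affordsP [n' [b' [z' [[zl' _ _] chiE']]]].
apply: contrapT => nWW'.
have Is := ind_simple Wsim; have Is' := ind_simple W'sim.
have [w nw] := Wsim.1.
have nu : ind_unit w <> 0 by rewrite -(is_linear0 (@ind_unit_lin W)) => /ind_unit_inj.
have [f [fl f1]] := exists_functional nu.
have [m [i [y iyB]]] := simple_basis (A_fin_dim F) Is.
pose E := matrix_unit (fun p => #|gT|%:R^-1 *: (mono K p : A)) (A_inv F) f (ind_unit w).
have [x xE] := corner_tga E.
have xW u : m.+1%:R *: am_act x u = f (ind_unit u) *: w.
  apply: ind_unit_inj; rewrite !(is_linearZ (@ind_unit_lin W)) ind_unit_act -xE !am_actM.
  rewrite ind_unit_idem -(is_linearZ (am_act_lin _ e)).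
  rewrite (matrix_unit_eq (A_separability F) (A_fin_dim F) Is fl _ _ iyB).
  by rewrite (is_linearZ (am_act_lin _ e)) ind_unit_idem.
have xW' u : am_act x u = 0 :> W'.
  apply: ind_unit_inj; rewrite ind_unit_act -xE !am_actM ind_unit_idem.
  rewrite (matrix_unit_neq (A_separability F) Is fl _ _ Is') => [|/ind_iso_inv //].
  by rewrite (is_linear0 (am_act_lin _ e)) (is_linear0 (@ind_unit_lin W')).
have chi0 : chi x = 0.
  by rewrite chiE' big1 // => k _; rewrite xW' (is_linear0 (zl' k)).
(* On [W], [m.+1] times [x] is the rank one operator [u |-> f (ind_unit u) *: w], whose trace is
   [f (ind_unit w) = 1]. *)
have : m.+1%:R * chi x = 1.
  rewrite chiE mulr_sumr -[RHS]f1.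
  have /= <- := trace_rank1 w bzB (is_linear_comp fl (@ind_unit_lin W)).
  apply: eq_bigr => k _; rewrite -xW; have [zl _ _] := bzB.
  by rewrite (is_linearZ (zl k)).
by move/eqP; rewrite chi0 mulr0 eq_sym oner_eq0.
Qed.
End InducedPair.

(** The character of the corner is an irreducible character [lambda], but [irr_mod lambda] is only
    some simple module affording it; [character_inj] identifies it with the corner. The inclusion of
    the corner then lifts to a nonzero map between simple modules. *)
Lemma induced_from_stabilizer (Y : amodule A) : simple_amodule Y ->
  (exists2 y : Y, am_act e y = y & y <> 0) ->
  exists lambda : irr_char Q, amodule_iso (ind_irr lambda) Y.
Proof.
move=> Ys Ye; have Cs := corner_simple Ys Ye.
have [n [b [z bzB]]] := exists_basis (simple_fin_dim (mono_fin_dim _) Cs).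
pose chi a := \sum_i z i (am_act a (b i)).
have Cchi : affords (corner_mod Y) chi by apply/affordsP; exists n, b, z.
pose lambda : irr_char Q := exist _ chi (ex_intro2 _ _ _ Cs Cchi); exists lambda.
have Is := ind_simple (irr_mod_simple lambda).
have [f [fl fb] fa] : amodule_iso (irr_mod lambda) (corner_mod Y).
  apply: (character_inj (irr_mod_simple lambda) Cs (chi := chi)) => //.
  exact: irr_mod_affords lambda.
have [|x w|h hh hE] := @ind_lift _ Y (fun w => corner_val (f w)).
- exact: is_linear_comp (@corner_val_lin Y) fl.
- by rewrite fa.
apply: schur_iso hh _ => //; have [w nw] := (irr_mod_simple lambda).1.
exists (ind_unit w); rewrite /ind_unit hE [D_val _]/(e) corner_valP.
rewrite -(is_linear0 (@corner_val_lin Y)) => /val_inj fw; apply: nw.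
by apply: (bij_inj fb); rewrite fw (is_linear0 fl).
Qed.

(** * Frobenius reciprocity for the multiplicity spaces *)

Section Frobenius.
Variable W : amodule Q.
Local Notation N := (mult_space W (mod_bimodule F s)).
Local Notation IndW := (ind_module W).

Lemma A_act_tga (x : Q) (m : gs_mod s) : A_act (tga_inj x) (gs_inj m) = gs_inj (tga_act x m).
Proof.
have al := @am_act_linl _ _ (bm_amod BT) (gs_inj m).
apply: (mono_lin_eq (f := fun x : Q => A_act (tga_inj x) (gs_inj m))
  (h := fun x : Q => gs_inj (tga_act x m))) => [c u v|c u v|h].
- by rewrite tga_inj_lin; apply: al.
- have [tl _ _ _] := tga_actP F s; by rewrite tl gs_inj_lin.
- by rewrite tga_inj_mono A_act_mono [tga_act _ _]mono_extE stab_op_inj.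
Qed.

Fact frobenius_ex (n : N) : exists2 h : IndW -> bm_amod BT, amod_hom h &
  forall w, h (ind_unit w) = gs_inj (hom_fun n w).
Proof.
have [nl na] := hom_funP n.
have [c u v|x w|h hh hE] := @ind_lift W (bm_amod BT) (fun w => gs_inj (hom_fun n w)).
- by rewrite nl gs_inj_lin.
- by rewrite na [RHS]A_act_tga.
exists h => // w; rewrite [LHS]hE [D_val _]/(e) [LHS]A_act_mono.
by rewrite gs_op1 gs_inj_eq.
Qed.

Definition frobenius (n : N) : IndW -> BT := s2val (cid2 (frobenius_ex n)).

Lemma frobenius_hom n : amod_hom (Y := bm_amod BT) (frobenius n).
Proof. exact: s2valP (cid2 (frobenius_ex n)). Qed.

Lemma frobeniusE n w : frobenius n (ind_unit w) = gs_inj (hom_fun n w).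
Proof. by have := s2valP' (cid2 (frobenius_ex n)); apply. Qed.

Lemma ind_hom_eq (Y : amodule A) (f g : IndW -> Y) : amod_hom f -> amod_hom g ->
  (forall w, f (ind_unit w) = g (ind_unit w)) -> f =1 g.
Proof.
move=> [fl fa] [gl ga] fg; apply: ind_stable_all => //.
split=> [|c z fgz]; first exact: subspace_eq.
by rewrite fa ga fgz.
Qed.

Lemma frobenius_lin z : is_linear (fun n => frobenius n z).
Proof.
move=> c n n'; move: z; have [nl na] := frobenius_hom n; have [nl' na'] := frobenius_hom n'.
apply: (ind_hom_eq (Y := bm_amod BT) (frobenius_hom _)
  (g := fun z => c *: frobenius n z + frobenius n' z)) => [|w].
  split=> [k u v|k u].
    by rewrite nl nl' !scalerDr !scalerA mulrC addrACA.
  by rewrite na na' (am_act_lin (bm_amod BT) k).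
by rewrite !frobeniusE (hom_fun_lin w) gs_inj_lin.
Qed.

Lemma frobenius_inj n : (forall z, frobenius n z = 0) -> n = 0.
Proof.
move=> n0; apply: hom_eqP => w; apply: gs_inj_inj; rewrite -frobeniusE n0.
by rewrite (is_linear0 (hom_fun_lin w)) (is_linear0 (@gs_inj_lin _ _ _ _ S s)).
Qed.

Lemma frobenius_surj (f : IndW -> BT) : amod_hom (Y := bm_amod BT) f ->
  exists n, frobenius n =1 f.
Proof.
move=> fh; have [fl fa] := fh; pose m (w : W) : gs_mod s := gs_coord (f (ind_unit w)) s.
have mE w : gs_inj (m w) = f (ind_unit w).
  rewrite -[in RHS]ind_unit_idem fa [RHS]A_act_mono; exact/esym/gs_op1.
have [|n nE] := @exists_hom _ _ _ (mod_bimodule F s) W m.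
  split=> [c u v|x w]; first by rewrite /m ind_unit_lin fl gs_coord_lin.
  by apply: gs_inj_inj; rewrite mE ind_unit_act fa -mE [LHS]A_act_tga.
exists n; apply: (ind_hom_eq (Y := bm_amod BT)) => // [|w]; first exact: frobenius_hom.
by rewrite frobeniusE nE mE.
Qed.

Lemma frobenius_mode v k n z : frobenius (pm_mode v k n) z = pm_mode v k (frobenius n z).
Proof.
have [nl na] := frobenius_hom n; have ml := @pm_mode_lin _ _ BT v k.
move: z; apply: (ind_hom_eq (Y := bm_amod BT) (frobenius_hom _)
  (g := fun z => pm_mode v k (frobenius n z))) => [|w].
  split=> [c u u'|c u]; first by rewrite nl ml.
  by rewrite na; apply/esym/bm_comm.
by rewrite !frobeniusE; apply: gs_inj_mode.
Qed.

(** Through this isomorphism the properties proved for homomorphisms over [A_alpha(G, S)] pass to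
    [Hom(W, M^j)]. *)
Lemma frobenius_iso : module_iso N (mult_space IndW BT).
Proof.
have /(_ _)/cid h : forall n, exists f : mult_space IndW BT, hom_fun f = frobenius n.
  by move=> n; apply: exists_hom; apply: frobenius_hom.
pose f n := projT1 (h n); have fE n : hom_fun (f n) = frobenius n by exact: projT2 (h n).
have fl : is_linear f.
  by move=> c n n'; apply: hom_eqP => z; rewrite (hom_fun_lin z) !fE (frobenius_lin z).
exists f => [|v k n]; last first.
  by apply: hom_eqP => z; rewrite fE frobenius_mode -fE.
split=> //; apply: inj_surj_bijective.
  apply: (inj_linear fl) => n fn0; apply: frobenius_inj => z.
  by rewrite -fE fn0 (is_linear0 (hom_fun_lin z)).
move=> g; have [n nE] := frobenius_surj (hom_funP g); exists n.
by apply: hom_eqP => z; rewrite fE nE.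
Qed.
End Frobenius.
End Corner.

(** The idempotent of [t] fixes the nonzero image of [ind_unit] in the module induced from [t], but
    kills every module induced from outside the orbit of [t]. *)
Lemma ind_iso_orbit (K : numClosedFieldType) (V : voa K) (gT : finGroupType)
    (G : aut_group V gT) (S : gstable_set G) (F : intertwiners S) (s t : S)
    (W : amodule (tga F s)) (W' : amodule (tga F t)) : simple_amodule W' ->
  amodule_iso (ind_module W) (ind_module W') -> t \in gs_orbit s.
Proof.
move=> [[w nw] _] [th [thl [g thK gK]] tha].
case: (boolP (t \in gs_orbit s)) => // nt; case: nw; apply: ind_unit_inj.
rewrite (is_linear0 (@ind_unit_lin _ _ _ _ _ _ _ W')) -ind_unit_idem.
rewrite -[ind_unit w]gK -tha ind_idem0 ?(is_linear0 thl) // => h st.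
by case/imsetP: nt; exists h.
Qed.

Theorem theorem6p13 (R : realType) (V : voa R[i]) (hV : simple_voa V)
    (gT : finGroupType) (G : aut_group V gT)
    (S : gstable_set G) (F : intertwiners S)
    (J : finType) (rep : J -> S)
    (hrep : forall s : S, exists! j : J, s \in gs_orbit (rep j)) :
  let Lambda j := irr_char (tga F (rep j)) in
  [/\ bimodule_iso (total_bimodule F)
        (dsum_bimodule (fun p : {j : J & Lambda j} =>
           tens_bimodule (ind_irr (projT2 p)) (mult_irr (projT2 p)))),
      forall (j : J) (lambda : Lambda j),
        is_module (mult_irr lambda) /\ irreducible (mult_irr lambda),
      forall p1 p2 : {j : J & Lambda j},
        module_iso (mult_irr (projT2 p1)) (mult_irr (projT2 p2)) <-> p1 = p2
    & dual_pair (total_bimodule F)].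
Proof.
move=> Lambda; pose T := {j : J & Lambda j}.
have Isim (p : T) : simple_amodule (ind_irr (projT2 p)).
  exact: ind_simple (irr_mod_simple _).
have Iinj (p q : T) : amodule_iso (ind_irr (projT2 p)) (ind_irr (projT2 q)) -> p = q.
  case: p q => [j l] [k m] /= iso.
  have jk : j = k.
    have [i [_ iu]] := hrep (rep k); rewrite -(iu k); last first.
      by apply/imsetP; exists 1%g; rewrite ?inE ?gs_act1.
    by rewrite -(iu j) //; apply: ind_iso_orbit iso; apply: irr_mod_simple.
  move: m iso; rewrite -jk => m iso; congr (existT _ j _).
  by apply: irr_mod_inj; apply: ind_iso_inv iso; apply: irr_mod_simple.
(* A nonzero vector of [Y] has a nonzero component at some [t]; moved to the representative of the
   orbit of [t], it makes the corner there nonzero. *)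
have Iall Y : simple_amodule Y -> exists p : T, amodule_iso (ind_irr (projT2 p)) Y.
  move=> Ys; have [y ny] := Ys.1; have [t nt] := exists_idem_neq0 ny.
  have [j [/imsetP[g _ tg] _]] := hrep t; rewrite tg in nt.
  have [c [ec nc]] := idem_orbit nt.
  have [|l lY] := @induced_from_stabilizer _ _ _ _ _ F (rep j) Y Ys.
    by exists (am_act c y).
  by exists (existT _ j l).
have frob (p : T) := frobenius_iso (irr_mod (projT2 p)).
split=> [|j l|p q|].
- apply: (isotypic_decomposition (A_separability F) (A_fin_dim F)
    (ev := fun p : T => @frobenius _ _ _ _ _ F (rep (projT1 p)) (irr_mod (projT2 p)))) => //.
  + by move=> p x; apply: frobenius_lin.
  + by move=> p n; apply: frobenius_hom.
  + by move=> p n; apply: frobenius_inj.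
  + by move=> p f; apply: frobenius_surj.
  + by move=> p v k n x; apply: frobenius_mode.
- have iso := module_iso_sym (frob (existT _ j l)); have Is := Isim (existT _ j l).
  split; first exact: module_iso_module iso (mult_space_total_module Is).
  exact: module_iso_irreducible iso (mult_space_total_irreducible hV Is).
- split=> [iso|->]; last exact: module_iso_refl.
  apply: Iinj; apply: (mult_space_total_inj hV) => //.
  exact: module_iso_trans (module_iso_sym (frob p)) (module_iso_trans iso (frob q)).
- exact: total_dual_pair.
Qed.
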